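(* Let $\Phi:\mathbb{R}^2\to\mathbb{R}^2$ be a smooth mapping, let $\Sigma=\{x\in\mathbb{R}^2:\Phi(x)=x\}$ be its fixed point set, and let $S:\mathbb{R}^2\to\mathbb{R}$ be defined by $S(x)=\sigma(\Phi(x),x)$, where $\sigma(x,x')=\tfrac12|x-x'|^2$. Assume: ($\Phi$.1) $\Sigma$ is a smooth compact connected one-dimensional submanifold of $\mathbb{R}^2$ without boundary. ($\Phi$.2) There exist constants $p>0$, $R>0$, $C>0$ such that for any $x\in\mathbb{R}^2$, if $\sigma(x,0)>\frac{R^2}{2}$, then $S(x)\geqslant C[\sigma(x,0)]^p$. ($\Phi$.3) $s_2=\nabla_{\mathbf h}^2S|_\Sigma>0$ at all points of $\Sigma$, where $s_k=\nabla^k_{\mathbf h}S|_\Sigma$ is the $k$-th normal derivative of $S$ on $\Sigma$. Then there exists the asymptotic expansion as $t\to0^+$ $$\Theta_\Phi(t)\sim\sum_{k=0}^\infty t^{(2k-1)/2}A_k,$$ where the coefficients $A_k$ are locally computable in the form $$A_k=\int_\Sigma \mathrm{dvol}(y)\,a_k(y),$$ and $a_k$ are scalars on $\Sigma$ depending polynomially on $s_2^{-1/2}$ and $s_k$, $k\geqslant3$.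
   Context: The plane $\mathbb{R}^2$ carries the Euclidean metric, with heat kernel $U(t;x,x')=(4\pi t)^{-1}\exp\left(-\frac{\sigma(x,x')}{2t}\right)$. The deformed heat trace is $$\Theta_\Phi(t)=\int_{\mathbb{R}^2}dx\,U(t;\Phi(x),x)=(4\pi t)^{-1}\int_{\mathbb{R}^2}dx\,\exp\left(-\frac{1}{2t}S(x)\right).$$ $\mathbf h$ is a smooth unit normal vector field along $\Sigma$, and $\nabla_{\mathbf h}$ is the corresponding normal derivative, so that $s_k(y)=\frac{d^k}{dz^k}\big|_{z=0}S(f(y)+z\,\mathbf h(y))$, where $x=f(y)$ is a parametrization of $\Sigma$; $\mathrm{dvol}(y)$ is the arc-length element of $\Sigma$. The asymptotic expansion $F(t)\sim\sum_k t^{(2k-1)/2}A_k$ means that for every $K$, $F(t)-\sum_{k=0}^{K}t^{(2k-1)/2}A_k=o(t^{(2K-1)/2})$ as $t\to0^+$.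
   Formalization: The scalars a_k are shown to depend polynomially on s_2^{-1/2}, s_k (k≥3) and also the signed curvature of Σ; without the curvature the claim fails for universal polynomials, e.g. on circles of varying radius with s_3≠0, where A_1 contains a curvature·s_3·s_2^{-5/2} term. *)

(* Defs.v *)
From mathcomp Require Import all_boot all_order all_algebra.
From mathcomp Require Import all_classical all_reals all_analysis.
(* Not imported: the notations of [mpoly] clash with those of analysis. *)
From mathcomp Require mpoly.

Set Implicit Arguments.
Unset Strict Implicit.
Unset Printing Implicit Defensive.

Import Order.TTheory GRing.Theory Num.Theory.
Import numFieldNormedType.Exports.

Local Open Scope classical_set_scope.
Local Open Scope ring_scope.

(* The canonical norm of [R * R] is the sup norm; it induces the Euclidean
   topology and the usual notions of differentiability, but lengths and angles
   have to be expressed with the Euclidean inner product. *)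
Definition dot (R : realType) (u v : R * R) : R := u.1 * v.1 + u.2 * v.2.

Definition enorm (R : realType) (u : R * R) : R := Num.sqrt (dot u u).

(* World function: half the squared Euclidean distance. *)
Definition world_fun (R : realType) (x x' : R * R) : R := enorm (x - x') ^+ 2 / 2.

(* C^n maps on an open set, through iterated directional derivatives; on a
   finite-dimensional space [V] this is the usual notion. *)
Fixpoint Cn_on (R : realType) (V W : normedModType R) (n : nat) (U : set V)
    (f : V -> W) {struct n} : Prop :=
  match n with
  | 0 => forall x, U x -> {for x, continuous f}
  | m.+1 => (forall x, U x -> differentiable f x) /\
            (forall v : V, Cn_on m U (fun x => 'D_v f x))
  end.

Definition smooth_on (R : realType) (V W : normedModType R) (U : set V)
    (f : V -> W) : Prop := forall n, Cn_on n U f.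

Definition smooth (R : realType) (V W : normedModType R) (f : V -> W) : Prop :=
  smooth_on setT f.

(* One-dimensional (embedded) submanifold of the plane without boundary:
   every point has a slice chart, [psi] being the inverse diffeomorphism. *)
Definition curve_submanifold (R : realType) (M : set (R * R)) : Prop :=
  forall x, M x ->
  exists (U V : set (R * R)) (phi psi : R * R -> R * R),
    [/\ open U, open V & U x] /\
    [/\ smooth_on U phi, smooth_on V psi,
        (forall u, U u -> V (phi u) /\ psi (phi u) = u) &
        (forall v, V v -> U (psi v) /\ phi (psi v) = v)] /\
    (forall u, U u -> (M u <-> (phi u).2 = 0)).

(* Smoothness of a map that only matters on [M]: local extension property. *)
Definition smooth_along (R : realType) (M : set (R * R))
    (h : R * R -> R * R) : Prop :=
  forall x, M x -> exists (U : set (R * R)) (g : R * R -> R * R),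
    [/\ open U, U x, smooth_on U g & forall u, U u -> M u -> g u = h u].

Definition tangent (R : realType) (M : set (R * R)) (x v : R * R) : Prop :=
  exists c : R -> R * R,
    [/\ smooth c, c 0 = x, (\forall t \near (0 : R), M (c t)) &
        derive1 c 0 = v].

Definition unit_normal_field (R : realType) (M : set (R * R))
    (h : R * R -> R * R) : Prop :=
  smooth_along M h /\
  forall x, M x -> enorm (h x) = 1 /\ forall v, tangent M x v -> dot (h x) v = 0.

(* Regular smooth parametrization of [M] as a simple closed curve, seen as an
   [L]-periodic function on the line. *)
Definition closed_param (R : realType) (M : set (R * R)) (L : R)
    (f : R -> R * R) : Prop :=
  [/\ 0 < L, smooth f & forall y, derive1 f y <> 0] /\
  [/\ forall y, f (y + L) = f y,
      {in `[0, L[%R &, injective f} &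
      f @` `[0, L]%classic = M].

(* [A] is the integral of [a] over [M] for the arc-length element: [M] has a
   parametrization and all parametrizations give the value [A]. *)
Definition is_arc_integral (R : realType) (M : set (R * R)) (a : R * R -> R)
    (A : R) : Prop :=
  (exists L f, closed_param M L f) /\
  forall L f, closed_param M L f ->
    A = \int[lebesgue_measure]_(y in `[0, L]) (a (f y) * enorm (derive1 f y)).

(* Signed curvature at [f y] of the curve [f] with respect to the normal [h].
   The map (y, z) |-> f y + z *: h (f y) has Jacobian
   enorm (derive1 f y) * (1 - z * curvature h f y), up to sign. *)
Definition curvature (R : realType) (h : R * R -> R * R) (f : R -> R * R)
    (y : R) : R :=
  dot (derive1n 2 f y) (h (f y)) / enorm (derive1 f y) ^+ 2.

Definition fixed_points (R : realType) (Phi : R * R -> R * R) : set (R * R) :=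
  [set x | Phi x = x].

Definition half_sqr_displacement (R : realType) (Phi : R * R -> R * R) (x : R * R) : R :=
  world_fun (Phi x) x.

Definition normal_derivative (R : realType) (h : R * R -> R * R)
    (S : R * R -> R) (k : nat) (x : R * R) : R :=
  derive1n k (fun z : R => S (x + z *: h x)) 0.

Definition heat_kernel (R : realType) (t : R) (x x' : R * R) : R :=
  (4 * pi * t)^-1 * expR (- (world_fun x x' / (2 * t))).

Definition plane_measure (R : realType) :=
  (@lebesgue_measure R \x @lebesgue_measure R)%E.

(* Junk value 0 if the integral diverges, hence [theta_cvg]. *)
Definition theta (R : realType) (Phi : R * R -> R * R) (t : R) : R :=
  \int[@plane_measure R]_x heat_kernel t (Phi x) x.

Definition theta_cvg (R : realType) (Phi : R * R -> R * R) (t : R) : Prop :=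
  (@plane_measure R).-integrable setT
    (fun x => (heat_kernel t (Phi x) x)%:E).

Definition asymptotic_expansion (R : realType) (F : R -> R) (A : nat -> R) :
    Prop :=
  forall K : nat,
    (fun t : R => F t -
       \sum_(0 <= k < K.+1) t `^ (((2 * k)%N%:R - 1) / 2) * A k)
    =o_ (0^'+) (fun t : R => t `^ (((2 * K)%N%:R - 1) / 2)).

(* Values substituted for the variables 0, 1, 2, 3, ... of the universal
   polynomials: kappa, s_2^(-1/2), s_3, s_4, ...  The curvature kappa of the
   curve has to be among them: it enters through the Jacobian of the normal
   coordinates, e.g. as a term in kappa * s_3 * s_2^(-5/2) in a_1. *)
Definition local_data (R : realType) (kappa : R) (s : nat -> R) (i : nat) : R :=
  match i with
  | 0 => kappa
  | 1 => s 2%N `^ (- (1 / 2))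
  | j.+2 => s j.+3
  end.

(* Main.v *)
(* Laplace's method in normal coordinates. The curve of fixed points has a
   closed regular parametrization [f]: the integral curves of the rotated
   normal field exist for all times by compactness, fill the curve by
   connectedness and close up by compactness. On a tube around the curve the
   coordinates (y, z) |-> f y + z n y have Jacobian |f'| (1 - z kappa), and
   S is bounded below off the tube, so that the rest of the plane contributes
   O(t^infinity). Inside, with t = tau^2 and z = tau w, the exponent
   -S / (2 t) is -s_2 w^2 / 4 plus a polynomial in tau (up to Taylor remainder)
   without constant term, whose exponential is expanded in powers of tau
   uniformly in y; integrating against exp(-s_2 w^2 / 4) gives the local
   coefficients, the odd powers vanishing by w |-> - w. Since an asymptotic
   expansion is unique, the integrals of the coefficients do not depend on the
   parametrization. *)
Require Import Defs.
From mathcomp Require Import all_boot all_order all_algebra.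
From mathcomp Require Import all_classical all_reals all_analysis.
From mathcomp Require mpoly.
From mathcomp Require Import measurable_realfun ring lra.

Set Implicit Arguments.
Unset Strict Implicit.
Unset Printing Implicit Defensive.

Import Order.TTheory GRing.Theory Num.Theory.
Import numFieldNormedType.Exports.

Local Open Scope classical_set_scope.
Local Open Scope ring_scope.
Import (canonicals) mpoly.

(** The order N is fixed first, then a bound B on the normal jets and a lower bound c0 of s_2, and
    only then the half-width eps of the tube, so small that the corrections to the Gaussian exponent
    stay below a fraction of c0 w^2 whenever |tau w| <= eps. The tube shrinks as the order grows,
    but the coefficients are independent of eps. The change of variables in the plane is pieced
    together from one-dimensional ones: n is a unit vector, so one of its components is nonzero near
    any given parameter, and slicing by lines parallel to an axis becomes possible. The slices are
    under control only away from the rim of the tube; hence test functions that vanish for |z|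
    between eps / 2 and eps, and a continuous truncation of the heat factor. Polynomial dependence
    holds by construction: the coefficients of the exponential are defined by a recursion in an
    arbitrary commutative ring, run once over polynomials in the local data and once over the reals,
    and evaluation is a ring morphism. *)

(** * Calculus of C^n maps *)

Section CnCalculus.
Context {R : realType}.

Section general.
Variables (V W : normedModType R).
Implicit Types (U : set V) (f g : V -> W).

Lemma Cn_onW n U f : Cn_on n.+1 U f -> Cn_on n U f.
Proof.
elim: n f => [f [df _] x Ux|n IH f [df Df]].
  exact: differentiable_continuous (df x Ux).
by split=> // v; apply: IH; apply: Df.
Qed.

Lemma Cn_on_continuous n U f x : Cn_on n U f -> U x -> {for x, continuous f}.
Proof. by elim: n f => [f h Ux|n IH f /Cn_onW]; [exact: h|exact: IH]. Qed.

Lemma Cn_onS n U U' f : U' `<=` U -> Cn_on n U f -> Cn_on n U' f.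
Proof.
move=> sU; elim: n f => [f h x /sU|n IH f [df Df]]; first exact: h.
split=> [x /sU Ux|v]; first exact: df.
exact: IH (Df v).
Qed.

(** The first-order expansion of f is also one of g, and it determines the differential. *)
Lemma near_eq_differentiable f g x : {near x, f =1 g} ->
  differentiable f x -> differentiable g x.
Proof.
move=> fg df; have fgx : f x = g x by exact: nbhs_singleton fg.
have cd : continuous ('d f x) by exact: diff_continuous.
have gE : g \o shift x = cst (g x) + 'd f x +o_ 0 id.
  apply/eqaddoP => _/posnumP[e].
  have /eqaddoP/(_ _ (gt0 e)) := diff_locally df.
  move: fg; rewrite -near_simpl (near_shift 0) /= => fg0.
  apply: filterS2 fg0 => h; rewrite subr0 /= => fgh.
  by rewrite !fctE /= fgx fgh.
apply/diff_locallyP; have dE := diff_unique cd gE.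
by split; rewrite dE.
Qed.

(** [U] is open so that equality on [U] is equality near each of its points and passes to
    derivatives. The closure properties below use this to replace a derivative by its formula, which
    is available on [U] only. *)
Lemma eq_Cn_on n U f g : open U -> (forall x, U x -> f x = g x) ->
  Cn_on n U f -> Cn_on n U g.
Proof.
move=> oU; elim: n f g => [f g fg h x Ux|n IH f g fg [df Df]].
  have fgx : {near x, f =1 g}.
    by near=> y; apply: fg; near: y; exact: open_nbhs_nbhs.
  have gx : f x @[x --> x] --> g x by rewrite -(fg x Ux); exact: h.
  by apply: cvg_trans gx; apply: near_eq_cvg; apply: filterS fgx.
have near_fg x : U x -> {near x, f =1 g}.
  by move=> Ux; near=> y; apply: fg; near: y; exact: open_nbhs_nbhs.
split=> [x Ux|v]; first exact: near_eq_differentiable (near_fg x Ux) (df x Ux).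
apply: IH (Df v) => x Ux; exact: near_eq_derive (near_fg x Ux).
Unshelve. all: by end_near. Qed.

Lemma Cn_cst n U (a : W) : Cn_on n U (fun=> a).
Proof.
elim: n a => [a x _|n IH a]; first exact: cvg_cst.
split=> [x _|v]; first exact: differentiable_cst.
rewrite (_ : 'D_v (fun=> a) = fun=> 0) //.
by apply/funext => x; exact: derive_cst.
Qed.

Lemma Cn_add n U f g : open U -> Cn_on n U f -> Cn_on n U g ->
  Cn_on n U (fun x => f x + g x).
Proof.
move=> oU; elim: n f g => [f g cf cg x Ux|n IH f g [df Df] [dg Dg]].
  by apply: cvgD; [exact: cf|exact: cg].
split=> [x Ux|v]; first by apply: differentiableD; [exact: df|exact: dg].
apply: eq_Cn_on oU _ (IH _ _ (Df v) (Dg v)) => x Ux.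
by rewrite deriveD //; apply: diff_derivable; [exact: df|exact: dg].
Qed.

Lemma Cn_scale n U (k : R) f : open U -> Cn_on n U f ->
  Cn_on n U (fun x => k *: f x).
Proof.
move=> oU; elim: n f => [f cf x Ux|n IH f [df Df]].
  by apply: cvgZr; exact: cf.
split=> [x Ux|v]; first by apply: differentiableZ; exact: df.
apply: eq_Cn_on oU _ (IH _ (Df v)) => x Ux.
by rewrite deriveZ //; apply: diff_derivable; exact: df.
Qed.

End general.

Lemma Cn_opp (V W : normedModType R) n U (f : V -> W) : open U ->
  Cn_on n U f -> Cn_on n U (fun x => - f x).
Proof.
move=> oU /(Cn_scale (-1) oU); apply: eq_Cn_on oU _ => x Ux.
by rewrite scaleN1r.
Qed.

Lemma Cn_sub (V W : normedModType R) n U (f g : V -> W) : open U ->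
  Cn_on n U f -> Cn_on n U g -> Cn_on n U (fun x => f x - g x).
Proof. by move=> oU cf cg; apply: Cn_add => //; exact: Cn_opp. Qed.

Lemma continuous_fst (A B : topologicalType) : continuous (fst : A * B -> A).
Proof. by move=> x; exact: cvg_fst. Qed.

Lemma continuous_snd (A B : topologicalType) : continuous (snd : A * B -> B).
Proof. by move=> x; exact: cvg_snd. Qed.

Lemma continuous_pair (A B C : topologicalType) (f : A -> B) (g : A -> C) x :
  {for x, continuous f} -> {for x, continuous g} ->
  {for x, continuous (fun y => (f y, g y))}.
Proof. by move=> cf cg; exact: cvg_pair. Qed.

Section domain.
Variable V : normedModType R.
Implicit Types (U : set V).

Lemma Cn_mul n U (f g : V -> R) : open U -> Cn_on n U f -> Cn_on n U g ->
  Cn_on n U (fun x => f x * g x).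
Proof.
move=> oU; elim: n f g => [f g cf cg x Ux|n IH f g cf cg].
  by apply: cvgM; [exact: cf|exact: cg].
have [df Df] := cf; have [dg Dg] := cg.
split=> [x Ux|v]; first by apply: differentiableM; [exact: df|exact: dg].
have := Cn_add oU (IH _ _ (Cn_onW cf) (Dg v)) (IH _ _ (Cn_onW cg) (Df v)).
apply: eq_Cn_on oU _ => x Ux.
by rewrite deriveM //; apply: diff_derivable; [exact: df|exact: dg].
Qed.

Lemma derive_pair (f g : V -> R) x v : differentiable f x -> differentiable g x ->
  'D_v (fun y => (f y, g y)) x = ('D_v f x, 'D_v g x).
Proof.
move=> df dg; have dp := differentiable_pair df dg.
by rewrite !deriveE // diff_pair.
Qed.

Lemma Cn_pair n U (f g : V -> R) : open U -> Cn_on n U f -> Cn_on n U g ->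
  Cn_on n U (fun x => (f x, g x)).
Proof.
move=> oU; elim: n f g => [f g cf cg x Ux|n IH f g [df Df] [dg Dg]].
  by apply: continuous_pair; [exact: cf|exact: cg].
split=> [x Ux|v]; first by apply: differentiable_pair; [exact: df|exact: dg].
apply: eq_Cn_on oU _ (IH _ _ (Df v) (Dg v)) => x Ux.
by rewrite derive_pair //; [exact: df|exact: dg].
Qed.

Lemma differentiable_fst (p : R * R) : differentiable (fst : R * R -> R) p.
Proof.
by apply: (@linear_differentiable _ _ _ (fst : {linear (R * R)%type -> R})); exact: continuous_fst.
Qed.

Lemma differentiable_snd (p : R * R) : differentiable (snd : R * R -> R) p.
Proof.
by apply: (@linear_differentiable _ _ _ (snd : {linear (R * R)%type -> R})); exact: continuous_snd.
Qed.

Lemma derive_fst (f : V -> R * R) x v : differentiable f x ->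
  'D_v (fun y => (f y).1) x = ('D_v f x).1.
Proof.
move=> df; have dg := differentiable_comp df (differentiable_fst (f x)).
rewrite deriveE // deriveE // (diff_comp df (differentiable_fst _)) /=.
by rewrite (@diff_lin _ _ _ (fst : {linear (R * R)%type -> R})) //; exact: continuous_fst.
Qed.

Lemma derive_snd (f : V -> R * R) x v : differentiable f x ->
  'D_v (fun y => (f y).2) x = ('D_v f x).2.
Proof.
move=> df; have dg := differentiable_comp df (differentiable_snd (f x)).
rewrite deriveE // deriveE // (diff_comp df (differentiable_snd _)) /=.
by rewrite (@diff_lin _ _ _ (snd : {linear (R * R)%type -> R})) //; exact: continuous_snd.
Qed.

Lemma Cn_fst n U (f : V -> R * R) : open U -> Cn_on n U f ->
  Cn_on n U (fun x => (f x).1).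
Proof.
move=> oU; elim: n f => [f cf x Ux|n IH f [df Df]].
  by apply: continuous_comp; [exact: cf|exact: continuous_fst].
split=> [x Ux|v].
  exact: (differentiable_comp (df x Ux) (differentiable_fst _)).
by apply: eq_Cn_on oU _ (IH _ (Df v)) => x Ux; rewrite derive_fst //; exact: df.
Qed.

Lemma Cn_snd n U (f : V -> R * R) : open U -> Cn_on n U f ->
  Cn_on n U (fun x => (f x).2).
Proof.
move=> oU; elim: n f => [f cf x Ux|n IH f [df Df]].
  by apply: continuous_comp; [exact: cf|exact: continuous_snd].
split=> [x Ux|v].
  exact: (differentiable_comp (df x Ux) (differentiable_snd _)).
by apply: eq_Cn_on oU _ (IH _ (Df v)) => x Ux; rewrite derive_snd //; exact: df.
Qed.

Lemma derive_compE (V' W : normedModType R) (f : V -> V') (g : V' -> W) x v :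
  differentiable f x -> differentiable g (f x) ->
  'D_v (fun y => g (f y)) x = 'D_('D_v f x) g (f x).
Proof.
move=> df dg; have dgf := differentiable_comp df dg.
by rewrite deriveE // deriveE // deriveE // diff_comp.
Qed.

Lemma derive_planeE (W : normedModType R) (g : R * R -> W) x (v : R * R) :
  differentiable g x ->
  'D_v g x = v.1 *: 'D_(1, 0) g x + v.2 *: 'D_(0, 1) g x.
Proof.
move=> dg; rewrite !deriveE // -!linearZ -linearD; congr ('d g x _).
by case: v => a b; congr pair; rewrite /= ?scaler0 ?addr0 ?add0r // /GRing.scale /= mulr1.
Qed.

Lemma derive_lineE (W : normedModType R) (g : R -> W) x (v : R) :
  differentiable g x -> 'D_v g x = v *: 'D_1 g x.
Proof.
by move=> dg; rewrite !deriveE // -linearZ; congr ('d g x _); rewrite /GRing.scale /= mulr1.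
Qed.

(** The direction ['D_v f x] in the chain rule varies with x, whereas [Cn_on] differentiates in
    constant directions. Splitting it along the two axes gives products of functions of the lower
    class, and the induction runs over all g. *)
Lemma Cn_comp_plane n U (W : set (R * R)) (f : V -> R * R) (g : R * R -> R) :
  open U -> (forall x, U x -> W (f x)) -> Cn_on n U f -> Cn_on n W g ->
  Cn_on n U (fun x => g (f x)).
Proof.
move=> oU UW; elim: n f g UW => [f g UW cf cg x Ux|n IH f g UW cf cg].
  by apply: continuous_comp; [exact: cf|exact: cg (UW _ Ux)].
have [df Df] := cf; have [dg Dg] := cg.
split=> [x Ux|v].
  exact: (differentiable_comp (df x Ux) (dg _ (UW _ Ux))).
have c1 := Cn_mul oU (Cn_fst oU (Df v)) (IH _ _ UW (Cn_onW cf) (Dg (1, 0))).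
have c2 := Cn_mul oU (Cn_snd oU (Df v)) (IH _ _ UW (Cn_onW cf) (Dg (0, 1))).
apply: eq_Cn_on oU _ (Cn_add oU c1 c2) => x Ux.
have dgx := dg _ (UW _ Ux).
by rewrite (derive_compE _ (df _ Ux) dgx) [RHS](derive_planeE _ dgx).
Qed.

Lemma Cn_comp_line n U (W : set R) (f : V -> R) (g : R -> R) :
  open U -> (forall x, U x -> W (f x)) -> Cn_on n U f -> Cn_on n W g ->
  Cn_on n U (fun x => g (f x)).
Proof.
move=> oU UW; elim: n f g UW => [f g UW cf cg x Ux|n IH f g UW cf cg].
  by apply: continuous_comp; [exact: cf|exact: cg (UW _ Ux)].
have [df Df] := cf; have [dg Dg] := cg.
split=> [x Ux|v].
  exact: (differentiable_comp (df x Ux) (dg _ (UW _ Ux))).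
have c1 := Cn_mul oU (Df v) (IH _ _ UW (Cn_onW cf) (Dg 1)).
apply: eq_Cn_on oU _ c1 => x Ux.
have dgx := dg _ (UW _ Ux).
by rewrite (derive_compE _ (df _ Ux) dgx) [RHS](derive_lineE _ dgx).
Qed.

Lemma Cn_id n U : Cn_on n U id.
Proof.
case: n => [x _|n]; first exact: cvg_id.
split=> [x _|v]; first exact: ex_diff.
rewrite (_ : 'D_v id = fun=> v); first exact: Cn_cst.
by apply/funext => x; rewrite derive_id.
Qed.

End domain.

Lemma Cn_comp_plane2 (V : normedModType R) n (U : set V) (W : set (R * R)) (f : V -> R * R) (g : R * R -> R * R) :
  open U -> open W -> (forall x, U x -> W (f x)) -> Cn_on n U f -> Cn_on n W g ->
  Cn_on n U (fun x => g (f x)).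
Proof.
move=> oU oW UW cf cg; rewrite (_ : (fun x => _) = fun x => ((g (f x)).1, (g (f x)).2)).
  apply: Cn_pair => //.
    exact: (Cn_comp_plane oU UW cf (Cn_fst oW cg)).
  exact: (Cn_comp_plane oU UW cf (Cn_snd oW cg)).
by apply/funext => x; rewrite -surjective_pairing.
Qed.

Lemma Cn_comp_line2 (V : normedModType R) n (U : set V) (W : set R) (f : V -> R) (g : R -> R * R) :
  open U -> open W -> (forall x, U x -> W (f x)) -> Cn_on n U f -> Cn_on n W g ->
  Cn_on n U (fun x => g (f x)).
Proof.
move=> oU oW UW cf cg; rewrite (_ : (fun x => _) = fun x => ((g (f x)).1, (g (f x)).2)).
  apply: Cn_pair => //.
    exact: (Cn_comp_line oU UW cf (Cn_fst oW cg)).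
  exact: (Cn_comp_line oU UW cf (Cn_snd oW cg)).
by apply/funext => x; rewrite -surjective_pairing.
Qed.

Lemma Cn_inv n (U : set R) : open U -> (forall x, U x -> x != 0) -> Cn_on n U (fun x => x^-1).
Proof.
move=> oU U0; elim: n => [x Ux|n IH].
  by apply: cvgV; [exact: U0|exact: cvg_id].
split=> [x Ux|v]; first by apply: differentiable_Rinv; exact: U0.
apply: eq_Cn_on oU _ (Cn_mul oU (Cn_cst n U (- v)) (Cn_mul oU IH IH)) => x Ux.
rewrite deriveV ?derive_id ?U0 //.
by rewrite /GRing.scale /= expr2 invfM; ring.
Qed.

(** Proved together, each being the derivative of the other up to sign. The sine serves later to
    squeeze the whole line into a bounded interval. *)
Lemma Cn_sin n (U : set R) : open U -> Cn_on n U sin /\ Cn_on n U cos.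
Proof.
move=> oU; elim: n => [|n [IHs IHc]].
  by split=> x _; [exact: continuous_sin|exact: continuous_cos].
split; split=> [x _|v].
- by apply/derivable1_diffP; exact: ex_derive.
- apply: eq_Cn_on oU _ (Cn_mul oU (Cn_cst n U v) IHc) => x Ux.
  rewrite derive_lineE ?derive_val //; apply/derivable1_diffP; exact: ex_derive.
- by apply/derivable1_diffP; exact: ex_derive.
- apply: eq_Cn_on oU _ (Cn_mul oU (Cn_cst n U (- v)) IHs) => x Ux.
  rewrite derive_lineE ?derive_val; first by rewrite /GRing.scale /= mulrN mulNr.
  by apply/derivable1_diffP; exact: ex_derive.
Qed.

End CnCalculus.

(** * Arc-length charts *)

Section OneVariable.
Context {R : realType}.

Lemma is_derive_differentiable (V : normedModType R) (f : R -> V) (x : R) d :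
  is_derive x 1 f d -> differentiable f x.
Proof. by move=> df; apply/derivable1_diffP; exact: ex_derive. Qed.

Lemma differentiable_is_derive (V : normedModType R) (f : R -> V) x :
  differentiable f x -> is_derive x 1 f ('D_1 f x).
Proof. by move=> df; apply: derivableP; exact: diff_derivable. Qed.

Lemma continuous_primitive (a b : R) (f : R -> R) : a < b ->
  {within `[a, b], continuous f} ->
  exists F : R -> R, forall x : R, a < x < b -> is_derive x 1 F (f x).
Proof.
move=> ab cf; exists (fun x => \int[lebesgue_measure]_(t in [set` `[a, x]]) f t).
move=> x /andP[ax xb].
have fi : lebesgue_measure.-integrable `[a, b] (EFin \o f).
  by apply: continuous_compact_integrable => //; exact: segment_compact.
have fx : {for x, continuous f}.
  have [+ _ _] := (continuous_within_itvP f ab).1 cf; apply.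
  by rewrite in_itv /= ax xb.
have [dF F'] := continuous_FTC1_closed xb fi ax fx.
by split; [exact: dF|rewrite -derive1E].
Qed.

Lemma open_itv (a b : R) : open [set x : R | a < x < b].
Proof.
rewrite (_ : [set x | _] = [set` `]a, b[%R]); first exact: interval_open.
by apply/seteqP; split => x /=; rewrite in_itv.
Qed.

(** Reparametrization by arc length: [L] is strictly increasing, and its inverse [m] is smooth
    because m' = 1 / l (m s) gains one derivative at each step of an induction. *)
Lemma primitive_inverse (r : R) (L l : R -> R) : 0 < r -> L 0 = 0 ->
  (forall u : R, - r < u < r -> is_derive u 1 L (l u)) ->
  (forall u : R, - r < u < r -> 0 < l u) ->
  smooth_on [set u : R | - r < u < r] l ->
  exists (d : R) (m : R -> R), [/\ 0 < d,
    (forall s : R, - d < s < d -> - r < m s < r /\ L (m s) = s),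
    (forall u : R, - r < u < r -> - d < L u < d -> m (L u) = u),
    (forall s : R, - d < s < d -> is_derive s 1 m (l (m s))^-1) &
    smooth_on [set s : R | - d < s < d] m].
Proof.
move=> r0 L0 dL l0 sl.
have cL (u : R) : - r < u < r -> {for u, continuous L}.
  by move=> ur; apply: differentiable_continuous; exact: is_derive_differentiable (dL u ur).
have incL (u v : R) : - r < u -> u < v -> v < r -> L u < L v.
  move=> ru uv vr.
  have sub (y : R) : y \in `[u, v]%R -> - r < y < r by rewrite in_itv /=; lra.
  have cuv : {within `[u, v], continuous L}.
    by apply: continuous_in_subspaceT => y; rewrite inE => /sub; exact: cL.
  have dL' (y : R) : y \in `]u, v[%R -> is_derive y 1 L (l y).
    by rewrite in_itv /= => uyv; apply: dL; lra.
  have [y yuv e] := MVT uv dL' cuv.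
  rewrite -subr_gt0 e; apply: mulr_gt0; last lra.
  by apply: l0; move: yuv; rewrite in_itv /=; lra.
have injL (u v : R) : - r < u < r -> - r < v < r -> L u = L v -> u = v.
  move=> ur vr e; have [uv|vu|//] := ltgtP u v.
    by have := incL u v; rewrite e ltxx; lra.
  by have := incL v u; rewrite e ltxx; lra.
(* Both [d] and [- d] lie between the values of [L] at the ends of the closed interval
   [[- (r / 2), r / 2]], where the intermediate value theorem applies. *)
pose d := Num.min (L (r / 2)) (- L (- (r / 2))).
have dpos : 0 < d.
  rewrite lt_min oppr_gt0 -{1}L0 -{2}L0; apply/andP; split; apply: incL; lra.
have ex (s : R) : exists u : R, - d < s < d -> - r < u < r /\ L u = s.
  have [sd|nsd] := boolP (- d < s < d); last by exists 0.
  have c2 : {within `[- (r / 2), r / 2], continuous L}.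
    apply: continuous_in_subspaceT => y; rewrite inE /= in_itv /= => yr.
    by apply: cL; lra.
  have dL1 : d <= L (r / 2) by rewrite /d ge_min lexx.
  have dL2 : d <= - L (- (r / 2)) by rewrite /d ge_min lexx orbT.
  have [||u ur Lu] := @IVT R L (- (r / 2)) (r / 2) s _ c2; first lra.
    have h : L (- (r / 2)) < L (r / 2) by apply: incL; lra.
    by rewrite minElt maxElt h; lra.
  by exists u => _; split => //; move: ur; rewrite in_itv /=; lra.
have [m mP] := choice ex.
have mL (u : R) : - r < u < r -> - d < L u < d -> m (L u) = u.
  by move=> ur Lud; have [mr e] := mP _ Lud; apply: injL.
have dm (s : R) : - d < s < d -> is_derive s 1 m (l (m s))^-1.
  move=> sd; have [mr e] := mP _ sd.
  have nr : \forall u \near m s, - r < u < r.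
    by apply: open_nbhs_nbhs; split => //; exact: open_itv.
  have nd : \forall u \near m s, - d < L u < d.
    have /(_ [set y : R | - d < y < d]) := cL _ mr; apply; rewrite e.
    by apply: open_nbhs_nbhs; split => //; exact: open_itv.
  rewrite -{1}e; apply: is_derive_inverse.
  - by near=> u; apply: mL; near: u.
  - by near=> u; apply: cL; near: u.
  - exact: dL.
  - by rewrite gt_eqF // l0.
have odd : open [set s : R | - d < s < d] by exact: open_itv.
exists d, m; split => // n; elim: n => [|n IH].
  by move=> s sd; apply: differentiable_continuous; exact: is_derive_differentiable (dm s sd).
split=> [s sd|v]; first exact: is_derive_differentiable (dm s sd).
pose P := [set y : R | 0 < y].
have oP : open P by exact: open_gt.
have c1 : Cn_on n [set s : R | - d < s < d] (fun s => l (m s)).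
  apply: (Cn_comp_line odd _ IH (sl n)) => s sd; by have [] := mP _ sd.
have c2 : Cn_on n P (fun y => y^-1).
  by apply: Cn_inv => // y y0; rewrite gt_eqF.
have c3 : Cn_on n [set s : R | - d < s < d] (fun s => (l (m s))^-1).
  apply: (Cn_comp_line odd _ c1 c2) => s sd; apply: l0; by have [] := mP _ sd.
apply: eq_Cn_on odd _ (Cn_scale v odd c3) => s sd.
have ds := dm s sd.
by rewrite derive_lineE ?derive_val //; exact: is_derive_differentiable ds.
Unshelve. all: by end_near. Qed.

End OneVariable.

Section PlaneGeometry.
Context {R : realType}.
Implicit Types (u v : R * R).

Definition rot90 u : R * R := (- u.2, u.1).

Lemma dotC u v : dot u v = dot v u.
Proof. by rewrite /dot; ring. Qed.

Lemma dotZl (a : R) u v : dot (a *: u) v = a * dot u v.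
Proof. by rewrite /dot /= /GRing.scale /=; ring. Qed.

Lemma dotZr (a : R) u v : dot u (a *: v) = a * dot u v.
Proof. by rewrite /dot /= /GRing.scale /=; ring. Qed.

Lemma dotDl u v w : dot (v + w) u = dot v u + dot w u.
Proof. by rewrite /dot /=; ring. Qed.

Lemma dot_ge0 u : 0 <= dot u u.
Proof. by rewrite /dot -!expr2 addr_ge0 // sqr_ge0. Qed.

Lemma dot_eq0 u : (dot u u == 0) = (u == 0).
Proof.
rewrite /dot -!expr2 paddr_eq0 ?sqr_ge0 // !sqrf_eq0.
by case: u => a b /=; rewrite xpair_eqE.
Qed.

Lemma enorm_sqr u : enorm u ^+ 2 = dot u u.
Proof. by rewrite /enorm sqr_sqrtr // dot_ge0. Qed.

Lemma enorm1P u : enorm u = 1 <-> dot u u = 1.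
Proof.
by split=> [e|e]; [rewrite -enorm_sqr e expr1n|rewrite /enorm e sqrtr1].
Qed.

Lemma normal_decomposition u v : dot u u = 1 -> dot u v = 0 ->
  v = dot v (rot90 u) *: rot90 u.
Proof.
case: u v => a b [c d]; rewrite /dot /rot90 /= => e1 e2.
rewrite /GRing.scale /= /GRing.scale /=; congr pair; rewrite /GRing.scale /=.
  have -> : (c * - b + d * a) * - b = c * (a * a + b * b) - a * (a * c + b * d) by ring.
  by rewrite e1 e2; ring.
have -> : (c * - b + d * a) * a = d * (a * a + b * b) - b * (a * c + b * d) by ring.
by rewrite e1 e2; ring.
Qed.

Lemma Cn_dot (V : normedModType R) n (U : set V) (f g : V -> R * R) : open U ->
  Cn_on n U f -> Cn_on n U g -> Cn_on n U (fun x => dot (f x) (g x)).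
Proof.
move=> oU cf cg; apply: Cn_add => //; apply: Cn_mul => //.
- exact: Cn_fst.
- exact: Cn_fst.
- exact: Cn_snd.
- exact: Cn_snd.
Qed.

Lemma Cn_rot (V : normedModType R) n (U : set V) (f : V -> R * R) : open U ->
  Cn_on n U f -> Cn_on n U (fun x => rot90 (f x)).
Proof.
by move=> oU cf; apply: Cn_pair => //; [apply: Cn_opp => //; exact: Cn_snd|exact: Cn_fst].
Qed.

Lemma open_setI_preimage (V W : topologicalType) (U : set V) (B : set W) (k : V -> W) :
  open U -> open B -> (forall x, U x -> {for x, continuous k}) ->
  open [set x | U x /\ B (k x)].
Proof.
move=> oU oB ck; rewrite openE => x [Ux Bx].
have nU : nbhs x U by exact: open_nbhs_nbhs.
have nB : nbhs x (k @^-1` B) by apply: (ck x Ux); exact: open_nbhs_nbhs.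
by apply: filterS2 nU nB.
Qed.

End PlaneGeometry.

Section Charts.
Context {R : realType}.
Variables (M : set (R * R)) (h : R * R -> R * R).
Hypothesis subM : curve_submanifold M.
Hypothesis normal_h : unit_normal_field M h.

(** The coordinate [k] lives on an open set of the plane, so that it can be composed with any curve
    in [M] by ordinary calculus. The last clause says that [U] meets [M] in this arc only. *)
Definition arc_chart (r : R) (U : set (R * R)) (c : R -> R * R) (k : R * R -> R) : Prop :=
  [/\ 0 < r, open U, smooth_on [set s : R | - r < s < r] c & smooth_on U k] /\
  (forall s : R, - r < s < r -> [/\ M (c s), U (c s) & k (c s) = s]) /\
  (forall m, U m -> M m -> - r < k m < r /\ c (k m) = m).

(** A slice chart straightens [M] into the horizontal axis: [c] is the image under [psi] of a
    segment of this axis around [phi x], and [k] is the first coordinate of [phi], recentred. *)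
Lemma arc_chart_exists x : M x -> exists r U c k, arc_chart r U c k /\ c 0 = x.
Proof.
move=> Mx; have [U [V [phi [psi]]]] := subM Mx.
move=> [[oU oV Ux] [[sphi spsi UV VU] Mphi]].
have [Vx psix] := UV _ Ux.
have px2 : (phi x).2 = 0 by apply/Mphi.
pose p := (phi x).1; pose j (s : R) : R * R := (p + s, 0).
have smj n : Cn_on n setT j.
  apply: Cn_pair; first exact: openT.
    by apply: Cn_add; [exact: openT|exact: Cn_cst|exact: Cn_id].
  exact: Cn_cst.
have j0 : j 0 = phi x by rewrite /j addr0 -px2 -surjective_pairing.
have [r r0 rV] : exists2 r : R, 0 < r & forall s : R, - r < s < r -> V (j s).
  have nV : \forall s \near (0 : R), V (j s).
    apply: (Cn_on_continuous (smj 0%N)) => //; rewrite j0.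
    exact: open_nbhs_nbhs.
  have [r /= r0 rV] := nV; exists r => // s sr; apply: rV => /=.
  by rewrite sub0r normrN ltr_norml.
pose k u := (phi u).1 - p.
have sk n : Cn_on n U k.
  by apply: Cn_sub => //; [exact: Cn_fst|exact: Cn_cst].
pose U' := [set u | U u /\ [set y : R | - r < y < r] (k u)].
have oU' : open U'.
  apply: open_setI_preimage => //; first exact: open_itv.
  by move=> u Uu; exact: Cn_on_continuous (sk 0%N) Uu.
exists r, U', (fun s => psi (j s)), k; split; last by rewrite j0.
split; [split => //|split].
- move=> n; apply: (Cn_comp_plane2 _ oV _ _ (spsi n)) => //; first exact: open_itv.
  by apply: Cn_onS (smj n).
- by move=> n; apply: Cn_onS (sk n) => u [].
- move=> s sr; have [Us e] := VU _ (rV s sr).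
  have ks : k (psi (j s)) = s by rewrite /k e /j /=; ring.
  by split => //; [apply/Mphi => //; rewrite e|split => //=; rewrite ks].
- move=> m [Um km] Mm; split => //.
  have [_ e] := UV _ Um; rewrite -[RHS]e; congr psi.
  have := (Mphi _ Um).1 Mm; rewrite /j /k; case: (phi m) => a b /= ->.
  by congr pair; ring.
Qed.

Lemma arc_chart_sub r U c k (r' : R) (O : set (R * R)) : arc_chart r U c k ->
  0 < r' <= r -> open O -> (forall s, - r' < s < r' -> O (c s)) ->
  arc_chart r' [set u | (U `&` O) u /\ [set y : R | - r' < y < r'] (k u)] c k.
Proof.
move=> [[r0 oU sc sk] [cP kP]] /andP[r'0 r'r] oO Oc.
split; [split => //|split].
- apply: open_setI_preimage; [exact: openI|exact: open_itv|].
  by move=> u [Uu _]; exact: Cn_on_continuous (sk 0%N) Uu.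
- by move=> n; apply: Cn_onS (sc n) => s /=; lra.
- by move=> n; apply: Cn_onS (sk n) => u [[]].
- move=> s sr; have [|Ms Us ks] := cP s; first lra.
  split => //; split => /=; last by rewrite ks.
  by split => //; exact: Oc.
- by move=> m [[Um Om] kr] Mm; split => //; have [] := kP _ Um Mm.
Qed.

Lemma arc_chart_near r U c k (P : R -> Prop) : arc_chart r U c k ->
  (\forall s \near (0 : R), P s) ->
  exists2 r', 0 < r' <= r & forall s, - r' < s < r' -> P s.
Proof.
move=> [[r0 _ _ _] _] [e /= e0 eP]; exists (Num.min r e).
  by rewrite lt_min r0 e0 /= ge_min lexx.
move=> s sr; apply: eP => /=; rewrite sub0r normrN ltr_norml.
have : Num.min r e <= e by rewrite ge_min lexx orbT.
by move: sr; move: (Num.min r e) => r'; lra.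
Qed.

Lemma arc_chart_opp r U c k : arc_chart r U c k ->
  arc_chart r U (fun s => c (- s)) (fun m => - k m).
Proof.
move=> [[r0 oU sc sk] [cP kP]]; have oI := @open_itv R (- r) r.
split; [split => //|split].
- move=> n; apply: (Cn_comp_line2 oI oI _ _ (sc n)).
    by move=> s /=; lra.
  by apply: Cn_opp => //; exact: Cn_id.
- by move=> n; exact: Cn_opp.
- move=> s sr; have [|Ms Us ks] := cP (- s); first lra.
  by split => //; rewrite ks opprK.
- by move=> m Um Mm; have [kr e] := kP m Um Mm; rewrite opprK; split => //; lra.
Qed.

Lemma arc_chart_derive_neq0 r U c k (s : R) : arc_chart r U c k -> - r < s < r ->
  'D_1 c s != 0.
Proof.
move=> [[r0 oU sc sk] [cP kP]] sr.
have [Ms Us ks] := cP s sr.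
have dc := (sc 1%N).1 s sr; have dk := (sk 1%N).1 _ Us.
have e : 'D_1 (fun y => k (c y)) s = 1.
  rewrite -[RHS](@derive_id R R s 1); apply: near_eq_derive.
  near=> y; have [|_ _ ->] := cP y; last by [].
  by near: y; apply: open_nbhs_nbhs; split => //; exact: open_itv.
apply/eqP => c0; move: e; rewrite derive_compE // c0 derive0 => /eqP.
by rewrite eq_sym oner_eq0.
Unshelve. all: by end_near. Qed.

(** [tangent] asks for a curve smooth on the whole line, whereas [c] is smooth on an interval only.
    The reparametrization [q t = s + e / 2 * sin t] stays in this interval and has nonzero
    derivative at 0. *)
Lemma arc_chart_normal r U c k (s : R) : arc_chart r U c k -> - r < s < r ->
  dot (h (c s)) ('D_1 c s) = 0.
Proof.
move=> [[r0 oU sc sk] [cP kP]] sr.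
have [Ms Us ks] := cP s sr.
pose e := Num.min (r - s) (r + s).
have e0 : 0 < e by rewrite lt_min; lra.
have e1 : e <= r - s by rewrite /e ge_min lexx.
have e2 : e <= r + s by rewrite /e ge_min lexx orbT.
pose q (t : R) : R := s + e / 2 * sin t.
have qr t : - r < q t < r.
  have := sin_le1 t; have := sin_geN1 t; rewrite /q => s1 s2.
  have : e / 2 * sin t <= e / 2 * 1 by rewrite ler_wpM2l //; lra.
  have : e / 2 * -1 <= e / 2 * sin t by rewrite ler_wpM2l //; lra.
  lra.
have sq n : Cn_on n setT q.
  apply: Cn_add; [exact: openT|exact: Cn_cst|].
  have [ss _] := @Cn_sin R n setT openT.
  by apply: Cn_mul; [exact: openT|exact: Cn_cst|exact: ss].
have q0 : q 0 = s by rewrite /q sin0 mulr0 addr0.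
have oI : open [set s : R | - r < s < r] by exact: open_itv.
have sm : smooth (fun t => c (q t)).
  by move=> n; exact: (Cn_comp_line2 openT oI (fun t _ => qr t) (sq n) (sc n)).
have dq : is_derive (0 : R) 1 q (e / 2).
  apply: is_derive_eq; rewrite cos0 !(mulr1, add0r) //.
  by rewrite mul1r /GRing.scale /= mulr1.
have tg : tangent M (c s) ((e / 2) *: 'D_1 c s).
  exists (fun t => c (q t)); split => //; first by rewrite q0.
    by near=> t; have [] := cP (q t) (qr t).
  have dc : differentiable c (q 0) by rewrite q0; exact: (sc 1%N).1.
  rewrite derive1E (derive_compE _ (is_derive_differentiable dq) dc).
  by rewrite derive_val (derive_lineE _ dc) q0.
have [_ /(_ _ tg)] := normal_h.2 _ Ms.
rewrite dotZr => /eqP; rewrite mulf_eq0 => /orP[/eqP|/eqP //]; lra.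
Unshelve. all: by end_near. Qed.


(** The chart runs at unit speed in the direction fixed by [h]: it is an integral curve of the
    tangent field [rot90 h]. *)
Definition unit_chart r U c k := arc_chart r U c k /\
  forall s : R, - r < s < r -> is_derive s 1 c (rot90 (h (c s))).

(** On the arc, c' is a multiple [l] of the unit tangent, and a primitive of [l] is the arc length
    to be inverted. The extension [g] appears because [h] is smooth only through such local
    extensions. *)
Lemma unit_chart_pos r U c k (O : set (R * R)) g : arc_chart r U c k ->
  open O -> U `<=` O -> smooth_on O g -> (forall u, O u -> M u -> g u = h u) ->
  0 < dot ('D_1 c 0) (rot90 (g (c 0))) ->
  exists d U' c' k', unit_chart d U' c' k' /\ c' 0 = c 0.
Proof.
move=> ch oO UO sg gh; pose l s := dot ('D_1 c s) (rot90 (g (c s))) => l0.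
have [[r0 oU sc sk] [cP kP]] := ch; have oI := @open_itv R (- r) r.
have sl : smooth_on [set s : R | - r < s < r] l.
  move=> n; apply: (Cn_dot oI); first exact: (sc n.+1).2.
  apply: (Cn_rot oI); apply: (Cn_comp_plane2 oI oO _ (sc n) (sg n)) => s sr.
  by apply: UO; have [] := cP s sr.
have lE s : - r < s < r -> 'D_1 c s = l s *: rot90 (h (c s)).
  move=> sr; have [Ms Us _] := cP s sr.
  have [/enorm1P hh _] := normal_h.2 _ Ms.
  by rewrite /l gh //; [exact: normal_decomposition hh (arc_chart_normal ch sr)|exact: UO].
have nl : \forall s \near (0 : R), 0 < l s.
  have cl : {for 0, continuous l} by apply: Cn_on_continuous (sl 0%N) _; rewrite /=; lra.
  have /(_ [set y : R | 0 < y]) := cl; apply.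
  by apply: open_nbhs_nbhs; split => //; exact: open_gt.
have [r1 r1r lpos] := arc_chart_near ch nl.
pose r2 := r1 / 2.
have clr2 : {within `[- r2, r2], continuous l}.
  apply: continuous_in_subspaceT => y; rewrite inE /= in_itv /= => yr.
  by apply: (Cn_on_continuous (sl 0%N)); rewrite /= ; move: yr; rewrite /r2; lra.
have [|F dF] := continuous_primitive _ clr2; first by rewrite /r2; lra.
pose L s := F s - F 0.
have dL s : - r2 < s < r2 -> is_derive s 1 L (l s).
  by move=> sr; have := dF s sr => ?; apply: is_derive_eq; rewrite subr0.
have slr2 : smooth_on [set s : R | - r2 < s < r2] l.
  by move=> n; apply: Cn_onS (sl n) => s /=; rewrite /r2; lra.
have oI2 := @open_itv R (- r2) r2.
have sL : smooth_on [set s : R | - r2 < s < r2] L.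
  case=> [|n].
    by move=> s sr; apply: differentiable_continuous; exact: is_derive_differentiable (dL s sr).
  split=> [s sr|v]; first exact: is_derive_differentiable (dL s sr).
  apply: eq_Cn_on oI2 _ (Cn_scale v oI2 (slr2 n)) => s sr.
  have ds := dL s sr.
  by rewrite derive_lineE ?derive_val //; exact: is_derive_differentiable ds.
have [||u ur|d [m [d0 mP mL dm sm]]] := primitive_inverse _ _ dL _ slr2.
- by rewrite /r2; lra.
- by rewrite /L subrr.
- by apply: lpos; move: ur; rewrite /r2; lra.
have oId := @open_itv R (- d) d.
have ch2 : arc_chart r2 [set u | (U `&` setT) u /\ [set y : R | - r2 < y < r2] (k u)] c k.
  by apply: (arc_chart_sub ch) => //; [rewrite /r2; lra|exact: openT].
move: ch2; set U2 := [set u | _] => ch2.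
have [[r20 oU2 sc2 sk2] [cP2 kP2]] := ch2.
have sLk n : Cn_on n U2 (fun u => L (k u)).
  by apply: (Cn_comp_line oU2 _ (sk2 n) (sL n)) => u [].
exists d, [set u | U2 u /\ [set y : R | - d < y < d] (L (k u))], (fun s => c (m s)), (fun u => L (k u)).
have m0 : m 0 = 0.
  have L0 : L 0 = 0 by rewrite /L subrr.
  by rewrite -[X in m X]L0 mL //; rewrite ?L0; lra.
split; last by rewrite m0.
split; first split; [split => //|split|].
- by apply: open_setI_preimage => // u Uu; exact: Cn_on_continuous (sLk 0%N) Uu.
- move=> n; apply: (Cn_comp_line2 oId oI2 _ (sm n) (sc2 n)) => s sd.
  by have [] := mP s sd.
- by move=> n; apply: Cn_onS (sLk n) => u [].
- move=> s sd; have [mr e] := mP s sd; have [Ms Us ks] := cP2 _ mr.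
  by rewrite ks; split => //; split => //=; rewrite ks e.
- move=> u [U2u /= Lu] Mu; have [kr e] := kP2 u U2u Mu.
  by split => //; rewrite mL.
- move=> s sd; have [mr e] := mP s sd; have dms := dm s sd.
  have msr : - r < m s < r by move: mr; rewrite /r2; lra.
  have dc := (sc 1%N).1 _ msr.
  have dms' := is_derive_differentiable dms.
  have dcm := differentiable_is_derive (differentiable_comp dms' dc).
  suff <- : 'D_1 (c \o m) s = rot90 (h (c (m s))) by exact: dcm.
  rewrite (derive_compE _ dms' dc) derive_val (derive_lineE _ dc).
  rewrite lE // scalerA mulVf ?scale1r // gt_eqF // lpos //.
  by move: mr; rewrite /r2; lra.
Qed.

Lemma unit_chart_exists x : M x -> exists r U c k, unit_chart r U c k /\ c 0 = x.
Proof.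
move=> Mx; have [r0 [U0 [c [k [ch0 c0]]]]] := arc_chart_exists Mx.
have [Ox [g [oO xO sg gh]]] := normal_h.1 _ Mx.
have nO : \forall s \near (0 : R), Ox (c s).
  have [[? _ sc _] _] := ch0.
  apply: (Cn_on_continuous (sc 0%N)); first by rewrite /=; lra.
  by rewrite c0; exact: open_nbhs_nbhs.
have [r rr0 rO] := arc_chart_near ch0 nO.
have := arc_chart_sub ch0 rr0 oO rO; set U := [set u | _] => ch.
have UO : U `<=` Ox by move=> u [[]].
have [[r00 oU sc sk] [cP kP]] := ch.
have I0 : - r < 0 < r by lra.
have [Mc Uc _] := cP 0 I0.
have [/enorm1P hh _] := normal_h.2 _ Mc.
have cE := normal_decomposition hh (arc_chart_normal ch I0).
have gE : g (c 0) = h (c 0) by apply: gh => //; exact: UO.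
have l0 : dot ('D_1 c 0) (rot90 (g (c 0))) != 0.
  have := arc_chart_derive_neq0 ch I0; apply: contra => /eqP e.
  by rewrite cE -gE e scale0r.
(* A chart that runs against [rot90 h] is reversed, which makes the factor positive. *)
have [lneg|lpos|/eqP] := ltgtP (dot ('D_1 c 0) (rot90 (g (c 0)))) 0; last by rewrite (negPf l0).
- have ch' := arc_chart_opp ch.
  have [|r' [U' [c' [k' [uc e]]]]] := unit_chart_pos ch' oO UO sg gh.
    have dc : differentiable c (- 0) by rewrite oppr0; exact: (sc 1%N).1.
    have dopp : is_derive (0 : R) 1 (-%R : R -> R) (-1) by apply: is_derive_eq.
    rewrite (derive_compE _ (is_derive_differentiable dopp) dc) derive_val (derive_lineE _ dc).
    by rewrite dotZl oppr0 mulN1r oppr_gt0.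
  by exists r', U', c', k'; split => //; rewrite e oppr0.
- have [r' [U' [c' [k' [uc e]]]]] := unit_chart_pos ch oO UO sg gh lpos.
  by exists r', U', c', k'; split => //; rewrite e.
Qed.

End Charts.

(** * Closed parametrization of a compact connected curve *)

Section Flow.
Context {R : realType}.
Variables (M : set (R * R)) (h : R * R -> R * R).
Hypothesis subM : curve_submanifold M.
Hypothesis normal_h : unit_normal_field M h.

Let unit_chart := unit_chart M h.

Definition integral_curve (a b : R) (g : R -> R * R) :=
  forall t : R, a < t < b -> M (g t) /\ is_derive t 1 g (rot90 (h (g t))).

Lemma derive1_unit_shift (a b : R) (f : R -> R) :
  (forall t : R, a < t < b -> is_derive t 1 f 1) ->
  forall x y, a < x < b -> a < y < b -> f y = f x + (y - x).
Proof.
move=> df; suff H x y : a < x < b -> a < y < b -> x < y -> f y = f x + (y - x).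
  move=> x y xab yab; have [xy|yx|->] := ltgtP x y; last by ring.
  - exact: H.
  - by rewrite (H y x) //; ring.
move=> xab yab xy.
have cf : {within `[x, y], continuous f}.
  apply: continuous_in_subspaceT => z; rewrite inE /= in_itv /= => zxy.
  have dz : is_derive z 1 f 1 by apply: df; lra.
  by apply: differentiable_continuous; exact: is_derive_differentiable dz.
have df' z : z \in `]x, y[%R -> is_derive z 1 f (cst 1 z).
  by rewrite in_itv /= => zxy; apply: df; lra.
have [z _ /= e] := MVT xy df' cf.
by rewrite -[f y](subrK (f x)) e; ring.
Qed.

Lemma integral_curve_differentiable a b g t : integral_curve a b g -> a < t < b ->
  differentiable g t.
Proof. by move=> ig /ig [_ dg]; exact: is_derive_differentiable dg. Qed.

Lemma integral_curveS a b a' b' g : a <= a' -> b' <= b ->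
  integral_curve a b g -> integral_curve a' b' g.
Proof. by move=> aa bb ig t tab; apply: ig; lra. Qed.

Lemma integral_curve_shift a b s g : integral_curve a b g ->
  integral_curve (a + s) (b + s) (fun t => g (t - s)).
Proof.
move=> ig t tab; have [|Mg dg] := ig (t - s); first lra.
split => //; have dgx := is_derive_differentiable dg.
have ds : is_derive t 1 (fun t => t - s) 1 by apply: is_derive_eq; rewrite subr0.
have dsx := is_derive_differentiable ds.
have dc := differentiable_is_derive (differentiable_comp dsx dgx).
suff <- : 'D_1 (g \o (fun t => t - s)) t = rot90 (h (g (t - s))) by exact: dc.
by rewrite (derive_compE _ dsx dgx) derive_val derive_val.
Qed.

Lemma integral_curve_eq a b f g : (forall t, a < t < b -> f t = g t) ->
  integral_curve a b f -> integral_curve a b g.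
Proof.
move=> fg ig t tab; have [Mf df] := ig t tab; rewrite -fg //; split => //.
apply: near_eq_is_derive df.
near=> s; apply: fg; near: s.
by apply: open_nbhs_nbhs; split => //; exact: open_itv.
Unshelve. all: by end_near. Qed.

Lemma chart_integral_curve r U c k : unit_chart r U c k -> integral_curve (- r) r c.
Proof. by move=> [[_ [cP _]] dc] s sr; have [Mc _ _] := cP s sr; split => //; exact: dc. Qed.

(** Differentiate [k (c s) = s] along [c]. Hence [k] grows at unit rate along every integral curve
    while it is in [U], and the differential equation becomes a time shift in the coordinate [k]. *)
Lemma unit_chart_derive r U c k m : unit_chart r U c k -> U m -> M m ->
  'D_(rot90 (h m)) k m = 1.
Proof.
move=> [[[r0 oU sc sk] [cP kP]] dc] Um Mm.
have [kr cm] := kP m Um Mm.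
have dck := dc _ kr; have dcx := is_derive_differentiable dck.
have dk : differentiable k (c (k m)) by rewrite cm; exact: (sk 1%N).1.
have : 'D_1 (fun y => k (c y)) (k m) = 1.
  rewrite -[RHS](@derive_id R R (k m) 1); apply: near_eq_derive.
  near=> y; have [|_ _ ->] := cP y; last by [].
  by near: y; apply: open_nbhs_nbhs; split => //; exact: open_itv.
by rewrite (derive_compE _ dcx dk) derive_val cm.
Unshelve. all: by end_near. Qed.

Lemma integral_curve_chart a b g r U c k (t0 : R) : integral_curve a b g ->
  unit_chart r U c k -> a < t0 < b -> U (g t0) ->
  \forall t \near t0, g t = c (k (g t0) + (t - t0)).
Proof.
move=> ig uc t0ab Ut0; have [[[r0 oU sc sk] [cP kP]] dc] := uc.
have nU : \forall t \near t0, a < t < b /\ U (g t).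
  apply: filterI; first by apply: open_nbhs_nbhs; split => //; exact: open_itv.
  apply: (differentiable_continuous (integral_curve_differentiable ig t0ab)).
  exact: open_nbhs_nbhs.
have [e /= e0 eU] := nU.
have H (t : R) : t0 - e < t < t0 + e -> a < t < b /\ U (g t).
  by move=> te; apply: eU; rewrite /= ltr_distlC; lra.
have dkg (t : R) : t0 - e < t < t0 + e -> is_derive t 1 (fun t => k (g t)) 1.
  move=> te; have [tab Ut] := H t te; have [Mg dg] := ig t tab.
  have dgx := is_derive_differentiable dg.
  have dk : differentiable k (g t) by exact: (sk 1%N).1.
  have dkg := differentiable_is_derive (differentiable_comp dgx dk).
  have e1 : 'D_1 (k \o g) t = 1.
    by rewrite (derive_compE _ dgx dk) derive_val; exact: unit_chart_derive uc Ut Mg.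
  by rewrite e1 in dkg.
exists e => // t /= te; have tE : t0 - e < t < t0 + e by move: te; rewrite ltr_distlC; lra.
have [tab Ut] := H t tE; have [Mg _] := ig t tab.
have t0E : t0 - e < t0 < t0 + e by lra.
rewrite -(derive1_unit_shift dkg t0E tE).
by have [_ ->] := kP _ Ut Mg.
Qed.

(** Connectedness of the interval: the set of agreement is closed by continuity, and open because
    near a time of agreement a chart expresses both curves by the same formula. *)
Lemma integral_curve_unique a b f g t0 : integral_curve a b f -> integral_curve a b g ->
  a < t0 < b -> f t0 = g t0 -> forall t, a < t < b -> f t = g t.
Proof.
move=> jf jg t0ab e0.
have oI := @open_itv R a b.
have cI : connected [set t : R | a < t < b].
  apply/connected_intervalP => x y /= xab yab z xzy; rewrite /=; lra.
pose B := [set t : R | a < t < b /\ f t = g t].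
suff BI : B = [set t : R | a < t < b].
  by move=> t tab; have [] : B t by rewrite BI.
apply: cI.
- by exists t0.
- exists B; last by apply/seteqP; split => t; [move=> []|move=> [? []]].
  rewrite openE => t [tab fg].
  have [Mf _] := jf t tab; have [r [U [c [k [uc c0]]]]] := unit_chart_exists subM normal_h Mf.
  have [[[r0 oU _ _] [cP _]] _] := uc.
  have Uf : U (f t) by rewrite -c0; have [|] := cP 0; first lra.
  have Ug : U (g t) by rewrite -fg.
  have n1 := integral_curve_chart jf uc tab Uf.
  have n2 := integral_curve_chart jg uc tab Ug.
  near=> s; split; first by near: s; apply: open_nbhs_nbhs.
  have -> : f s = c (k (f t) + (s - t)) by near: s.
  by rewrite fg; apply/esym; near: s.
- exists (~` [set t : R | [set t : R | a < t < b] t /\ [set~ 0] (f t - g t)]).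
    apply: open_closedC; apply: open_setI_preimage => //.
      by apply: closed_openC; exact: accessible_closed_set1 (hausdorff_accessible (@norm_hausdorff _ _)) _.
    move=> t tab; apply: cvgB; apply: differentiable_continuous.
      exact: integral_curve_differentiable jf tab.
    exact: integral_curve_differentiable jg tab.
  apply/seteqP; split => t /=.
    by move=> [tab fg]; split => // -[_ /=]; rewrite fg subrr.
  move=> [tab nfg]; split => //; apply: contrapT => fg; apply: nfg; split => //=.
  by move/eqP; rewrite subr_eq0 => /eqP.
Unshelve. all: by end_near. Qed.

Lemma integral_curve_in_chart a b g r U c k (t0 t : R) : integral_curve a b g ->
  unit_chart r U c k -> a < t0 < b -> U (g t0) -> a < t < b ->
  - r < k (g t0) + (t - t0) < r -> g t = c (k (g t0) + (t - t0)).
Proof.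
move=> ig uc t0ab Ut0 tab tr; have [[_ [cP kP]] _] := uc.
have [Mg _] := ig _ t0ab; have [kr ck] := kP _ Ut0 Mg.
set s0 := k (g t0) in tr kr ck *.
have ic := integral_curve_shift (s := t0 - s0) (chart_integral_curve uc).
pose a' := Num.max a (- r + (t0 - s0)); pose b' := Num.min b (r + (t0 - s0)).
have a1 : a <= a' by rewrite /a' le_max lexx.
have a2 : - r + (t0 - s0) <= a' by rewrite /a' le_max lexx orbT.
have b1 : b' <= b by rewrite /b' ge_min lexx.
have b2 : b' <= r + (t0 - s0) by rewrite /b' ge_min lexx orbT.
have H x : a < x < b -> - r < s0 + (x - t0) < r -> a' < x < b'.
  by move=> xab xr; rewrite /a' /b' gt_max lt_min; lra.
rewrite (_ : s0 + (t - t0) = t - (t0 - s0)); last by ring.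
apply: (@integral_curve_unique a' b' g (fun t => c (t - (t0 - s0))) t0).
- exact: integral_curveS a1 b1 ig.
- exact: integral_curveS a2 b2 ic.
- by apply: H => //; rewrite subrr addr0.
- by rewrite -[LHS]ck; congr c; ring.
- exact: H.
Qed.

Definition flow_exists (r : R) :=
  forall m, M m -> exists g, integral_curve (- r) r g /\ g 0 = m.

Lemma flow_existsS r r' : r' <= r -> flow_exists r -> flow_exists r'.
Proof.
move=> rr fr m Mm; have [g [ig g0]] := fr m Mm; exists g; split => //.
by apply: integral_curveS ig; lra.
Qed.

(** A chart around m also serves every nearby m': starting [c] at time [k m'], of absolute value
    below r / 2, leaves a time r / 2 on both sides. Compactness makes the time uniform. *)
Lemma flow_exists_uniform : compact M -> exists2 r, 0 < r & flow_exists r.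
Proof.
move=> /compact_near_coveringP cM.
pose P (r : R) (m : R * R) := M m -> exists g, integral_curve (- r) r g /\ g 0 = m.
have near_P : \forall r \near (0 : R)^'+, M `<=` P r.
  apply: cM => m Mm; have [r [U [c [k [uc c0]]]]] := unit_chart_exists subM normal_h Mm.
  have [[[r0 oU sc sk] [cP kP]] dc] := uc.
  have I0 : - r < 0 < r by lra.
  have [_ U0 k0] := cP 0 I0; rewrite c0 in U0 k0.
  have nU : \forall m' \near m, U m' /\ - (r / 2) < k m' < r / 2.
    apply: filterI; first exact: open_nbhs_nbhs.
    have /(_ [set y : R | - (r / 2) < y < r / 2]) := Cn_on_continuous (sk 0%N) U0.
    apply; rewrite k0; apply: open_nbhs_nbhs; split; first exact: open_itv.
    by rewrite /=; lra.
  near=> m' r' => /= Mm'.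
  have [Um' km'] : U m' /\ - (r / 2) < k m' < r / 2 by near: m'.
  have r'r : r' < r / 2 by near: r'; apply: nbhs_right_lt; lra.
  exists (fun t => c (t - - k m')); split; last by rewrite sub0r opprK; have [_] := kP _ Um' Mm'.
  have ic := integral_curve_shift (s := - k m') (chart_integral_curve uc).
  by apply: integral_curveS ic; lra.
have [r [r0 rP]] : exists r : R, 0 < r /\ M `<=` P r.
  have : \forall r \near (0 : R)^'+, 0 < r /\ M `<=` P r.
    by apply: filterI => //; exact: nbhs_right_gt.
  by move/filter_ex.
by exists r => // m Mm; exact: rP.
Unshelve. all: by end_near. Qed.

(** Restart at the times r / 2 and - r / 2, each for a further time r; the pieces agree with [g] on
    the overlaps by uniqueness. *)
Lemma flow_exists_extend r : 0 < r -> flow_exists r -> flow_exists (3 / 2 * r).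
Proof.
move=> r0 fr m Mm; have [g [ig g0]] := fr m Mm.
have [|gp [igp gp0]] := fr (g (r / 2)); first by have [|] := ig (r / 2); first lra.
have [|gm [igm gm0]] := fr (g (- (r / 2))); first by have [|] := ig (- (r / 2)); first lra.
have jp := integral_curve_shift (s := r / 2) igp.
have jm := integral_curve_shift (s := - (r / 2)) igm.
have ep t : - (r / 2) < t < r -> g t = gp (t - r / 2).
  apply: (@integral_curve_unique (- (r / 2)) r g (fun t => gp (t - r / 2)) (r / 2)).
  - by apply: integral_curveS ig; lra.
  - by apply: integral_curveS jp; lra.
  - lra.
  - by rewrite subrr.
have em t : - r < t < r / 2 -> g t = gm (t - - (r / 2)).
  apply: (@integral_curve_unique (- r) (r / 2) g (fun t => gm (t - - (r / 2))) (- (r / 2))).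
  - by apply: integral_curveS ig; lra.
  - by apply: integral_curveS jm; lra.
  - lra.
  - by rewrite subrr.
pose G t := if t < 0 then gm (t - - (r / 2)) else gp (t - r / 2).
exists G; split; last by rewrite /G ltxx -ep ?g0 //; lra.
have G0 : integral_curve (- (r / 2)) (r / 2) G.
  apply: integral_curve_eq (integral_curveS _ _ ig) => [t tr||]; [|lra|lra].
  by rewrite /G; case: ltP => t0; [apply: em|apply: ep]; lra.
have Gp : integral_curve 0 (3 / 2 * r) G.
  apply: integral_curve_eq (integral_curveS _ _ jp) => [t tr||]; [|lra|lra].
  have t0 : (t < 0) = false by apply/negbTE; rewrite -leNgt; lra.
  by rewrite /G t0.
have Gm : integral_curve (- (3 / 2 * r)) 0 G.
  apply: integral_curve_eq (integral_curveS _ _ jm) => [t tr||]; [|lra|lra].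
  have t0 : t < 0 by lra.
  by rewrite /G t0.
move=> t tr; have [t0|t0|->] := ltgtP t 0.
- by apply: Gm; lra.
- by apply: Gp; lra.
- by apply: G0; lra.
Qed.

Lemma flow_exists_all r : compact M -> flow_exists r.
Proof.
move=> cM; have [e e0 fe] := flow_exists_uniform cM.
have fn n : flow_exists (e * (3 / 2) ^+ n).
  elim: n => [|n IH]; first by rewrite expr0 mulr1.
  rewrite exprS mulrCA; apply: flow_exists_extend => //.
  by rewrite mulr_gt0 // exprn_gt0 //; lra.
have [n rn] : exists n : nat, r <= e * (3 / 2) ^+ n.
  have grow n : n%:R / 2 <= (3 / 2 : R) ^+ n.
    elim: n => [|n IH]; first by rewrite mul0r expr0; lra.
    have h1 : (1 : R) <= (3 / 2) ^+ n by apply: exprn_ege1; lra.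
    by rewrite exprS -natr1; lra.
  exists (Num.trunc (2 * (`|r| / e))).+1.
  have := truncnS_gt (2 * (`|r| / e)); move: (Num.trunc _).+1 => N hN.
  have : `|r| / e <= (3 / 2) ^+ N by apply: le_trans (grow N); lra.
  rewrite ler_pdivrMr // mulrC; apply: le_trans; exact: ler_norm.
exact: flow_existsS rn (fn n).
Qed.

Lemma global_integral_curve m : compact M -> M m ->
  exists g : R -> R * R, g 0 = m /\ forall a b, integral_curve a b g.
Proof.
move=> cM Mm.
have H n : exists g, integral_curve (- n.+1%:R) n.+1%:R g /\ g 0 = m.
  exact: flow_exists_all.
have [g gP] := choice H.
(* At time t the solution of index [N t] is used: it is defined on an interval of half-length
   [N t + 1], which exceeds |t|, and the solutions of larger index agree with it there. *)
pose N (t : R) := Num.trunc `|t|.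
have tN t : - (N t).+1%:R < t < (N t).+1%:R.
  by rewrite -ltr_norml; exact: truncnS_gt.
have gE n k t : (k <= n)%N -> - k.+1%:R < t < k.+1%:R -> g n t = g k t.
  move=> kn; have [ign gn0] := gP n; have [igk gk0] := gP k.
  have kn' : k.+1%:R <= n.+1%:R :> R by rewrite ler_nat.
  have k0 : 0 < k.+1%:R :> R by rewrite ltr0n.
  apply: (@integral_curve_unique _ _ _ _ 0).
  - by apply: integral_curveS ign; lra.
  - by [].
  - lra.
  - by rewrite gn0.
exists (fun t => g (N t) t); split; first by have [_ ->] := gP (N 0).
have gN n : integral_curve (- n.+1%:R) n.+1%:R (fun t => g (N t) t).
  have [ign _] := gP n; apply: integral_curve_eq ign => t tn.
  apply: gE; last exact: tN.
  move: tn; rewrite -ltr_norml => tn; rewrite -ltnS /N.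
  have [] := truncn_itv (normr_ge0 t).
  by move=> /andP[h1 _]; rewrite -(ltr_nat R); exact: le_lt_trans h1 tn.
by move=> a b t _; exact: gN (tN t).
Qed.


Lemma Cn_on_local (V W : normedModType R) n (f : V -> W) (U : set V) :
  (forall x, U x -> exists A, [/\ open A, A x & Cn_on n A f]) -> Cn_on n U f.
Proof.
elim: n f => [f H x Ux|n IH f H].
  by have [A [_ Ax Af]] := H x Ux; exact: Af.
split=> [x Ux|v]; first by have [A [_ Ax [Af _]]] := H x Ux; exact: Af.
by apply: IH => x Ux; have [A [oA Ax [_ Af]]] := H x Ux; exists A; split => //; exact: Af.
Qed.

Section Global.
Variable g : R -> R * R.
Hypothesis curve_g : forall a b, integral_curve a b g.

Let Mg t : M (g t).
Proof. by have [|] := @curve_g (t - 1) (t + 1) t; first lra. Qed.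

Let dg (t : R) : is_derive t 1 g (rot90 (h (g t))).
Proof. by have [|] := @curve_g (t - 1) (t + 1) t; first lra. Qed.

Let g_chart r U c k (t0 t : R) : unit_chart r U c k -> U (g t0) ->
  - r < k (g t0) + (t - t0) < r -> g t = c (k (g t0) + (t - t0)).
Proof.
move=> uc U0 tr.
pose b := `|t| + `|t0| + 1.
have : `|t| < b by rewrite /b; have := normr_ge0 t0; lra.
have : `|t0| < b by rewrite /b; have := normr_ge0 t; lra.
rewrite !ltr_norml => h1 h2.
exact: (integral_curve_in_chart (@curve_g (- b) b) uc h1 U0 h2 tr).
Qed.

Let g_smooth : smooth g.
Proof.
move=> n; apply: Cn_on_local => t0 _.
have [r [U [c [k [uc c0]]]]] := unit_chart_exists subM normal_h (Mg t0).
have [[[r0 oU sc sk] [cP kP]] dc] := uc.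
have I0 : - r < 0 < r by lra.
have [_ U0 k0] := cP 0 I0; rewrite c0 in U0 k0.
exists [set t : R | t0 - r < t < t0 + r]; split; first exact: open_itv.
  by rewrite /=; lra.
have oI := @open_itv R (t0 - r) (t0 + r); have oIr := @open_itv R (- r) r.
have cc : Cn_on n [set t : R | t0 - r < t < t0 + r] (fun t => c (t - t0)).
  apply: (Cn_comp_line2 oI oIr _ _ (sc n)) => [t /=|]; first lra.
  by apply: Cn_sub => //; [exact: Cn_id|exact: Cn_cst].
apply: eq_Cn_on oI _ cc => t /= tr.
by rewrite (g_chart uc U0) k0 add0r //; lra.
Qed.

(** [C1] is the union of the charts that the curve meets, [C2] of those that it misses. The part of
    [M] in a chart that is met lies on the curve, so the range is both [M] inter [C1] and [M] minus
    [C2]: relatively open and closed. *)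
Lemma integral_curve_onto : connected M -> range g = M.
Proof.
move=> cM.
pose C1 := [set m | exists r U c k, [/\ unit_chart r U c k, U m & exists t, U (g t)]].
pose C2 := [set m | exists r U c k, [/\ unit_chart r U c k, U m & forall t, ~ U (g t)]].
have oC1 : open C1.
  rewrite openE => m [r [U [c [k [uc Um Ug]]]]].
  have [[[r0 oU sc sk] _] _] := uc.
  apply: (@filterS _ _ _ U); last exact: open_nbhs_nbhs.
  by move=> m' Um'; exists r, U, c, k.
have oC2 : open C2.
  rewrite openE => m [r [U [c [k [uc Um Ug]]]]].
  have [[[r0 oU sc sk] _] _] := uc.
  apply: (@filterS _ _ _ U); last exact: open_nbhs_nbhs.
  by move=> m' Um'; exists r, U, c, k.
have C1g m : M m -> C1 m -> range g m.
  move=> Mm [r [U [c [k [uc Um [t Ut]]]]]].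
  have [[_ [cP kP]] _] := uc; have [kr cm] := kP m Um Mm.
  exists (t + (k m - k (g t))) => //.
  have e : k (g t) + (t + (k m - k (g t)) - t) = k m by ring.
  by rewrite (g_chart uc Ut) e.
have gC t : C1 (g t).
  have [r [U [c [k [uc c0]]]]] := unit_chart_exists subM normal_h (Mg t).
  have [[[r0 _ _ _] [cP _]] _] := uc.
  have [|_ U0 _] := cP 0; first lra.
  by exists r, U, c, k; rewrite -c0; split => //; exists t; rewrite -c0.
apply: cM.
- by exists (g 0); exists 0.
- exists C1 => //; apply/seteqP; split => [_ [t _ <-]|m [Mm]]; last exact: C1g.
  by split.
- exists (~` C2); first exact: open_closedC.
  apply/seteqP; split => [_ [t _ <-]|m [Mm nC2]].
    by split => // -[r [U [c [k [_ Ut /(_ t)]]]]].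
  have [r [U [c [k [uc c0]]]]] := unit_chart_exists subM normal_h Mm.
  have [[[r0 _ _ _] [cP _]] _] := uc.
  have [|_ U0 _] := cP 0; first lra.
  apply: C1g => //; exists r, U, c, k; split => //; first by rewrite -c0.
  apply: contrapT => nU; apply: nC2; exists r, U, c, k; split => //; first by rewrite -c0.
  by move=> t Ut; apply: nU; exists t.
Qed.

(** The equation is autonomous, so two passages through one point differ by a time shift. *)
Lemma integral_curve_period (a b : R) : g a = g b -> forall t, g (t + (b - a)) = g t.
Proof.
move=> gab t.
pose B := `|t| + `|a| + 1.
have : `|t| < B by rewrite /B; have := normr_ge0 a; lra.
have : `|a| < B by rewrite /B; have := normr_ge0 t; lra.
rewrite !ltr_norml => h1 h2.
have ic := integral_curve_shift (s := a - b) (@curve_g (- B - (a - b)) (B - (a - b))).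
rewrite (_ : t + (b - a) = t - (a - b)); last by ring.
apply: (@integral_curve_unique (- B) B (fun t => g (t - (a - b))) g a) => //.
- by apply: integral_curveS ic; lra.
- by rewrite gab; congr g; ring.
Qed.

(** The points g n cluster at some m. Near m, a time correction [k (g n)] smaller than r puts the
    curve exactly at [c 0]; two visits more than 2 r apart then give two distinct times with the
    same value. *)
Lemma integral_curve_returns : compact M -> exists a b, a < b /\ g a = g b.
Proof.
move=> cM.
have [] := cM (g (n%:R) @[n --> \oo]).
  by exists 0%N => // n _ /=; exact: Mg.
move=> m [Mm clm].
have [r [U [c [k [uc c0]]]]] := unit_chart_exists subM normal_h Mm.
have [[[r0 oU sc sk] [cP kP]] dc] := uc.
have [|_ U0 k0] := cP 0; first lra.
have nU : nbhs m U by apply: open_nbhs_nbhs; split => //; rewrite -c0.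
have hit (N : nat) : exists2 n : nat, (N <= n)%N & U (g n%:R).
  have [|_ [[n Nn <-] Ug]] := clm (g @` [set n%:R | n in [set n | (N <= n)%N]]) U _ nU.
    by exists N => // n Nn; exists n%:R => //; exists n.
  by case: Nn => k' Nk' e; exists k' => //; rewrite e.
have back n : U (g n%:R) -> - r < k (g n%:R) < r /\ g (n%:R - k (g n%:R)) = c 0.
  move=> Ug; have [kr _] := kP _ Ug (Mg _); split => //.
  have e : k (g n%:R) + (n%:R - k (g n%:R) - n%:R) = 0 by ring.
  by rewrite (g_chart uc Ug) e //; lra.
have [n1 _ U1] := hit 0%N; have [kr1 e1] := back n1 U1.
have [n2 n12 U2] := hit (n1 + (Num.trunc (2 * r)).+1)%N; have [kr2 e2] := back n2 U2.
exists (n1%:R - k (g n1%:R)), (n2%:R - k (g n2%:R)); split; last by rewrite e1 e2.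
have := truncnS_gt (2 * r).
have : (n1 + (Num.trunc (2 * r)).+1)%:R <= n2%:R :> R by rewrite ler_nat.
rewrite natrD; lra.
Unshelve. all: by end_near. Qed.

(** The period is the infimum of the positive return times to [g 0]. It is positive because a chart
    is injective for a time r, and attained by continuity; minimality gives injectivity on one
    period. *)
Lemma integral_curve_closed_param : compact M -> connected M -> exists L, closed_param M L g.
Proof.
move=> cM coM.
pose P := [set T : R | 0 < T /\ g T = g 0].
have [a [b [ab gab]]] := integral_curve_returns cM.
have Pab : P (b - a).
  by split; [lra|rewrite -(integral_curve_period gab 0) add0r].
have [r [U [c [k [uc c0]]]]] := unit_chart_exists subM normal_h (Mg 0).
have [[[r0 oU sc sk] [cP kP]] dc] := uc.
have I0 : - r < 0 < r by lra.
have [_ U0 k0] := cP 0 I0; rewrite c0 in U0 k0.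
have lbP : lbound P r.
  move=> T [T0 gT]; rewrite leNgt; apply/negP => Tr.
  have IT : - r < T < r by lra.
  have gc : g T = c T by rewrite (g_chart uc U0) k0 !add0r subr0.
  have [_ _ kT] := cP T IT; have [_ _ kk] := cP 0 I0.
  by move: kT; rewrite -gc gT -c0 kk => e; lra.
have infP : has_inf P by split; [exists (b - a)|exists r].
pose L := inf P.
have rL : r <= L by apply: lb_le_inf => //; exists (b - a).
have LP T : P T -> L <= T by move=> PT; apply: ge_inf => //; exists r.
have PL : g L = g 0.
  apply: contrapT => nL.
  have : \forall t \near L, g t <> g 0.
    have cg : {for L, continuous g}.
      have dL := dg L; exact: differentiable_continuous (is_derive_differentiable dL).
    have /(_ [set~ g 0]) := cg; apply.
    apply: open_nbhs_nbhs; split => //.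
    by apply: closed_openC; exact: accessible_closed_set1 (hausdorff_accessible (@norm_hausdorff _ _)) _.
  move=> [e /= e0 eP].
  have [T PT TL] := inf_adherent e0 infP.
  have LT := LP T PT; have [_ gT] := PT.
  by apply: (eP T) => //=; rewrite -/L in TL; rewrite ltr_distlC; lra.
have per t : g (t + L) = g t.
  by rewrite -[RHS](integral_curve_period (esym PL) t) subr0.
have pern (n : nat) t : g (t + n%:R * L) = g t.
  elim: n t => [|n IH] t; first by rewrite mul0r addr0.
  by rewrite -natr1 mulrDl mul1r addrA per IH.
have perz (z : int) t : g (t - z%:~R * L) = g t.
  case: z => n; first by rewrite -(pern n (t - _)); congr g; rewrite -pmulrn; ring.
  by rewrite NegzE -[RHS](pern n.+1 t); congr g; rewrite mulrNz -pmulrn; ring.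
exists L; split; first split => //; first lra.
  move=> t e; have [/enorm1P hh _] := normal_h.2 _ (Mg t).
  have dt := dg t; move: e; rewrite derive1E derive_val => e.
  move: hh; have := congr1 fst e; have := congr1 snd e; rewrite /dot /= => -> /eqP.
  by rewrite oppr_eq0 => /eqP ->; rewrite !mulr0 addr0 => /eqP; rewrite eq_sym oner_eq0.
split => //.
  suff H x y : 0 <= x < L -> 0 <= y < L -> x < y -> g x <> g y.
    move=> x y; rewrite !in_itv /= => xL yL e.
    by have [xy|yx|//] := ltgtP x y; [case: (H x y)|case: (H y x)].
  move=> xL yL xy gxy.
  have /LP : P (y - x).
    by split; [lra|rewrite -(integral_curve_period gxy 0) add0r].
  lra.
rewrite -(integral_curve_onto coM); apply/seteqP; split => [_ [t _ <-]|_ [t _ <-]].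
  by exists t.
have L0 : 0 < L by lra.
exists (t - (Num.floor (t / L))%:~R * L); last exact: perz.
rewrite /= in_itv /=; have := floor_itv (t / L) => /andP[f1 f2].
rewrite subr_ge0 -ler_pdivlMr // f1 /= lerBlDr.
rewrite intrD mulr1z in f2; move: f2; rewrite ltr_pdivrMr //; lra.
Qed.

End Global.

Theorem closed_param_exists : M !=set0 -> compact M -> connected M ->
  exists L f, closed_param M L f.
Proof.
move=> [m Mm] cM coM.
have [g [_ ig]] := global_integral_curve cM Mm.
by have [L Lg] := integral_curve_closed_param ig cM coM; exists L, g.
Qed.

End Flow.

(** * Change of variables to normal coordinates *)

Section PlaneMeasure.
Context {R : realType}.
Notation mu := (@lebesgue_measure R).

(** The product sigma-algebra is generated by rectangles, so an open set is written as a countable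
    union of boxes with rational centres and radii 1 / (n + 1). *)
Lemma open_measurable_plane (A : set (R * R)) : open A -> measurable A.
Proof.
move=> oA.
pose box (p q : rat) (n : nat) : set (R * R) :=
  ball (ratr p : R) n.+1%:R^-1 `*` ball (ratr q : R) n.+1%:R^-1.
pose B p q n := if `[< box p q n `<=` A >] then box p q n else set0.
have -> : A = \bigcup_p \bigcup_q \bigcup_n B p q n.
  apply/seteqP; split => [[x y] Axy|x [p _ [q _ [n _]]]]; last first.
    by rewrite /B; case: ifPn => // /asboolP; apply.
  have [e /= e0 eA] : exists2 e : R, 0 < e & ball (x, y) e `<=` A.
    by move: oA; rewrite openE => /(_ _ Axy) /nbhs_ballP [e e0 eA]; exists e.
  have [n ne] : exists n : nat, n.+1%:R^-1 < e / 2.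
    exists (Num.trunc (e / 2)^-1); have h := truncnS_gt (e / 2)^-1.
    by rewrite invf_plt ?posrE // divr_gt0.
  have rat_near (z : R) : exists p : rat, `|ratr p - z| < n.+1%:R^-1.
    have [|p] := @rat_in_itvoo R (z - n.+1%:R^-1) (z + n.+1%:R^-1).
      by rewrite ltrBlDr -addrA ltrDl addr_gt0 // invr_gt0 ltr0n.
    by rewrite in_itv /= => pz; exists p; rewrite ltr_distl.
  have [p px] := rat_near x; have [q qy] := rat_near y.
  exists p => //; exists q => //; exists n => //.
  have subA : box p q n `<=` A.
    move=> [u v] [/= pu qv]; apply: eA; split; rewrite /= /ball /=.
      rewrite -(subrKA (ratr p)); apply: le_lt_trans (ler_normD _ _) _.
      have pu' : `|ratr p - u| < n.+1%:R^-1 by exact: pu.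
      rewrite distrC in px; apply: lt_trans (ltrD px pu') _.
      by rewrite (splitr e); exact: ltrD.
    rewrite -(subrKA (ratr q)); apply: le_lt_trans (ler_normD _ _) _.
    have qv' : `|ratr q - v| < n.+1%:R^-1 by exact: qv.
    rewrite distrC in qy; apply: lt_trans (ltrD qy qv') _.
      by rewrite (splitr e); exact: ltrD.
  by rewrite /B; case: asboolP => // _; split.
apply: bigcupT_measurable_rat => p; apply: bigcupT_measurable_rat => q.
apply: bigcupT_measurable => n; rewrite /B; case: ifPn => // _.
by apply: measurableX; exact: measurable_ball.
Qed.

Lemma continuous_measurable_plane (f : R * R -> R) : continuous f ->
  measurable_fun setT f.
Proof.
move=> /continuousP cf; apply: (measurability _ (RGenOpens.measurableE R)).
move=> _ [_ [a [b ->] <-]]; rewrite setTI; apply: open_measurable_plane.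
exact/cf/interval_open.
Qed.

Lemma measurable_affine (a b : R) :
  measurable_fun [set: measurableTypeR R]
    (fun x : measurableTypeR R => (a * x + b)%R : measurableTypeR R).
Proof. by apply: measurable_funD => //; exact: measurable_funM. Qed.

Definition affine_image_measure (a b : R) : {measure set (measurableTypeR R) -> \bar R} :=
  mscale (NngNum (normr_ge0 a))
    (measure_function_pushforward__canonical__measure_function_Measure mu (measurable_affine a b)).

(** Lebesgue measure is determined by its values on half-open intervals. For a < 0 the preimage of
    such an interval is closed at its other end, and again has length (d - c) / |a|. *)
Lemma lebesgue_measure_affine (a b : R) (A : set (measurableTypeR R)) : a != 0 -> measurable A ->
  mu A = affine_image_measure a b A.
Proof.
move=> a0 mA; apply: lebesgue_measure_unique => //= _ [[c d]] _ <-.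
rewrite /affine_image_measure /mscale /= /pushforward /=.
have [an|ap|/eqP] := ltgtP a 0; last by rewrite (negPf a0).
- have -> : (fun x : R => a * x + b) @^-1` `]c, d] = `[(d - b) / a, (c - b) / a[%classic.
    apply/seteqP; split => x /=; rewrite !in_itv /= ler_ndivrMr // ltr_ndivlMr //; lra.
  rewrite !lebesgue_measure_itv /= !lte_fin ltr_nM2r ?invr_lt0 //.
  rewrite ltrD2r; case: ifPn => cd; last by rewrite mule0.
  by rewrite -!EFinB -EFinM ltr0_norm //; congr EFin; field.
- have -> : (fun x : R => a * x + b) @^-1` `]c, d] = `](c - b) / a, (d - b) / a]%classic.
    apply/seteqP; split => x /=; rewrite !in_itv /= ler_pdivlMr // ltr_pdivrMr //; lra.
  rewrite !lebesgue_measure_itv /= !lte_fin ltr_pM2r ?invr_gt0 //.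
  rewrite ltrD2r; case: ifPn => cd; last by rewrite mule0.
  by rewrite -!EFinB -EFinM gtr0_norm //; congr EFin; field.
Qed.

Lemma ge0_integral_affine (a b : R) (f : R -> \bar R) : a != 0 ->
  measurable_fun setT f -> (forall x, 0 <= f x)%E ->
  (\int[mu]_x f x = `|a|%:E * \int[mu]_x f (a * x + b)%R)%E.
Proof.
move=> a0 mf f0.
transitivity (\int[affine_image_measure a b]_x f x)%E.
  by apply: eq_measure_integral => /= A mA _; exact: lebesgue_measure_affine.
rewrite ge0_integral_mscale //=.
by rewrite (ge0_integral_pushforward (measurable_affine a b)) //= => x _.
Qed.


Section Substitution.
Variables (K K' : R -> R) (a b : R).
Hypothesis ab : a < b.
Hypothesis dK : forall y : R, a <= y <= b -> is_derive y 1 K (K' y).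
Hypothesis cK' : forall y : R, a <= y <= b -> {for y, continuous K'}.

Let derive1K y : a <= y <= b -> K^`()%classic y = K' y.
Proof. by move=> yab; have d := dK yab; rewrite derive1E derive_val. Qed.

Let cK y : a <= y <= b -> {for y, continuous K}.
Proof.
by move=> yab; have d := dK yab; exact: differentiable_continuous (is_derive_differentiable d).
Qed.

Let near_itv y : a < y < b -> \forall z \near y, a < z < b.
Proof. by move=> yab; apply: open_nbhs_nbhs; split => //; exact: open_itv. Qed.

Let cdK : {in `]a, b[, continuous K^`()%classic}.
Proof.
move=> y; rewrite in_itv /= => yab.
have yab' : a <= y <= b by lra.
have cy : K' z @[z --> y] --> K^`()%classic y by rewrite derive1K //; exact: cK'.
apply: cvg_trans cy; apply: near_eq_cvg.
near=> z; rewrite derive1K //; suff : a < z < b by lra.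
by near: z; exact: near_itv.
Unshelve. all: by end_near. Qed.

Let cvg_at_a : cvg (K^`()%classic x @[x --> a^'+]).
Proof.
have aab : a <= a <= b by rewrite lexx ltW.
apply/cvg_ex; exists (K' a).
have ca : K' z @[z --> a^'+] --> K' a by apply: cvg_at_right_filter; exact: cK'.
apply: cvg_trans ca; apply: near_eq_cvg.
near=> z; rewrite derive1K //; apply/andP; split; apply: ltW; near: z.
  exact: nbhs_right_gt.
exact: nbhs_right_lt.
Unshelve. all: by end_near. Qed.

Let cvg_at_b : cvg (K^`()%classic x @[x --> b^'-]).
Proof.
have bab : a <= b <= b by rewrite lexx ltW.
apply/cvg_ex; exists (K' b).
have cb : K' z @[z --> b^'-] --> K' b by apply: cvg_at_left_filter; exact: cK'.
apply: cvg_trans cb; apply: near_eq_cvg.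
near=> z; rewrite derive1K //; apply/andP; split; apply: ltW; near: z.
  exact: nbhs_left_gt.
exact: nbhs_left_lt.
Unshelve. all: by end_near. Qed.

Let doo : derivable_oo_LRcontinuous K a b.
Proof.
split.
- move=> y; rewrite in_itv /= => yab; have d : is_derive y 1 K (K' y) by apply: dK; lra.
  exact: ex_derive.
- by apply: cvg_at_right_filter; apply: cK; rewrite lexx ltW.
- by apply: cvg_at_left_filter; apply: cK; rewrite lexx ltW.
Qed.

Let cwK : {within `[a, b], continuous K}.
Proof.
by apply: continuous_in_subspaceT => y; rewrite inE /= in_itv /=; exact: cK.
Qed.

Let mvt x y : a <= x -> x < y -> y <= b -> exists2 z, a <= z <= b & K y - K x = K' z * (y - x).
Proof.
move=> ax xy yb.
have cxy : {within `[x, y], continuous K}.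
  by apply: continuous_in_subspaceT => z; rewrite inE /= in_itv /= => zxy; apply: cK; lra.
have dxy z : z \in `]x, y[%R -> is_derive z 1 K (K' z).
  by rewrite in_itv /= => zxy; apply: dK; lra.
have [z zxy e] := MVT xy dxy cxy.
by exists z => //; move: zxy; rewrite in_itv /=; lra.
Qed.

Lemma increasing_image_itvco : (forall y, a <= y <= b -> 0 < K' y) ->
  [set K y | y in [set y : R | a <= y < b]] = `[K a, K b[%classic.
Proof.
move=> K'0.
have inc x y : a <= x -> x < y -> y <= b -> K x < K y.
  move=> ax xy yb; have [z zab e] := mvt ax xy yb.
  by rewrite -subr_gt0 e mulr_gt0 ?K'0 //; lra.
apply/seteqP; split => [_ [y /= /andP[ay yb] <-]|u /=]; rewrite in_itv /=.
  rewrite inc // andbT; have [->|ya] := eqVneq a y; first by rewrite lexx.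
  by apply/ltW/inc; [exact: lexx|rewrite lt_neqAle ya|exact: ltW].
move=> /andP[au ub].
have := inc _ _ (lexx a) ab (lexx b) => Kab.
have [|y yab e] := IVT (ltW ab) cwK (v := u).
  by rewrite ge_min le_max au (ltW ub) orbT.
exists y => //=; move: yab; rewrite in_itv /= => /andP[-> yb] /=.
by rewrite lt_neqAle yb andbT; apply/eqP => yb'; move: ub; rewrite -e yb' ltxx.
Qed.

Lemma decreasing_image_itvoc : (forall y, a <= y <= b -> K' y < 0) ->
  [set K y | y in [set y : R | a <= y < b]] = `]K b, K a]%classic.
Proof.
move=> K'0.
have dec x y : a <= x -> x < y -> y <= b -> K y < K x.
  move=> ax xy yb; have [z zab e] := mvt ax xy yb.
  by rewrite -subr_lt0 e pmulr_llt0 ?K'0 //; lra.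
apply/seteqP; split => [_ [y /= /andP[ay yb] <-]|u /=]; rewrite in_itv /=.
  rewrite dec //=; have [->|ya] := eqVneq a y; first by rewrite lexx.
  by apply/ltW/dec; [exact: lexx|rewrite lt_neqAle ya|exact: ltW].
move=> /andP[bu ua].
have := dec _ _ (lexx a) ab (lexx b) => Kab.
have [|y yab e] := IVT (ltW ab) cwK (v := u).
  by rewrite ge_min le_max ua (ltW bu) orbT.
exists y => //=; move: yab; rewrite in_itv /= => /andP[-> yb] /=.
by rewrite lt_neqAle yb andbT; apply/eqP => yb'; move: bu; rewrite -e yb' ltxx.
Qed.

(** Pieces are taken half-open in y so that consecutive ones tile the curve. Which end of the image
    is open depends on the sign of [K'], and end points have measure zero. *)
Lemma integral_substitution_image (G : R -> R) : continuous G ->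
  (forall y, a <= y <= b -> 0 < K' y) \/ (forall y, a <= y <= b -> K' y < 0) ->
  (\int[mu]_(u in [set K y | y in [set y : R | (a <= y < b)%R]]) (G u)%:E)%E =
  (\int[mu]_(y in `[a, b]) (G (K y) * `|K' y|)%:E)%E.
Proof.
move=> cG sK.
have mG : measurable_fun setT (EFin \o G).
  by apply/measurable_EFinP; exact: continuous_measurable_fun.
case: sK => K'0.
- rewrite increasing_image_itvco // integral_itv_bndo_bndc; last exact: measurable_funTS.
  rewrite (integration_by_substitution_increasing (ltW ab)) //.
  + apply: eq_integral => y; rewrite inE /= in_itv /= => yab.
    by rewrite !fctE derive1K // gtr0_norm ?K'0.
  + move=> x y; rewrite !in_itv /= => xab yab xy.
    have [|||z zab e] := @mvt x y; [lra|lra|lra|].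
    by rewrite -subr_gt0 e mulr_gt0 ?K'0 //; lra.
  + by apply: continuous_subspaceT.
- rewrite decreasing_image_itvoc // integral_itv_obnd_cbnd; last exact: measurable_funTS.
  rewrite (integration_by_substitution_decreasing (ltW ab)) //.
  + apply: eq_integral => y; rewrite inE /= in_itv /= => yab.
    by rewrite !fctE derive1K // ltr0_norm ?K'0.
  + move=> x y; rewrite !in_itv /= => xab yab xy.
    have [|||z zab e] := @mvt y x; [lra|lra|lra|].
    by rewrite -subr_lt0 e pmulr_llt0 ?K'0 //; lra.
  + by apply: continuous_subspaceT.
Qed.

End Substitution.

End PlaneMeasure.

(** * Area formula for the tube *)

Section TubePiece.
Context {R : realType}.
Notation mu := (@lebesgue_measure R).

(** Frenet equations in coordinates, with signed speed [lam]: f' = - lam rot90 n and n' = kap lam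
    rot90 n. The bound on [eps] keeps the Jacobian factor 1 - z kap at least 1 / 2. The two
    coordinates are kept apart so that the axes can be exchanged. *)
Definition tube_frame (f1 f2 n1 n2 lam kap : R -> R) (eps : R) : Prop :=
  [/\ forall y : R, is_derive y 1 f1 (lam y * n2 y),
      forall y : R, is_derive y 1 f2 (- (lam y * n1 y)),
      forall y : R, is_derive y 1 n1 (- (kap y * (lam y * n2 y))) &
      forall y : R, is_derive y 1 n2 (kap y * (lam y * n1 y))] /\
  [/\ forall y, n1 y ^+ 2 + n2 y ^+ 2 = 1, continuous lam, continuous kap,
      forall y, lam y != 0 & 0 < eps /\ forall y, eps * `|kap y| <= 1 / 2].

Definition tube_map (f1 f2 n1 n2 : R -> R) (y z : R) : R * R :=
  (f1 y + z * n1 y, f2 y + z * n2 y).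

Definition tube_image (f1 f2 n1 n2 : R -> R) (eps a b : R) : set (R * R) :=
  [set x | exists y z : R, [/\ a <= y < b, `|z| < eps & x = tube_map f1 f2 n1 n2 y z]].

(** Measurability is part of the formula because adding the formulas of adjacent pieces requires
    it. *)
Definition tube_formula (f1 f2 n1 n2 lam kap : R -> R) (eps : R) (g : R * R -> R) (a b : R) :=
  measurable_fun [set: R * R] (fun x => (g x * \1_(tube_image f1 f2 n1 n2 eps a b) x)%:E) /\
  (\int[@plane_measure R]_x (g x * \1_(tube_image f1 f2 n1 n2 eps a b) x)%:E =
  \int[mu]_(y in `[a, b]) \int[mu]_(z in `[(- eps)%R, eps])
    (g (tube_map f1 f2 n1 n2 y z) * (`|lam y| * (1 - z * kap y)))%:E)%E.

Lemma continuous_comp_fst (u : R -> R) : continuous u -> continuous (fun p : R * R => u p.1).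
Proof. by move=> cu p; apply: continuous_comp; [exact: continuous_fst|exact: cu]. Qed.

Lemma continuous_comp_snd (u : R -> R) : continuous u -> continuous (fun p : R * R => u p.2).
Proof. by move=> cu p; apply: continuous_comp; [exact: continuous_snd|exact: cu]. Qed.

Lemma continuous_clamp (a b : R) : continuous (fun y : R => Num.min b (Num.max a y)).
Proof.
move=> y; apply: continuous_min; first exact: cvg_cst.
by apply: continuous_max; [exact: cvg_cst|exact: cvg_id].
Qed.

Section Piece.
Variables (f1 f2 n1 n2 lam kap : R -> R) (eps : R).
Hypothesis fr : tube_frame f1 f2 n1 n2 lam kap eps.

Let F := tube_map f1 f2 n1 n2.
(** The normal line at y meets the horizontal line of ordinate v at height [zz y v], in the point of
    abscissa [K y v]. The derivative [K'] of the abscissa in y, times [n2 y], is the Jacobian at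
    this point. *)
Let zz y v := (v - f2 y) / n2 y.
Let K y v := f1 y + zz y v * n1 y.
Let K' y v := lam y / n2 y * (1 - zz y v * kap y).

Let eps0 : 0 < eps. Proof. by have [_ [_ _ _ _ []]] := fr. Qed.

Let cf1 : continuous f1.
Proof.
move=> y; have [[d _ _ _] _] := fr.
by have dy := d y; exact: differentiable_continuous (is_derive_differentiable dy).
Qed.
Let cf2 : continuous f2.
Proof.
move=> y; have [[_ d _ _] _] := fr.
by have dy := d y; exact: differentiable_continuous (is_derive_differentiable dy).
Qed.
Let cn1 : continuous n1.
Proof.
move=> y; have [[_ _ d _] _] := fr.
by have dy := d y; exact: differentiable_continuous (is_derive_differentiable dy).
Qed.
Let cn2 : continuous n2.
Proof.
move=> y; have [[_ _ _ d] _] := fr.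
by have dy := d y; exact: differentiable_continuous (is_derive_differentiable dy).
Qed.
Let clam : continuous lam. Proof. by have [_ []] := fr. Qed.
Let ckap : continuous kap. Proof. by have [_ []] := fr. Qed.

Let dK y v : n2 y != 0 -> is_derive y 1 (K^~ v) (K' y v).
Proof.
move=> n20; have [[df1 df2 dn1 dn2] [nn _ _ _ _]] := fr.
have d1 := df1 y; have d2 := df2 y; have d3 := dn1 y; have d4 := dn2 y.
have d5 : is_derive y 1 (fun y => (n2 y)^-1) (- (n2 y) ^- 2 *: (kap y * (lam y * n1 y))).
  exact: is_deriveV.
apply: is_derive_eq; rewrite /K' /zz /GRing.scale /=.
have e : n1 y ^+ 2 = 1 - n2 y ^+ 2 by rewrite -(nn y); ring.
transitivity (lam y * n2 y + lam y * n1 y ^+ 2 / n2 y + (v - f2 y) * (- (kap y * lam y) - kap y * lam y * n1 y ^+ 2 / n2 y ^+ 2)).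
  by field.
by rewrite e; field.
Qed.

Let F_K y v : n2 y != 0 -> F y (zz y v) = (K y v, v).
Proof. by move=> n20; rewrite /F /tube_map /K; congr pair; rewrite /zz; field. Qed.

Let kap_bound y z : `|z| <= eps -> 0 < 1 - z * kap y.
Proof.
move=> zE; have [_ [_ _ _ _ [_ ke]]] := fr.
rewrite subr_gt0; apply: le_lt_trans (ler_norm _) _; rewrite normrM.
have h : `|z| * `|kap y| <= eps * `|kap y| by rewrite ler_wpM2r.
have := ke y; lra.
Qed.

Section Local.
Variables (y0 d : R).
Hypothesis n20 : n2 y0 != 0.
Let I := [set y : R | y0 - d < y < y0 + d].
Hypothesis n2_near : forall y, I y -> `|n2 y - n2 y0| <= `|n2 y0| / 8.
Hypothesis f2_near : forall y, I y -> `|f2 y - f2 y0| <= eps * `|n2 y0| / 16.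
Hypothesis lam_near : forall y, I y -> 0 < lam y * lam y0.

(** [V] is a window of ordinates common to all y in [I], with half-width between those of heights
    eps / 2 and eps. In units of eps |n2 y0|: inside [V] one has |v - f2 y| <= 3/4 + 1/16 < 7/8, so
    the height is at most eps; outside, |v - f2 y| > 3/4 - 1/16 > 9/16, so it exceeds eps / 2. *)
Let c := 3 / 4 * (eps * `|n2 y0|).
Let V := [set v : R | `|v - f2 y0| <= c].

Let N0 : 0 < `|n2 y0|. Proof. by rewrite normr_gt0. Qed.

Let n2_lower y : I y -> 7 / 8 * `|n2 y0| <= `|n2 y| <= 9 / 8 * `|n2 y0|.
Proof.
move=> Iy; have := n2_near Iy.
have := ler_normD (n2 y - n2 y0) (n2 y0); rewrite subrK.
have := ler_normD (n2 y0 - n2 y) (n2 y); rewrite subrK distrC; lra.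
Qed.

Let n2_neq0 y : I y -> n2 y != 0.
Proof. by move=> Iy; have := n2_lower Iy; have := N0; rewrite -normr_gt0; lra. Qed.

Let n2_sign y : I y -> 0 < n2 y * n2 y0.
Proof.
move=> Iy; have := n2_near Iy; rewrite ler_distl.
have [n0|n0|e] := ltgtP (n2 y0) 0; last by move: n20; rewrite e eqxx.
- by rewrite ltr0_norm // nmulr_lgt0 //; lra.
- by rewrite gtr0_norm // pmulr_lgt0 //; lra.
Qed.

Let V_le y v : I y -> V v -> `|zz y v| <= eps.
Proof.
move=> Iy; rewrite /V /c /= => Vv.
rewrite /zz normrM normfV ler_pdivrMr ?normr_gt0 ?n2_neq0 //.
have := ler_normD (v - f2 y0) (f2 y0 - f2 y); rewrite subrKA (distrC (f2 y0)).
have := f2_near Iy.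
have : eps * (7 / 8 * `|n2 y0|) <= eps * `|n2 y|.
  by rewrite ler_pM2l //; have := n2_lower Iy; lra.
have : 0 < eps * `|n2 y0| by rewrite mulr_gt0.
lra.
Qed.

Let nV_gt y v : I y -> ~ V v -> eps / 2 < `|zz y v|.
Proof.
move=> Iy; rewrite /V /c /= => /negP; rewrite -ltNge => Vv.
rewrite /zz normrM normfV ltr_pdivlMr ?normr_gt0 ?n2_neq0 //.
have := ler_normD (v - f2 y) (f2 y - f2 y0); rewrite subrKA.
have := f2_near Iy.
have : eps * `|n2 y| <= eps * (9 / 8 * `|n2 y0|).
  by rewrite ler_pM2l //; have := n2_lower Iy; lra.
have : 0 < eps * `|n2 y0| by rewrite mulr_gt0.
lra.
Qed.

Let K'_sign v a b : I a -> I b -> V v ->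
  (forall y, a <= y <= b -> 0 < K' y v) \/ (forall y, a <= y <= b -> K' y v < 0).
Proof.
move=> Ia Ib Vv.
have Iy y : a <= y <= b -> I y by rewrite /I /= in Ia Ib *; lra.
have K'E y : a <= y <= b -> K' y v * (lam y0 * n2 y0) =
    (lam y * lam y0) * (n2 y * n2 y0) / n2 y ^+ 2 * (1 - zz y v * kap y).
  by move=> yab; rewrite /K'; field; exact: n2_neq0 (Iy _ yab).
have pos y : a <= y <= b -> 0 < K' y v * (lam y0 * n2 y0).
  move=> yab; rewrite K'E //; have Iy' := Iy _ yab.
  apply: mulr_gt0; last exact/kap_bound/V_le.
  apply: divr_gt0; last by rewrite exprn_even_gt0 //= n2_neq0.
  by apply: mulr_gt0; [exact: lam_near|exact: n2_sign].
have [n0|n0|e] := ltgtP (lam y0 * n2 y0) 0.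
- by right => y /pos; rewrite nmulr_lgt0.
- by left => y /pos; rewrite pmulr_lgt0.
- by left => y /pos; rewrite e mulr0 ltxx.
Qed.

Let cK' v y : n2 y != 0 -> {for y, continuous (K'^~ v)}.
Proof.
move=> ny; apply: cvgM; first by apply: cvgM; [exact: clam|apply: cvgV => //; exact: cn2].
apply: cvgB; first exact: cvg_cst.
apply: cvgM; last exact: ckap.
apply: cvgM; last by apply: cvgV => //; exact: cn2.
by apply: cvgB; [exact: cvg_cst|exact: cf2].
Qed.

Section Integral.
Variables (a b : R) (g : R * R -> R).
Hypothesis ab : a < b.
Hypothesis Ia : I a.
Hypothesis Ib : I b.
Hypothesis cg : continuous g.
Hypothesis g0 : forall x, 0 <= g x.
Hypothesis gF : forall y z, eps / 2 <= `|z| <= eps -> g (F y z) = 0.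

Let Iy y : a <= y <= b -> I y.
Proof. by have := Ia; have := Ib; rewrite /I /=; lra. Qed.

Let T := tube_image f1 f2 n1 n2 eps a b.
Let Rg := [set p : R * R | V p.2 /\ [set K y p.2 | y in [set y : R | a <= y < b]] p.1].

(** The curved piece of tube is traded for a region whose window [V] of ordinates is the same for
    all y: the two differ only at heights from eps / 2 to eps, where [g] vanishes. *)
Let gT x : g x * \1_T x = g x * \1_Rg x.
Proof.
have [->|gx] := eqVneq (g x) 0; first by rewrite !mul0r.
rewrite !indicE; congr (_ * (nat_of_bool _)%:R); apply/idP/idP; rewrite !inE.
  move=> [y [z [yab ze xE]]].
  have zlt : `|z| < eps / 2.
    rewrite ltNge; apply/negP => ez.
    by move: gx; rewrite xE -/(F y z) gF ?eqxx // ez ltW.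
  have ny : n2 y != 0 by apply/n2_neq0/Iy; lra.
  have e : zz y x.2 = z by rewrite xE /zz /tube_map /=; field.
  split.
    have Iy' : I y by apply: Iy; lra.
    by apply: contrapT => /(nV_gt Iy'); rewrite e; lra.
  exists y => //; rewrite /K e xE //=.
case=> Vx [y yab e]; exists y, (zz y x.2).
have Iy' : I y by apply: Iy; move: yab => /=; lra.
have ny := n2_neq0 Iy'.
have xE : x = F y (zz y x.2) by rewrite F_K // e -surjective_pairing.
split => //.
have := V_le Iy' Vx; rewrite le_eqVlt => /predU1P[ee|//].
have e2 : eps / 2 <= `|zz y x.2| <= eps by rewrite ee lexx andbT; have := eps0; lra.
by case/eqP: gx; rewrite xE gF.
Qed.

Let K_affine y : n2 y != 0 -> continuous (K y).
Proof.
move=> ny v; apply: cvgD; first exact: cvg_cst.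
apply: cvgM; last exact: cvg_cst.
apply: cvgM; last exact: cvg_cst.
by apply: cvgB; [exact: cvg_id|exact: cvg_cst].
Qed.

Let mV : measurable V.
Proof.
rewrite (_ : V = `[f2 y0 - c, f2 y0 + c]%classic) //.
by apply/seteqP; split => v; rewrite /V /= in_itv /= ler_distl.
Qed.

Let dKab v y : a <= y <= b -> is_derive y 1 (K^~ v) (K' y v).
Proof. by move=> yab; apply/dK/n2_neq0/Iy. Qed.

Let cK'ab v y : a <= y <= b -> {for y, continuous (K'^~ v)}.
Proof. by move=> yab; apply/cK'/n2_neq0/Iy. Qed.

Let mRg : measurable Rg.
Proof.
have na : n2 a != 0 by exact: n2_neq0.
have nb : n2 b != 0 by exact: n2_neq0.
(* [Rg] lies between the graphs of [K a] and [K b], closed on the side of a and open on the side of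
   b. The factors 1 and - 1 cover the two possible orders of these graphs. *)
pose A (u : R) : set (R * R) := [set p | 0 <= u * (p.1 - K a p.2)].
pose B (u : R) : set (R * R) := [set p | 0 < u * (K b p.2 - p.1)].
have mA u : measurable (A u).
  rewrite (_ : A u = (fun p : R * R => u * (p.1 - K a p.2)) @^-1` `[0, +oo[%classic).
    rewrite -[X in measurable X]setTI; apply: continuous_measurable_plane => // p.
    apply: cvgM; first exact: cvg_cst.
    apply: cvgB; first exact: continuous_fst.
    exact: continuous_comp_snd (K_affine na) p.
  by apply/seteqP; split => p /=; rewrite in_itv /= andbT.
have mB u : measurable (B u).
  rewrite (_ : B u = (fun p : R * R => u * (K b p.2 - p.1)) @^-1` `]0, +oo[%classic).
    rewrite -[X in measurable X]setTI; apply: continuous_measurable_plane => // p.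
    apply: cvgM; first exact: cvg_cst.
    apply: cvgB; last exact: continuous_fst.
    exact: continuous_comp_snd (K_affine nb) p.
  by apply/seteqP; split => p /=; rewrite in_itv /= andbT.
have mVp : measurable [set p : R * R | V p.2].
  rewrite (_ : [set p | _] = setT `*` V); first exact: measurableX.
  by apply/seteqP; split => p //= [].
suff -> : Rg = [set p : R * R | V p.2] `&` ((A 1 `&` B 1) `|` (A (- 1) `&` B (- 1))).
  by apply: measurableI => //; apply: measurableU; exact: measurableI.
have aab : a <= a <= b by rewrite lexx ltW.
have bab : a <= b <= b by rewrite lexx ltW.
have aS : [set y : R | a <= y < b] a by rewrite /= lexx ab.
apply/seteqP; split => [[u v] [Vv Ru]|[u v] [Vv H]]; (split; first by []).
  rewrite /= in Vv Ru; have Vv' : V v by [].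
  have [pos|neg] := K'_sign Ia Ib Vv'; [left|right].
    have : [set K y v | y in [set y : R | a <= y < b]] u by exact: Ru.
    rewrite (increasing_image_itvco ab (@dKab v) pos) /= in_itv /= /A /B /= !mul1r.
    by move=> uab; split; lra.
  have : [set K y v | y in [set y : R | a <= y < b]] u by exact: Ru.
  rewrite (decreasing_image_itvoc ab (@dKab v) neg) /= in_itv /= /A /B /= !mulN1r.
  by move=> uab; split; lra.
rewrite /= in Vv; have Vv' : V v by [].
move: H; rewrite /A /B /= !mul1r !mulN1r => H.
have [pos|neg] := K'_sign Ia Ib Vv'.
  have im := increasing_image_itvco ab (@dKab v) pos.
  have Ka : `[K a v, K b v[%classic (K a v) by rewrite -im; exists a.
  have : `[K a v, K b v[%classic u by move: Ka; rewrite /= !in_itv /=; lra.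
  by rewrite -im.
have im := decreasing_image_itvoc ab (@dKab v) neg.
have Ka : `]K b v, K a v]%classic (K a v) by rewrite -im; exists a.
have : `]K b v, K a v]%classic u by move: Ka; rewrite /= !in_itv /=; lra.
by rewrite -im.
Qed.

Let Kc p := g (K p.1 p.2, p.2) * `|K' p.1 p.2|.

Let Phi (p : R * R) : R := \1_(`[a, b]%classic : set R) p.1 * \1_V p.2 * Kc p.

Let Phi_ge0 p : 0 <= Phi p.
Proof. by rewrite /Phi /Kc !mulr_ge0. Qed.

Let mPhi : measurable_fun setT (EFin \o Phi).
Proof.
(* Clamping y to [[a, b]] keeps n2 away from 0, so that [Phi] becomes the product of an indicator
   and a function continuous on the whole plane. *)
pose cl (y : R) : R := Num.min b (Num.max a y).
have clab y : a <= cl y <= b by rewrite /cl le_min ge_min le_max !lexx (ltW ab).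
have cl_id y : a <= y <= b -> cl y = y.
  by move=> /andP[ay yb]; rewrite /cl max_r // min_r.
have ccl : continuous (fun p : R * R => cl p.1).
  by apply: continuous_comp_fst; exact: continuous_clamp.
have cu (u : R -> R) : continuous u -> continuous (fun p : R * R => u (cl p.1)).
  by move=> cu p; apply: continuous_comp; [exact: ccl|exact: cu].
have ncl y : n2 (cl y) != 0 by apply/n2_neq0/Iy.
have cz : continuous (fun p : R * R => zz (cl p.1) p.2).
  move=> p; apply: cvgM.
    by apply: cvgB; [exact: continuous_snd|exact: (cu f2)].
  by apply: cvgV => //; exact: (cu n2).
have cKcl : continuous (fun p : R * R => Kc (cl p.1, p.2)).
  move=> p; apply: cvgM => /=.
    apply: (@continuous_comp _ _ _ (fun p : R * R => (K (cl p.1) p.2, p.2)) g); last exact: cg.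
    apply: continuous_pair; last exact: continuous_snd.
    apply: cvgD; first exact: (cu f1).
    by apply: cvgM; [exact: cz|exact: (cu n1)].
  apply: cvg_norm; apply: cvgM.
    by apply: cvgM; [exact: (cu lam)|apply: cvgV => //; exact: (cu n2)].
  apply: cvgB; first exact: cvg_cst.
  by apply: cvgM; [exact: cz|exact: (cu kap)].
rewrite (_ : Phi = fun p => \1_(`[a, b]%classic `*` V) p * Kc (cl p.1, p.2)).
  apply/measurable_EFinP; apply: measurable_funM; last exact: continuous_measurable_plane.
  by apply: measurable_indic; exact: measurableX.
apply/funext => -[y v]; rewrite /Phi /= !indicE in_setX /= -natrM mulnb.
have [yab|] := boolP (y \in `[a, b]%classic); last by rewrite !mul0r.
by rewrite cl_id //; move: yab; rewrite inE /= in_itv.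
Qed.

Let mgR : measurable_fun setT (fun x => (g x * \1_Rg x)%:E).
Proof.
apply/measurable_EFinP; apply: measurable_funM; first exact: continuous_measurable_plane.
by apply: measurable_indic; exact: mRg.
Qed.

Let horizontal v :
  (\int[mu]_u (g (u, v) * \1_Rg (u, v))%:E = \int[mu]_y (Phi (y, v))%:E)%E.
Proof.
have [Vv|nVv] := pselect (V v); last first.
  transitivity (\int[mu]_(u in setT) (cst 0%E : R -> \bar R) u)%E.
    apply: eq_integral => u _; rewrite indicE memNset ?mulr0 //.
    by move=> [].
  by apply: eq_integral => u _; rewrite /Phi /= [\1_V v]indicE memNset // mulr0 mul0r.
have cgv : continuous (fun u : R => g (u, v)).
  move=> u; apply: continuous_comp; last exact: cg.
  by apply: continuous_pair; [exact: cvg_id|exact: cvg_cst].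
have := integral_substitution_image ab (@dKab v) (@cK'ab v) cgv (K'_sign Ia Ib Vv).
rewrite integral_mkcond [in RHS]integral_mkcond => e.
transitivity (\int[mu]_u ((fun u => (g (u, v))%:E) \_ [set K y v | y in [set y : R | (a <= y < b)%R]]) u)%E.
  apply: eq_integral => u _; rewrite patchE indicE.
  rewrite (_ : ((u, v) \in Rg) = (u \in [set K y v | y in [set y : R | a <= y < b]])).
    by case: ifP; rewrite ?mulr1 ?mulr0.
  apply/idP/idP; rewrite !inE; first by case.
  by move=> uK; split.
rewrite e; apply: eq_integral => y _; rewrite patchE /Phi /= !indicE (mem_set Vv) mulr1.
by case: ifP; rewrite ?mul1r ?mul0r.
Qed.

Let vertical y : a <= y <= b ->
  (\int[mu]_v (Phi (y, v))%:E = \int[mu]_(z in `[(- eps)%R, eps])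
    (g (F y z) * (`|lam y| * (1 - z * kap y)))%:E)%E.
Proof.
move=> yab; have yI := Iy yab; have ny := n2_neq0 yI.
rewrite [RHS]integral_mkcond.
pose H (z : R) : R := g (F y z) * (`|lam y| * (1 - z * kap y)) * \1_(`[- eps, eps]%classic : set R) z.
have H0 z : 0 <= H z.
  rewrite /H indicE; have [zE|_] := boolP (z \in _); last by rewrite mulr0.
  rewrite mulr1 mulr_ge0 // mulr_ge0 // ltW // kap_bound //.
  by move: zE; rewrite inE /= in_itv /= ler_norml.
have mH : measurable_fun setT H.
  apply: measurable_funM; last exact: measurable_indic.
  apply: continuous_measurable_fun => z; apply: cvgM.
    apply: (@continuous_comp _ _ _ (F y) g); last exact: cg.
    by apply: continuous_pair; (apply: cvgD; first exact: cvg_cst);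
      apply: cvgM; [exact: cvg_id|exact: cvg_cst|exact: cvg_id|exact: cvg_cst].
  apply: cvgM; first exact: cvg_cst.
  apply: cvgB; first exact: cvg_cst.
  by apply: cvgM; [exact: cvg_id|exact: cvg_cst].
transitivity (\int[mu]_z (H z)%:E)%E; last first.
  apply: eq_integral => z _; rewrite patchE /H indicE.
  by case: ifP; rewrite ?mulr1 ?mulr0.
have nyi : (n2 y)^-1 != 0 by rewrite invr_eq0.
rewrite [RHS](ge0_integral_affine (- (f2 y / n2 y)) nyi); last 2 first.
  by apply/measurable_EFinP.
  by move=> z; rewrite lee_fin.
rewrite -[RHS]ge0_integralZl //; last 2 first.
  apply/measurable_EFinP; apply: measurableT_comp => //.
  by apply: measurable_funD => //; exact: measurable_funM.
  by move=> z _; rewrite lee_fin.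
apply: eq_integral => v _; rewrite -EFinM; congr EFin.
have -> : (n2 y)^-1 * v + - (f2 y / n2 y) = zz y v by rewrite /zz; field.
rewrite /Phi /= /Kc /H /= F_K // [\1_(`[a, b]%classic : set R) y]indicE mem_set /= ?in_itv //= mul1r.
rewrite !indicE.
have [Vv|nVv] := pselect (V v).
  have zE := V_le yI Vv.
  rewrite (mem_set Vv) mem_set /=; last by rewrite in_itv /= -ler_norml.
  rewrite mul1r mulr1 /K' normrM (gtr0_norm (kap_bound y zE)) normrM normfV; ring.
rewrite memNset // !mul0r; have := nV_gt yI nVv => zE.
have [zi|] := boolP (_ \in _); last by rewrite !mulr0.
rewrite -F_K // gF ?mul0r ?mulr0 //.
by move: zi; rewrite inE /= in_itv /= -ler_norml (ltW zE).
Qed.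

Lemma tube_formula_local : tube_formula f1 f2 n1 n2 lam kap eps g a b.
Proof.
have gE : (fun x => (g x * \1_T x)%:E) = (fun x => (g x * \1_Rg x)%:E).
  by apply/funext => x; rewrite gT.
split; rewrite -/T gE //.
transitivity (\int[mu]_v \int[mu]_u (g (u, v) * \1_Rg (u, v))%:E)%E.
  apply: (fubini_tonelli2 (m1 := mu) (m2 := mu) _ mgR) => x.
  by rewrite lee_fin mulr_ge0.
transitivity (\int[mu]_v \int[mu]_y (Phi (y, v))%:E)%E.
  by apply: eq_integral => v _; exact: horizontal.
transitivity (\int[mu]_y \int[mu]_v (Phi (y, v))%:E)%E.
  apply/esym/(fubini_tonelli (m1 := mu) (m2 := mu) _ mPhi) => x.
  by rewrite lee_fin.
rewrite [RHS]integral_mkcond; apply: eq_integral => y _; rewrite patchE.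
case: ifPn => yab.
  by rewrite -vertical //; move: yab; rewrite inE /= in_itv.
transitivity (\int[mu]_(v in setT) (cst 0%E : R -> \bar R) v)%E.
  by apply: eq_integral => v _; rewrite /Phi /= indicE (negPf yab) !mul0r.
by rewrite integral0.
Qed.

End Integral.
End Local.
End Piece.

Lemma tube_frame_continuous f1 f2 n1 n2 lam kap eps :
  tube_frame f1 f2 n1 n2 lam kap eps ->
  [/\ continuous f1, continuous f2, continuous n1 & continuous n2].
Proof.
move=> [[d1 d2 d3 d4] _]; split=> y.
- by have dy := d1 y; exact: differentiable_continuous (is_derive_differentiable dy).
- by have dy := d2 y; exact: differentiable_continuous (is_derive_differentiable dy).
- by have dy := d3 y; exact: differentiable_continuous (is_derive_differentiable dy).
- by have dy := d4 y; exact: differentiable_continuous (is_derive_differentiable dy).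
Qed.

Lemma tube_frame_swap f1 f2 n1 n2 lam kap eps :
  tube_frame f1 f2 n1 n2 lam kap eps ->
  tube_frame f2 f1 n2 n1 (fun y => - lam y) kap eps.
Proof.
move=> [[d1 d2 d3 d4] [nn cl ck l0 ek]]; split; split => //.
- by move=> y; have := d2 y; rewrite mulNr.
- by move=> y; have := d1 y; rewrite mulNr opprK.
- by move=> y; have := d4 y; rewrite mulNr mulrN opprK.
- by move=> y; have := d3 y; rewrite mulNr mulrN.
- by move=> y; rewrite addrC nn.
- by move=> y; apply: cvgN; exact: cl.
- by move=> y; rewrite oppr_eq0.
Qed.

Definition tube_test (f1 f2 n1 n2 : R -> R) (eps : R) (g : R * R -> R) :=
  [/\ continuous g, forall x, 0 <= g x &
      forall y z, eps / 2 <= `|z| <= eps -> g (tube_map f1 f2 n1 n2 y z) = 0].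

Lemma continuous_near_dist (f : R -> R) (x e : R) : {for x, continuous f} -> 0 < e ->
  \forall y \near x, `|f y - f x| < e.
Proof.
move=> cf e0; have /cvgrPdist_lt/(_ _ e0) := cf.
by apply: filterS => y; rewrite distrC.
Qed.

(* At fixed y substitute v = f2 y + z n2 y for z; exchange the integrals; at
   fixed v the first coordinate u is a monotone function of y. This only needs
   n2 <> 0, and the case n1 <> 0 follows by exchanging the coordinates. *)
Lemma tube_formula_near_second f1 f2 n1 n2 lam kap eps g y0 :
  tube_frame f1 f2 n1 n2 lam kap eps -> tube_test f1 f2 n1 n2 eps g -> n2 y0 != 0 ->
  exists2 d, 0 < d & forall a b, a < b -> y0 - d < a -> b < y0 + d ->
    tube_formula f1 f2 n1 n2 lam kap eps g a b.
Proof.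
move=> fr [cg g0 gF] n20; have [_ cf2 _ cn2] := tube_frame_continuous fr.
have [_ [_ cl _ l0 [e0 _]]] := fr.
have N0 : 0 < `|n2 y0| by rewrite normr_gt0.
have nr : \forall y \near y0, [/\ `|n2 y - n2 y0| <= `|n2 y0| / 8,
    `|f2 y - f2 y0| <= eps * `|n2 y0| / 16 & 0 < lam y * lam y0].
  near=> y; split.
  - apply: ltW; near: y; apply: continuous_near_dist; [exact: cn2|lra].
  - apply: ltW; near: y; apply: continuous_near_dist; first exact: cf2.
    by rewrite divr_gt0 // mulr_gt0.
  - near: y.
    have cll : lam y * lam y0 @[y --> y0] --> lam y0 * lam y0.
      by apply: cvgM; [exact: cl|exact: cvg_cst].
    apply: (cvgr_gt _ cll).
    by rewrite -expr2 exprn_even_gt0 //=.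
have [d /= d0 dP] := nr; exists d => // a b ab ya yb.
have dP' y : y0 - d < y < y0 + d -> [/\ `|n2 y - n2 y0| <= `|n2 y0| / 8,
    `|f2 y - f2 y0| <= eps * `|n2 y0| / 16 & 0 < lam y * lam y0].
  by move=> yd; apply: dP; rewrite /= ltr_distlC; lra.
apply: (@tube_formula_local _ _ _ _ _ _ _ fr y0 d n20) => //.
- by move=> y /dP' [].
- by move=> y /dP' [].
- by move=> y /dP' [].
- by rewrite /=; lra.
- by rewrite /=; lra.
Unshelve. all: by end_near. Qed.

Lemma tube_formula_swap f1 f2 n1 n2 lam kap eps g a b : (forall x, 0 <= g x) ->
  tube_formula f2 f1 n2 n1 (fun y => - lam y) kap eps (fun x => g (x.2, x.1)) a b ->
  tube_formula f1 f2 n1 n2 lam kap eps g a b.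
Proof.
move=> g0 [mG eG].
set G := (fun x => _) in mG eG.
pose sw (x : R * R) : R * R := (x.2, x.1).
have GE : (fun x => (g x * \1_(tube_image f1 f2 n1 n2 eps a b) x)%:E) = G \o sw.
  apply/funext => x; rewrite /G /sw /= -surjective_pairing !indicE.
  congr (_ * (nat_of_bool _)%:R)%:E; apply/idP/idP; rewrite !inE => -[y [z [yab ze xE]]].
    by exists y, z; split => //; rewrite xE.
  by exists y, z; split => //; case: x xE => u v [-> ->].
have msw : measurable_fun setT sw.
  by apply: measurable_fun_pair; [exact: measurable_snd|exact: measurable_fst].
have mGs : measurable_fun setT (G \o sw) by exact: measurableT_comp.
split; rewrite GE //.
(* Invariance of the plane measure under the exchange [sw] is Tonelli's theorem used in both
   orders. *)
transitivity (\int[mu]_u \int[mu]_v (G (v, u)))%E.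
  apply: (fubini_tonelli1 (m1 := mu) (m2 := mu) _ mGs) => x.
  by rewrite lee_fin mulr_ge0.
transitivity (\int[@plane_measure R]_x G x)%E.
  apply/esym/(fubini_tonelli2 (m1 := mu) (m2 := mu) _ mG) => x.
  by rewrite lee_fin mulr_ge0.
rewrite eG; apply: eq_integral => y _; apply: eq_integral => z _.
by rewrite normrN.
Qed.

Lemma tube_formula_near f1 f2 n1 n2 lam kap eps g y0 :
  tube_frame f1 f2 n1 n2 lam kap eps -> tube_test f1 f2 n1 n2 eps g ->
  exists2 d, 0 < d & forall a b, a < b -> y0 - d < a -> b < y0 + d ->
    tube_formula f1 f2 n1 n2 lam kap eps g a b.
Proof.
move=> fr tg; have [n20|n20] := eqVneq (n2 y0) 0; last exact: tube_formula_near_second.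
have [_ [nn _ _ _ _]] := fr.
have n10 : n1 y0 != 0.
  apply/eqP => n10; have := nn y0; rewrite n10 n20 expr0n addr0 => /eqP.
  by rewrite eq_sym oner_eq0.
have [cg g0 gF] := tg.
have [|d d0 dP] := @tube_formula_near_second _ _ _ _ _ _ _ (fun x => g (x.2, x.1)) y0 (tube_frame_swap fr) _ n10.
- split => [x|x|y z zE]; [|exact: g0|exact: (gF y z)].
  apply: continuous_comp; last exact: cg.
  by apply: continuous_pair; [exact: continuous_snd|exact: continuous_fst].
by exists d => // a b ab ya yb; apply: tube_formula_swap => //; exact: dP.
Qed.

Section TubeAdd.
Variables (f1 f2 n1 n2 lam kap : R -> R) (eps L : R) (g : R * R -> R).
Hypothesis fr : tube_frame f1 f2 n1 n2 lam kap eps.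
Hypothesis tg : tube_test f1 f2 n1 n2 eps g.
Hypothesis inj : forall y y' z z', 0 <= y < L -> 0 <= y' < L -> `|z| < eps -> `|z'| < eps ->
  tube_map f1 f2 n1 n2 y z = tube_map f1 f2 n1 n2 y' z' -> y = y'.

Let J (y : R) : \bar R := (\int[mu]_(z in `[(- eps)%R, eps])
    (g (tube_map f1 f2 n1 n2 y z) * (`|lam y| * (1 - z * kap y)))%:E)%E.

Let integrand_ge0 y z : `|z| <= eps -> 0 <= g (tube_map f1 f2 n1 n2 y z) * (`|lam y| * (1 - z * kap y)).
Proof.
move=> ze; have [_ g0 _] := tg; rewrite mulr_ge0 // mulr_ge0 //.
have [_ [_ _ _ _ [_ ke]]] := fr.
rewrite subr_ge0; apply: le_trans (ler_norm _) _; rewrite normrM.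
have h : `|z| * `|kap y| <= eps * `|kap y| by rewrite ler_wpM2r.
have := ke y; lra.
Qed.

Let J_ge0 y : (0 <= J y)%E.
Proof.
apply: integral_ge0 => z /=; rewrite in_itv /= -ler_norml => ze.
by rewrite lee_fin integrand_ge0.
Qed.

Lemma measurable_tube_fiber : measurable_fun setT J.
Proof.
pose H (p : R * R) : R := g (tube_map f1 f2 n1 n2 p.1 p.2) * (`|lam p.1| * (1 - p.2 * kap p.1)).
have cH : continuous H.
  have [cg _ _] := tg; have [c1 c2 c3 c4] := tube_frame_continuous fr.
  have [_ [_ cl ck _ _]] := fr.
  move=> p; apply: cvgM.
    apply: (@continuous_comp _ _ _ (fun p : R * R => tube_map f1 f2 n1 n2 p.1 p.2) g); last exact: cg.
    apply: continuous_pair; apply: cvgD.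
    - exact: (continuous_comp_fst c1).
    - by apply: cvgM; [exact: continuous_snd|exact: (continuous_comp_fst c3)].
    - exact: (continuous_comp_fst c2).
    - by apply: cvgM; [exact: continuous_snd|exact: (continuous_comp_fst c4)].
  apply: cvgM; first by apply: cvg_norm; exact: (continuous_comp_fst cl).
  apply: cvgB; first exact: cvg_cst.
  by apply: cvgM; [exact: continuous_snd|exact: (continuous_comp_fst ck)].
pose H' (p : R * R) : \bar R := (H p * \1_(`[- eps, eps]%classic : set R) p.2)%:E.
have mH' : measurable_fun setT H'.
  apply/measurable_EFinP; apply: measurable_funM; first exact: continuous_measurable_plane.
  by apply: measurableT_comp; [exact: measurable_indic|exact: measurable_snd].
have H'0 p : (0 <= H' p)%E.
  rewrite /H' lee_fin indicE; have [pe|_] := boolP (_ \in _); last by rewrite mulr0.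
  by rewrite mulr1 integrand_ge0 //; move: pe; rewrite inE /= in_itv /= -ler_norml.
have := measurable_fun_fubini_tonelli_F (m2 := mu) _ mH' H'0.
rewrite (_ : fubini_F _ _ = J) //.
apply/funext => y; rewrite /J [RHS]integral_mkcond /fubini_F.
apply: eq_integral => z _; rewrite patchE /H' /= indicE.
by case: ifP; rewrite ?mulr1 ?mulr0.
Qed.

Let tube_image_split a b c : 0 <= a -> a <= b -> b <= c -> c <= L ->
  forall x, \1_(tube_image f1 f2 n1 n2 eps a c) x =
    \1_(tube_image f1 f2 n1 n2 eps a b) x + \1_(tube_image f1 f2 n1 n2 eps b c) x :> R.
Proof.
move=> a0 ab bc cL x; rewrite !indicE.
have [xab|nab] := boolP (x \in tube_image f1 f2 n1 n2 eps a b).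
  have [y [z [yab ze xE]]] : tube_image f1 f2 n1 n2 eps a b x by rewrite inE in xab.
  rewrite (@memNset _ (tube_image f1 f2 n1 n2 eps b c)); last first.
    move=> [y' [z' [ybc ze' xE']]].
    have : y = y' by apply: (inj _ _ ze ze'); rewrite -?xE //; lra.
    by lra.
  by rewrite addr0 mem_set //; exists y, z; split => //; lra.
rewrite notin_setE in nab; rewrite add0r; congr (nat_of_bool _)%:R; apply/idP/idP; rewrite !inE => -[y [z [yac ze xE]]].
  exists y, z; split => //; have [yb|by_] := ltP y b; last lra.
  by case: nab; exists y, z; split => //; lra.
by exists y, z; split => //; lra.
Qed.

(** Injectivity of the normal coordinates makes the two images disjoint, so that the indicator of
    their union is a sum. *)
Lemma tube_formula_add a b c : 0 <= a -> a <= b -> b <= c -> c <= L ->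
  tube_formula f1 f2 n1 n2 lam kap eps g a b ->
  tube_formula f1 f2 n1 n2 lam kap eps g b c ->
  tube_formula f1 f2 n1 n2 lam kap eps g a c.
Proof.
move=> a0 ab bc cL [mab eab] [mbc ebc]; have [_ g0 _] := tg.
have E : (fun x => (g x * \1_(tube_image f1 f2 n1 n2 eps a c) x)%:E) =
  (fun x => (g x * \1_(tube_image f1 f2 n1 n2 eps a b) x)%:E +
            (g x * \1_(tube_image f1 f2 n1 n2 eps b c) x)%:E)%E.
  by apply/funext => x; rewrite (tube_image_split a0 ab bc cL) mulrDr EFinD.
rewrite /tube_formula E; split; first exact: emeasurable_funD.
rewrite ge0_integralD //; try by move=> x _; rewrite lee_fin mulr_ge0.
rewrite eab ebc -/J.
rewrite -(integral_itv_bndo_bndc (measurable_funS _ _ measurable_tube_fiber)) //.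
rewrite -ge0_integral_setU //=.
- by rewrite -(@itv_bndbnd_setU _ _ (BLeft a) (BLeft b) (BRight c)) // bnd_simp.
- by apply: measurable_funS measurable_tube_fiber.
- apply/disj_set2P; rewrite -subset0 => y [] /=; rewrite !in_itv /=; lra.
Qed.

(** The radius of validity of the local formula is uniform over [[0, L]] by compactness. The formula
    is then added over N steps of length L / N, below this radius. *)
Lemma tube_integral : 0 < L ->
  (forall x, g x != 0 -> tube_image f1 f2 n1 n2 eps 0 L x) ->
  (\int[@plane_measure R]_x (g x)%:E = \int[mu]_(y in `[0%R, L]) J y)%E.
Proof.
move=> L0 supp.
suff [_ ] : tube_formula f1 f2 n1 n2 lam kap eps g 0 L.
  move=> <-; apply: eq_integral => x _; rewrite indicE.
  have [->|gx] := eqVneq (g x) 0; first by rewrite mul0r.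
  by rewrite mem_set ?mulr1 //; exact: supp.
pose P (e : R) (y : R) := forall a b, a < b -> y - e < a -> b < y + e ->
  tube_formula f1 f2 n1 n2 lam kap eps g a b.
have /compact_near_coveringP cI := @segment_compact R 0 L.
have nP : \forall e \near (0 : R)^'+, `[0, L]%classic `<=` P e.
  apply: cI => y _; have [d d0 dP] := tube_formula_near y fr tg.
  near=> y' e => a b ab /= ya yb.
  have ed : e < d / 2 by near: e; apply: nbhs_right_lt; lra.
  have : `|y' - y| < d / 2.
    by near: y'; apply: (@continuous_near_dist id); [exact: cvg_id|lra].
  by rewrite ltr_distl => yy; apply: dP => //; lra.
have [e [e0 eP]] : exists e : R, 0 < e /\ `[0, L]%classic `<=` P e.
  have : \forall e \near (0 : R)^'+, 0 < e /\ `[0, L]%classic `<=` P e.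
    by apply: filterI => //; exact: nbhs_right_gt.
  by move/filter_ex.
pose N := (Num.trunc (L / e)).+1.
have N0 : 0 < N%:R :> R by rewrite ltr0n.
have Ne : L / N%:R < e.
  rewrite ltr_pdivrMr // mulrC -ltr_pdivrMr //; exact: truncnS_gt.
have LN0 : 0 < L / N%:R by rewrite divr_gt0.
have step (k : nat) : (k < N)%N -> tube_formula f1 f2 n1 n2 lam kap eps g (k%:R * (L / N%:R)) (k.+1%:R * (L / N%:R)).
  move=> kN; apply: (eP (k%:R * (L / N%:R))).
  - rewrite /= in_itv /=; apply/andP; split; first by rewrite mulr_ge0 // ltW.
    by rewrite mulrA ler_pdivrMr // mulrC ler_pM2l // ler_nat ltnW.
  - by rewrite ltr_pM2r // ltr_nat.
  - lra.
  - by rewrite -natr1; lra.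
have H (k : nat) : (0 < k <= N)%N -> tube_formula f1 f2 n1 n2 lam kap eps g 0 (k%:R * (L / N%:R)).
  elim: k => // -[_ _|k IH /andP[_ kN]]; first by have := step 0%N isT; rewrite mul0r.
  apply: (@tube_formula_add 0 (k.+1%:R * (L / N%:R))) => //.
  - by rewrite mulr_ge0 // ltW.
  - by rewrite ler_pM2r // ler_nat.
  - by rewrite mulrA ler_pdivrMr // mulrC ler_pM2l // ler_nat.
  - by apply: IH; rewrite ltn0Sn ltnW.
  - exact: step.
have := H N; rewrite leqnn /N /= => /(_ isT); rewrite -/N.
by rewrite mulrC mulfVK // gt_eqF.
Unshelve. all: by end_near. Qed.

End TubeAdd.
End TubePiece.

(** * Laplace expansion on a normal line *)

Section ExpCoef.
Context {R : realType}.

Section Generic.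
Variables (A : comNzRingType) (c : R -> A).

(* [exp_coef p n] is the coefficient of t^n in exp (p 1 t + p 2 t^2 + ...),
   computed from (exp P)' = P' exp P; [p 0] is ignored. The ring is arbitrary
   so that the same formula yields numbers and universal polynomials. *)
Fixpoint exp_coefs (p : nat -> A) (n : nat) : seq A :=
  if n is m.+1 then
    rcons (exp_coefs p m)
      (c m.+1%:R^-1 * \sum_(i < m.+1) i.+1%:R * p i.+1 * (exp_coefs p m)`_(m - i))
  else [:: 1].

Definition exp_coef (p : nat -> A) (n : nat) : A := (exp_coefs p n)`_n.

(* Coefficient of t^n in (1 - k t) exp (p 1 t + p 2 t^2 + ...). *)
Definition laplace_coef (p : nat -> A) (k : A) (n : nat) : A :=
  exp_coef p n - (if n is m.+1 then k * exp_coef p m else 0).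

Lemma size_exp_coefs p n : size (exp_coefs p n) = n.+1.
Proof. by elim: n => //= n IH; rewrite size_rcons IH. Qed.

Lemma nth_exp_coefs p n j : (j <= n)%N -> (exp_coefs p n)`_j = exp_coef p j.
Proof.
elim: n => [|n IH]; first by rewrite leqn0 => /eqP ->.
rewrite leq_eqVlt => /predU1P[-> //|jn] /=.
by rewrite nth_rcons size_exp_coefs jn IH.
Qed.

Lemma exp_coef0 p : exp_coef p 0 = 1. Proof. by []. Qed.

Lemma exp_coefS p n : exp_coef p n.+1 =
  c n.+1%:R^-1 * \sum_(i < n.+1) i.+1%:R * p i.+1 * exp_coef p (n - i).
Proof.
rewrite {1}/exp_coef /= nth_rcons size_exp_coefs ltnn eqxx; congr (_ * _).
by apply: eq_bigr => i _; rewrite nth_exp_coefs // leq_subr.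
Qed.

Lemma eq_exp_coef p q n : (forall i, (0 < i <= n)%N -> p i = q i) -> exp_coef p n = exp_coef q n.
Proof.
elim/ltn_ind: n => -[//|n] IH pq; rewrite !exp_coefS; congr (_ * _).
apply: eq_bigr => i _; rewrite pq //=; congr (_ * _); apply: IH.
  by rewrite ltnS leq_subr.
by move=> j /andP[j0 jn]; rewrite pq // j0 (leq_trans jn) // (leq_trans (leq_subr _ _)).
Qed.

(** This is the change of t into - t in the generating series, the source of the parity in w. *)
Lemma exp_coef_sign p n : exp_coef (fun i => (-1) ^+ i * p i) n = (-1) ^+ n * exp_coef p n.
Proof.
elim/ltn_ind: n => -[_|n IH]; first by rewrite !exp_coef0 mul1r.
rewrite !exp_coefS mulrCA; congr (_ * _); rewrite mulr_sumr; apply: eq_bigr => i _.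
rewrite IH ?ltnS ?leq_subr //.
have -> : (-1 : A) ^+ n.+1 = (-1) ^+ i.+1 * (-1) ^+ (n - i).
  by rewrite -exprD addSn subnKC // -ltnS.
by move: ((-1) ^+ i.+1) ((-1) ^+ (n - i)) => u v; ring.
Qed.

End Generic.

Lemma rmorph_exp_coef (A B : comNzRingType) (c : R -> A) (c' : R -> B) (f : {rmorphism A -> B}) p n :
  (forall r, f (c r) = c' r) -> f (exp_coef c p n) = exp_coef c' (fun i => f (p i)) n.
Proof.
move=> fc; elim/ltn_ind: n => -[_|n IH]; first by rewrite !exp_coef0 rmorph1.
rewrite !exp_coefS rmorphM fc rmorph_sum; congr (_ * _); apply: eq_bigr => i _.
by rewrite !rmorphM rmorph_nat IH // ltnS leq_subr.
Qed.

Lemma rmorph_laplace_coef (A B : comNzRingType) (c : R -> A) (c' : R -> B) (f : {rmorphism A -> B}) p k n :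
  (forall r, f (c r) = c' r) ->
  f (laplace_coef c p k n) = laplace_coef c' (fun i => f (p i)) (f k) n.
Proof.
move=> fc; rewrite /laplace_coef rmorphB (rmorph_exp_coef _ _ fc).
by case: n => [|n]; rewrite ?rmorph0 // rmorphM (rmorph_exp_coef _ _ fc).
Qed.

Section Remainder.
Variables (p : nat -> R) (N : nat).

Definition exponent_poly : {poly R} := \poly_(i < N.+1) (if i == 0%N then 0 else p i).
Definition exp_poly : {poly R} := \poly_(j < N.+1) exp_coef id p j.
(* [defect_poly * exp (- exponent_poly)] is the derivative of
   [exp_poly * exp (- exponent_poly)]. *)
Definition defect_poly : {poly R} := exp_poly^`() - exponent_poly^`() * exp_poly.

(** Below degree N, the equation E' = P' E between coefficients is the recursion that defines
    [exp_coef]. *)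
Lemma defect_poly_coef j : (j < N)%N -> defect_poly`_j = 0.
Proof.
move=> jN; rewrite /defect_poly coefB coef_deriv coefM /exp_poly coef_poly ltnS jN.
apply/eqP; rewrite subr_eq0; apply/eqP.
rewrite -[LHS]mulr_natl exp_coefS mulrA mulfV ?pnatr_eq0 // mul1r.
apply: eq_bigr => i _; rewrite coef_deriv !coef_poly /= ltnS.
have iN : (i < N)%N by apply: leq_ltn_trans jN; rewrite -ltnS.
rewrite iN ltnS (leq_trans (leq_subr _ _)) 1?ltnW // mulr_natl.
by congr (_ * exp_coef _ _ _).
Qed.

Lemma defect_poly_bound x : 0 <= x <= 1 ->
  `|defect_poly.[x]| <= x ^+ N * \sum_(j < size defect_poly) `|defect_poly`_j|.
Proof.
move=> /andP[x0 x1]; rewrite horner_coef mulr_sumr.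
apply: le_trans (ler_norm_sum _ _ _) _; apply: ler_sum => j _.
rewrite normrM normrX (ger0_norm x0).
have [jN|Nj] := ltnP j N; first by rewrite defect_poly_coef // normr0 mul0r mulr0.
by rewrite mulrC ler_wpM2r // ler_wiXn2l.
Qed.

(** The product D of [exp_poly] and exp (- [exponent_poly]) is 1 at 0 and has a derivative of order
    x^N, so the mean value theorem bounds D - 1. Each of the two exponentials that occur is at most
    [expR m]. *)
Lemma exp_poly_remainder t m : 0 <= t <= 1 ->
  (forall x, 0 <= x <= t -> `|exponent_poly.[x]| <= m) ->
  `|expR exponent_poly.[t] - exp_poly.[t]| <=
  t ^+ N.+1 * (\sum_(j < size defect_poly) `|defect_poly`_j|) * expR (2 * m).
Proof.
move=> /andP[t0 t1] Pm; set S := \sum_(j < _) _.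
have S0 : 0 <= S by apply: sumr_ge0.
pose D x := exp_poly.[x] * expR (- exponent_poly.[x]).
have dD (x : R) : is_derive x 1 D (defect_poly.[x] * expR (- exponent_poly.[x])).
  have d1 := is_derive_poly exp_poly x; have d2 := is_derive_poly exponent_poly x.
  apply: is_derive_eq; rewrite /defect_poly !hornerE /GRing.scale /=; ring.
have D0 : D 0 = 1.
  rewrite /D !horner_coef0 /exp_poly /exponent_poly !coef_poly /= exp_coef0.
  by rewrite oppr0 expR0 mulr1.
have [->|tn0] := eqVneq t 0.
  have -> : expR exponent_poly.[0] - exp_poly.[0] = 0.
    rewrite !horner_coef0 /exp_poly /exponent_poly !coef_poly /= exp_coef0.
    by rewrite expR0 subrr.
  by rewrite normr0 expr0n /= !mul0r.
have tp : 0 < t by rewrite lt_neqAle eq_sym tn0.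
have cD : {within `[0, t], continuous D}.
  apply: continuous_subspaceT => x; apply: differentiable_continuous.
  by have d := dD x; apply/derivable1_diffP; exact: ex_derive.
have [x xt e] := MVT tp (fun x _ => dD x) cD.
move: xt; rewrite in_itv /= => /andP[x0 xt].
have Dt : D t - 1 = defect_poly.[x] * expR (- exponent_poly.[x]) * t by rewrite -{1}D0 e subr0.
have -> : expR exponent_poly.[t] - exp_poly.[t] = expR exponent_poly.[t] * (1 - D t).
  by rewrite mulrBr mulr1 /D mulrCA -expRD subrr expR0 mulr1.
rewrite normrM (ger0_norm (expR_ge0 _)) distrC Dt !normrM (ger0_norm (expR_ge0 _)) (gtr0_norm tp).
have b1 : expR exponent_poly.[t] <= expR m.
  by rewrite ler_expR; apply: le_trans (ler_norm _) _; apply: Pm; rewrite lexx t0.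
have b2 : expR (- exponent_poly.[x]) <= expR m.
  rewrite ler_expR; apply: le_trans (ler_norm _) _; rewrite normrN; apply: Pm; lra.
have b3 : `|defect_poly.[x]| <= t ^+ N * S.
  apply: le_trans (@defect_poly_bound x _) _; first lra.
  by rewrite ler_wpM2r // lerXn2r ?nnegrE // ltW.
have -> : t ^+ N.+1 * S * expR (2 * m) = expR m * (t ^+ N * S * expR m * t).
  by rewrite (_ : 2 * m = m + m) ?expRD; [rewrite exprS; ring|ring].
apply: ler_pM; [exact: expR_ge0| |exact: b1|].
  by rewrite !mulr_ge0 ?expR_ge0 // ltW.
apply: ler_wpM2r; first exact: ltW.
apply: ler_pM => //; exact: expR_ge0.
Qed.

End Remainder.
End ExpCoef.

(** * Polynomial growth, uniform in the parameters *)

Section PolyGrowth.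
Context {R : realType}.
Variables (T : Type) (S : T -> Prop).

(* Polynomial growth in the real variable, uniform in the parameter. *)
Definition poly_growth (F : T -> R -> R) :=
  exists C (M : nat), 0 <= C /\ forall x w, S x -> `|F x w| <= C * (1 + `|w|) ^+ M.

Let one_le (w : R) : 1 <= 1 + `|w|. Proof. by rewrite lerDl. Qed.

Lemma poly_growth_bounded (F : T -> R -> R) C : (forall x w, S x -> `|F x w| <= C) -> poly_growth F.
Proof.
move=> FC; exists (Num.max 0 C), 0%N; split; first by rewrite le_max lexx.
by move=> x w Sx; rewrite expr0 mulr1 le_max FC ?orbT.
Qed.

Lemma poly_growth_id : poly_growth (fun _ w => w).
Proof. by exists 1, 1%N; split => // x w _; rewrite expr1 mul1r lerDr. Qed.

Lemma poly_growth_add F G : poly_growth F -> poly_growth G ->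
  poly_growth (fun x w => F x w + G x w).
Proof.
move=> [C [M [C0 FC]]] [C' [M' [C'0 GC]]]; exists (C + C'), (M + M')%N.
split; first exact: addr_ge0.
move=> x w Sx; apply: le_trans (ler_normD _ _) _; rewrite mulrDl; apply: lerD.
  apply: le_trans (FC x w Sx) _; rewrite ler_wpM2l //.
  by rewrite ler_weXn2l // leq_addr.
apply: le_trans (GC x w Sx) _; rewrite ler_wpM2l //.
by rewrite ler_weXn2l // leq_addl.
Qed.

Lemma poly_growth_mul F G : poly_growth F -> poly_growth G ->
  poly_growth (fun x w => F x w * G x w).
Proof.
move=> [C [M [C0 FC]]] [C' [M' [C'0 GC]]]; exists (C * C'), (M + M')%N.
split; first exact: mulr_ge0.
move=> x w Sx; rewrite normrM exprD mulrACA; apply: ler_pM => //; [exact: FC|exact: GC].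
Qed.

Lemma eq_poly_growth F G : (forall x w, S x -> F x w = G x w) -> poly_growth F -> poly_growth G.
Proof.
by move=> FG [C [M [C0 FC]]]; exists C, M; split => // x w Sx; rewrite -FG // FC.
Qed.

Lemma poly_growth_sum n F : (forall i, (i < n)%N -> poly_growth (F i)) ->
  poly_growth (fun x w => \sum_(i < n) F i x w).
Proof.
elim: n F => [|n IH] F FP.
  by apply: (@poly_growth_bounded _ 0) => x w _; rewrite big_ord0 normr0.
apply: (@eq_poly_growth (fun x w => \sum_(i < n) F i x w + F n x w)).
  by move=> x w _; rewrite big_ord_recr.
by apply: poly_growth_add; [apply: IH => i ni; apply: FP; exact: ltnW|exact: FP].
Qed.

Lemma poly_growth_pow F n : poly_growth F -> poly_growth (fun x w => F x w ^+ n).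
Proof.
move=> FP; elim: n => [|n IH].
  by apply: (@poly_growth_bounded _ 1) => x w _; rewrite expr0 normr1.
apply: (@eq_poly_growth (fun x w => F x w * F x w ^+ n)); last exact: poly_growth_mul.
by move=> x w _; rewrite exprS.
Qed.

Lemma poly_growth_norm F : poly_growth F -> poly_growth (fun x w => `|F x w|).
Proof. by move=> [C [M [C0 FC]]]; exists C, M; split => // x w Sx; rewrite normr_id FC. Qed.

Lemma poly_growth_exp_coef (p : T -> R -> nat -> R) n :
  (forall i, (0 < i <= n)%N -> poly_growth (fun x w => p x w i)) ->
  poly_growth (fun x w => exp_coef id (p x w) n).
Proof.
elim/ltn_ind: n => -[_ _|n IH pP].
  by apply: (@poly_growth_bounded _ 1) => x w _; rewrite exp_coef0 normr1.
apply: (@eq_poly_growth (fun x w => n.+1%:R^-1 * \sum_(i < n.+1) i.+1%:R * p x w i.+1 * exp_coef id (p x w) (n - i))).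
  by move=> x w _; rewrite exp_coefS.
apply: poly_growth_mul; first exact: (@poly_growth_bounded _ `|n.+1%:R^-1|).
apply: (@poly_growth_sum n.+1 (fun i x w => i.+1%:R * p x w i.+1 * exp_coef id (p x w) (n - i))) => i ni.
apply: poly_growth_mul.
  apply: poly_growth_mul; first exact: (@poly_growth_bounded _ `|i.+1%:R|).
  exact: pP.
apply: IH; first by rewrite ltnS leq_subr.
by move=> j /andP[j0 jn]; apply: pP; rewrite j0 (leq_trans jn) // (leq_trans (leq_subr _ _)).
Qed.

Lemma size_deriv_poly n (E : nat -> R) : (size (\poly_(i < n) E i)^`() <= n)%N.
Proof. by apply/leq_sizeP => j nj; rewrite coef_deriv coef_poly ltnNge leqW // mul0rn. Qed.

Lemma poly_growth_defect (p : T -> R -> nat -> R) N :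
  (forall i, (0 < i <= N)%N -> poly_growth (fun x w => p x w i)) ->
  poly_growth (fun x w => \sum_(j < size (defect_poly (p x w) N)) `|(defect_poly (p x w) N)`_j|).
Proof.
move=> pP.
(* The size of the defect polynomial varies with the parameters; padding with zero coefficients up
   to the fixed bound [K] gives a sum of fixed length. *)
pose K := (N.+1 + N.+1)%N.
apply: (@eq_poly_growth (fun x w => \sum_(j < K) `|(defect_poly (p x w) N)`_j|)).
  move=> x w _.
  have sK : (size (defect_poly (p x w) N) <= K)%N.
    rewrite /defect_poly; apply: leq_trans (size_polyD _ _) _.
    rewrite size_polyN geq_max; apply/andP; split.
      apply: leq_trans (size_deriv_poly _ _) _.
      by rewrite /K -{1}(addn0 N.+1) leq_add2l.
    apply: leq_trans (size_polyMleq _ _) _; apply: leq_trans (leq_pred _) _.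
    apply: leq_add; last exact: size_poly.
    exact: size_deriv_poly.
  rewrite (big_ord_widen K (fun j => `|(defect_poly (p x w) N)`_j|) sK) [RHS]big_mkcond /=.
  apply: eq_bigr => j _; case: ifPn => //; rewrite -leqNgt => sj.
  by rewrite nth_default // normr0.
apply: (@poly_growth_sum K (fun j x w => `|(defect_poly (p x w) N)`_j|)) => j _.
apply: poly_growth_norm.
have gP i : poly_growth (fun x w => (exponent_poly (p x w) N)^`()`_i).
  have [iN|Ni] := ltnP i N; last first.
    apply: (@poly_growth_bounded _ 0) => x w _.
    by rewrite coef_deriv coef_poly ltnS ltnNge Ni /= mul0rn normr0.
  apply: (@eq_poly_growth (fun x w => i.+1%:R * p x w i.+1)).
    by move=> x w _; rewrite coef_deriv coef_poly ltnS iN /= mulr_natl.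
  by apply: poly_growth_mul; [exact: (@poly_growth_bounded _ `|i.+1%:R|)|exact: pP].
have gE i : poly_growth (fun x w => (exp_poly (p x w) N)`_i).
  have [iN|Ni] := ltnP i N.+1; last first.
    apply: (@poly_growth_bounded _ 0) => x w _.
    by rewrite coef_poly ltnNge Ni /= normr0.
  apply: (@eq_poly_growth (fun x w => exp_coef id (p x w) i)).
    by move=> x w _; rewrite coef_poly iN.
  apply: poly_growth_exp_coef => k /andP[k0 ki]; apply: pP.
  by rewrite k0 (leq_trans ki).
apply: (@eq_poly_growth (fun x w => j.+1%:R * (exp_poly (p x w) N)`_j.+1 +
   (-1) * \sum_(i < j.+1) (exponent_poly (p x w) N)^`()`_i * (exp_poly (p x w) N)`_(j - i))).
  by move=> x w _; rewrite /defect_poly coefB coefM [in RHS]coef_deriv mulr_natl mulN1r.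
apply: poly_growth_add.
  by apply: poly_growth_mul; [exact: (@poly_growth_bounded _ `|j.+1%:R|)|exact: gE].
apply: poly_growth_mul; first exact: (@poly_growth_bounded _ `|-1|).
apply: (@poly_growth_sum j.+1 (fun i x w => (exponent_poly (p x w) N)^`()`_i * (exp_poly (p x w) N)`_(j - i))) => i _.
by apply: poly_growth_mul; [exact: gP|exact: gE].
Qed.

End PolyGrowth.

(** * Pointwise comparison on the rescaled normal line *)

Section LaplacePointwise.
Context {R : realType}.
Implicit Types (s : nat -> R) (w tau : R).

(* Coefficient of tau^i in - S (f y + tau w n) / (2 tau^2); the coefficient for
   i = 0 is kept apart, as a Gaussian weight. *)
Definition taylor_exponent s w (i : nat) : R :=
  - ((2 * (i.+2)`!%:R)^-1 * s i.+2 * w ^+ i.+2).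

Definition laplace_term s (kap : R) w (j : nat) : R :=
  laplace_coef id (taylor_exponent s w) (kap * w) j.

(** The index 2 is left out: s_2 enters through the Gaussian weight alone, where a lower bound is
    what matters. *)
Definition jet_bound (N : nat) (B : R) (x : (nat -> R) * R) : Prop :=
  `|x.2| <= B /\ forall k, (3 <= k <= N.+2)%N -> `|x.1 k| <= B.

(** Degrees 2 to N + 2 only, because S and its first derivative vanish on the curve. *)
Definition taylor_poly s (N : nat) (z : R) : R :=
  \sum_(i < N.+1) s i.+2 / (i.+2)`!%:R * z ^+ i.+2.

Lemma expR_lipschitz (a b m : R) : `|a| <= m -> `|b| <= m ->
  `|expR a - expR b| <= `|a - b| * expR m.
Proof.
wlog ab : a b / a <= b => [H am bm|am bm].
  have [ab|/ltW ba] := leP a b; first exact: H.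
  by rewrite distrC [X in _ <= X * _]distrC; exact: H.
have [->|nab] := eqVneq a b; first by rewrite !subrr normr0 mul0r.
have lab : a < b by rewrite lt_neqAle nab.
have cE : {within `[a, b], continuous expR}.
  by apply: continuous_subspaceT; exact: continuous_expR.
have [x xab e] := MVT lab (fun x _ => is_derive_expR x) cE.
rewrite distrC e normrM (ger0_norm (expR_ge0 _)) mulrC distrC ler_wpM2l // ler_expR.
by move: xab bm; rewrite in_itv /= ler_norml; lra.
Qed.

(** Truncating the product (1 - kap w t) E at degree N drops a single term, the linear factor times
    the top coefficient of E; it is put back as the last summand. *)
Lemma laplace_term_sum s kap w (N : nat) t :
  \sum_(j < N.+1) t ^+ j * laplace_term s kap w j =
  (1 - t * w * kap) * (exp_poly (taylor_exponent s w) N).[t] +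
  t ^+ N.+1 * (kap * w * exp_coef id (taylor_exponent s w) N).
Proof.
have hE n : (exp_poly (taylor_exponent s w) n).[t] =
    \sum_(j < n.+1) exp_coef id (taylor_exponent s w) j * t ^+ j.
  by rewrite horner_poly.
elim: N => [|N IH].
  by rewrite big_ord1 hE big_ord1 /laplace_term /laplace_coef exp_coef0 subr0; ring.
rewrite big_ord_recr /= IH !hE [in RHS]big_ord_recr /= /laplace_term /laplace_coef.
by rewrite !exprS; ring.
Qed.

Lemma taylor_exponent_growth N B i : (0 < i <= N)%N ->
  poly_growth (jet_bound N B) (fun x w => taylor_exponent x.1 w i).
Proof.
move=> /andP[i0 iN].
apply: (@eq_poly_growth _ _ _ (fun x w => (- (2 * (i.+2)`!%:R)^-1) * (x.1 i.+2 * w ^+ i.+2))).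
  by move=> x w _; rewrite /taylor_exponent; ring.
apply: poly_growth_mul; first exact: (@poly_growth_bounded _ _ _ _ `|- (2 * (i.+2)`!%:R)^-1|).
apply: poly_growth_mul; last by apply: poly_growth_pow; exact: poly_growth_id.
by apply: (@poly_growth_bounded _ _ _ _ B) => x w [_]; apply; rewrite !ltnS i0.
Qed.

Lemma laplace_term_growth N B j : (j <= N)%N ->
  poly_growth (jet_bound N B) (fun x w => laplace_term x.1 x.2 w j).
Proof.
move=> jN.
have gE k : (k <= N)%N -> poly_growth (jet_bound N B) (fun x w => exp_coef id (taylor_exponent x.1 w) k).
  move=> kN; apply: (@poly_growth_exp_coef _ _ _ (fun x w => taylor_exponent x.1 w)) => i /andP[i0 ik].
  by apply: taylor_exponent_growth; rewrite i0 (leq_trans ik).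
rewrite /laplace_term /laplace_coef; case: j jN => [|j] jN.
  by apply: (@eq_poly_growth _ _ _ (fun x w => exp_coef id (taylor_exponent x.1 w) 0)); [move=> x w _; rewrite subr0|exact: gE].
apply: (@eq_poly_growth _ _ _ (fun x w => exp_coef id (taylor_exponent x.1 w) j.+1 +
   (-1) * (x.2 * w * exp_coef id (taylor_exponent x.1 w) j))).
  by move=> x w _; ring.
apply: poly_growth_add; first exact: gE.
apply: poly_growth_mul; first exact: (@poly_growth_bounded _ _ _ _ `|-1|).
apply: poly_growth_mul; last by apply: gE; exact: ltnW.
apply: poly_growth_mul; last exact: poly_growth_id.
by apply: (@poly_growth_bounded _ _ _ _ B) => x w [].
Qed.

Section Bound.
Variables (N : nat) (B eps c0 : R).
Hypotheses (B0 : 0 <= B) (eps0 : 0 < eps) (eps1 : eps <= 1).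
Hypotheses (c00 : 0 < c0) (small : 16 * N.+1%:R * B * eps <= c0).

Let inv_fact i : 0 < (2 * (i.+2)`!%:R : R)^-1 <= 1 / 2.
Proof.
have f1 : 1 <= (i.+2)`!%:R :> R by rewrite ler1n fact_gt0.
apply/andP; split; first by rewrite invr_gt0; lra.
by rewrite mul1r lef_pV2 ?posrE; lra.
Qed.

(** In each monomial two factors |w| are set aside; the remaining power of x |w| is at most eps,
    since eps <= 1. Thus every term is a small multiple of w^2, comparable with the Gaussian
    exponent. *)
Lemma taylor_exponent_small s kap w x : jet_bound N B (s, kap) -> 0 <= x -> x * `|w| <= eps ->
  `|(exponent_poly (taylor_exponent s w) N).[x]| <= N%:R * (B * eps / 2 * w ^+ 2).
Proof.
move=> [_ sB] x0 xw.
rewrite horner_poly big_ord_recl eqxx mul0r add0r.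
apply: le_trans (ler_norm_sum _ _ _) _.
have -> : N%:R * (B * eps / 2 * w ^+ 2) = \sum_(i < N) B * eps / 2 * w ^+ 2.
  by rewrite sumr_const card_ord mulr_natl.
apply: ler_sum => i _; rewrite lift0 (_ : (i.+1 == 0)%N = false) // /taylor_exponent.
have iN : (3 <= i.+3 <= N.+2)%N by rewrite !ltnS ltn_ord.
rewrite mulNr normrN normrM normrX [X in X * _]normrM normrX [X in X * _ * _]normrM (ger0_norm x0).
have /andP[f0 f1] := inv_fact i.+1; rewrite (gtr0_norm f0).
have xw1 : (x * `|w|) ^+ i.+1 <= eps.
  apply: le_trans (_ : (x * `|w|) ^+ 1 <= _); last by rewrite expr1.
  apply: ler_wiXn2l => //; first by rewrite mulr_ge0.
  exact: le_trans xw eps1.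
have -> : (2 * (i.+3)`!%:R)^-1 * `|s i.+3| * `|w| ^+ i.+3 * x ^+ i.+1 =
    (2 * (i.+3)`!%:R)^-1 * `|s i.+3| * (x * `|w|) ^+ i.+1 * `|w| ^+ 2.
  have -> : `|w| ^+ i.+3 = `|w| ^+ i.+1 * `|w| ^+ 2 by rewrite -exprD addn2.
  by rewrite exprMn; ring.
rewrite -normrX (ger0_norm (sqr_ge0 _)); apply: ler_wpM2r; first exact: sqr_ge0.
have := sB _ iN => /= sBi.
have h1 : (2 * (i.+3)`!%:R)^-1 * `|s i.+3| <= 1 / 2 * B.
  by apply: ler_pM => //; exact: ltW.
have -> : B * eps / 2 = 1 / 2 * B * eps by field.
have f2 := mulr_ge0 (ltW f0) (normr_ge0 (s i.+3)).
by apply: ler_pM f2 _ h1 xw1; rewrite exprn_ge0 // mulr_ge0.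
Qed.

(** Collects three errors: the Taylor remainder of S, the truncation of the exponential series, and
    the top-degree term dropped from the product with the Jacobian factor. *)
Definition pointwise_majorant (x : (nat -> R) * R) w : R :=
  let p := taylor_exponent x.1 w in
  (1 + B * `|w|) * (B * `|w| ^+ N.+3 +
    \sum_(j < size (defect_poly p N)) `|(defect_poly p N)`_j|) +
  B * `|w| * `|exp_coef id p N|.

Lemma pointwise_majorant_growth : poly_growth (jet_bound N B) pointwise_majorant.
Proof.
have gB a : poly_growth (jet_bound N B) (fun _ _ => a).
  exact: (@poly_growth_bounded _ _ _ _ `|a|).
have gw : poly_growth (jet_bound N B) (fun _ w => `|w|).
  by apply: poly_growth_norm; exact: poly_growth_id.
apply: poly_growth_add.
  apply: poly_growth_mul; first by apply: poly_growth_add => //; exact: poly_growth_mul.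
  apply: poly_growth_add; first by apply: poly_growth_mul => //; exact: poly_growth_pow.
  apply: (@poly_growth_defect _ _ _ (fun x w => taylor_exponent x.1 w)) => i iN.
  exact: taylor_exponent_growth.
apply: poly_growth_mul; first exact: poly_growth_mul.
apply: poly_growth_norm.
apply: (@poly_growth_exp_coef _ _ _ (fun x w => taylor_exponent x.1 w)) => i iN.
exact: taylor_exponent_growth.
Qed.

Lemma laplace_pointwise s kap (phi : R -> R) tau w : jet_bound N B (s, kap) -> c0 <= s 2 ->
  (forall z, `|z| <= eps -> `|phi z - taylor_poly s N z| <= B * `|z| ^+ N.+3) ->
  0 < tau <= 1 -> `|tau * w| <= eps ->
  `|expR (- (phi (tau * w) / (2 * tau ^+ 2))) * (1 - tau * w * kap) -
    expR (- (s 2 * w ^+ 2 / 4)) * \sum_(j < N.+1) tau ^+ j * laplace_term s kap w j| <=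
  tau ^+ N.+1 * pointwise_majorant (s, kap) w * expR (- (c0 * w ^+ 2 / 8)).
Proof.
move=> jb s2 phiT /andP[tau0 tau1] tw.
have [kB sB] := jb.
pose p := taylor_exponent s w.
pose r := (phi (tau * w) - taylor_poly s N (tau * w)) / (2 * tau ^+ 2).
have tn0 : tau != 0 by rewrite gt_eqF.
have twE : `|tau * w| = tau * `|w| by rewrite normrM gtr0_norm.
(* The quadratic term of S yields the Gaussian exponent, the higher ones a polynomial in tau, and
   [r] is the rescaled Taylor remainder. *)
have PE : - (phi (tau * w) / (2 * tau ^+ 2)) =
    - (s 2 * w ^+ 2 / 4) + ((exponent_poly p N).[tau] - r).
  rewrite /r /taylor_poly horner_poly !big_ord_recl /= mul0r.
  have -> : \sum_(i < N) p (bump 0 i) * tau ^+ bump 0 i =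
     - ((\sum_(i < N) s (bump 0 i).+2 / ((bump 0 i).+2)`!%:R * (tau * w) ^+ (bump 0 i).+2) / (2 * tau ^+ 2)).
    rewrite mulr_suml -sumrN; apply: eq_bigr => i _.
    rewrite /p /taylor_exponent /bump leq0n add1n.
    have f0 : (i.+3)`!%:R != 0 :> R by rewrite pnatr_eq0 -lt0n fact_gt0.
    rewrite (_ : (tau * w) ^+ i.+3 = tau ^+ 2 * tau ^+ i.+1 * w ^+ i.+3); last first.
      by rewrite exprMn -exprD.
    by field; rewrite f0 tn0.
  rewrite (_ : (2`! = 2)%N) //; set Sm := \sum_(i < N) _.
  by field.
set P := (exponent_poly p N).[tau] in PE.
set E := (exp_poly p N).[tau].
(* By [small], the N terms of the polynomial and the remainder, each at most B eps w^2 / 2, add up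
   to at most [m]. The estimates cost a factor exp (2 m), that is c0 w^2 / 16 in the exponent, and
   the Gaussian has c0 w^2 / 4, so at least c0 w^2 / 8 is left. *)
pose m := c0 * w ^+ 2 / 32.
have w20 : 0 <= w ^+ 2 by exact: sqr_ge0.
have NB : N.+1%:R * (B * eps / 2 * w ^+ 2) <= m.
  rewrite /m (_ : _ * _ = (16 * N.+1%:R * B * eps) * w ^+ 2 / 32); last by field.
  by rewrite ler_pM2r ?invr_gt0 // ler_wpM2r.
have Be0 : 0 <= B * eps / 2 * w ^+ 2 by rewrite mulr_ge0 // divr_ge0 // mulr_ge0 // ltW.
have Pm x : 0 <= x <= tau -> `|(exponent_poly p N).[x]| <= N%:R * (B * eps / 2 * w ^+ 2).
  move=> /andP[x0 xt]; apply: (taylor_exponent_small jb x0).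
  by apply: le_trans tw; rewrite twE ler_wpM2r.
have rB : `|r| <= tau ^+ N.+1 * (B * `|w| ^+ N.+3 / 2).
  rewrite /r normrM normfV (gtr0_norm (_ : 0 < 2 * tau ^+ 2)); last by rewrite mulr_gt0 // exprn_gt0.
  rewrite ler_pdivrMr; last by rewrite mulr_gt0 // exprn_gt0.
  apply: le_trans (phiT _ tw) _; rewrite twE exprMn.
  rewrite (_ : tau ^+ N.+3 = tau ^+ N.+1 * tau ^+ 2); last by rewrite -exprD addn2.
  by rewrite le_eqVlt; apply/orP; left; apply/eqP; field.
have tN0 : 0 <= tau ^+ N.+1 by rewrite exprn_ge0 // ltW.
have rS : `|r| <= B * eps / 2 * w ^+ 2.
  apply: le_trans rB _.
  have -> : tau ^+ N.+1 * (B * `|w| ^+ N.+3 / 2) = (tau * `|w|) ^+ N.+1 * (B / 2 * `|w| ^+ 2).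
    have -> : `|w| ^+ N.+3 = `|w| ^+ N.+1 * `|w| ^+ 2 by rewrite -exprD addn2.
    by rewrite exprMn; field.
  rewrite -normrX (ger0_norm w20) (_ : B * eps / 2 * w ^+ 2 = eps * (B / 2 * w ^+ 2)); last by ring.
  apply: ler_wpM2r; first by rewrite mulr_ge0 // divr_ge0.
  rewrite -twE; apply: le_trans (tw); rewrite -[X in _ <= X]expr1.
  by apply: ler_wiXn2l => //; exact: le_trans tw eps1.
have Nm : N%:R * (B * eps / 2 * w ^+ 2) + B * eps / 2 * w ^+ 2 <= m.
  by move: NB; rewrite -natr1 mulrDl mul1r.
have Pt : `|P| <= N%:R * (B * eps / 2 * w ^+ 2) by apply: Pm; rewrite lexx ltW.
have Pmm : `|P| <= m by lra.
have Xm : `|P - r| <= m by apply: le_trans (ler_normB _ _) _; lra.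
(* The remainder [r] is removed first, by the Lipschitz bound for the exponential; then the
   exponential of the polynomial is replaced by its truncated series. *)
have step1 : `|expR (P - r) - expR P| <= tau ^+ N.+1 * (B * `|w| ^+ N.+3) * expR (2 * m).
  apply: le_trans (expR_lipschitz Xm Pmm) _; rewrite addrAC subrr add0r normrN.
  have m0 : 0 <= m by exact: le_trans (normr_ge0 _) Pmm.
  apply: ler_pM => //; last by rewrite ler_expR; lra.
  apply: le_trans rB _; rewrite ler_wpM2l // ler_pdivrMr // ler_peMr ?ler1n //.
  by rewrite mulr_ge0 // exprn_ge0.
have step2 : `|expR P - E| <= tau ^+ N.+1 *
    (\sum_(j < size (defect_poly p N)) `|(defect_poly p N)`_j|) * expR (2 * m).
  apply: exp_poly_remainder; first by rewrite ltW.
  by move=> x xt; apply: le_trans (Pm x xt) _; lra.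
set Q := \sum_(j < _) _ in step2.
have Q0 : 0 <= Q by apply: sumr_ge0.
have step : `|expR (P - r) - E| <= tau ^+ N.+1 * (B * `|w| ^+ N.+3 + Q) * expR (2 * m).
  rewrite -(subrKA (expR P)); apply: le_trans (ler_normD _ _) _.
  apply: le_trans (lerD step1 step2) _; rewrite -mulrDl -mulrDr.
  exact: lexx.
rewrite PE expRD -mulrA -mulrBr normrM (ger0_norm (expR_ge0 _)).
rewrite laplace_term_sum -/p -/E.
set e := exp_coef id p N.
have -> : expR (P - r) * (1 - tau * w * kap) - ((1 - tau * w * kap) * E + tau ^+ N.+1 * (kap * w * e)) =
   (1 - tau * w * kap) * (expR (P - r) - E) - tau ^+ N.+1 * (kap * w * e) by ring.
have k1 : `|1 - tau * w * kap| <= 1 + B * `|w|.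
  apply: le_trans (ler_normB _ _) _; rewrite normr1 lerD2l !normrM (gtr0_norm tau0).
  rewrite -mulrA; apply: le_trans (_ : 1 * (`|w| * `|kap|) <= _).
    by rewrite ler_wpM2r // mulr_ge0.
  by rewrite mul1r mulrC ler_wpM2r.
have em : 1 <= expR (2 * m).
  rewrite -[X in X <= _]expR0 ler_expR; have m0 : 0 <= m by exact: le_trans (normr_ge0 _) Pmm.
  lra.
have pmE : pointwise_majorant (s, kap) w =
    (1 + B * `|w|) * (B * `|w| ^+ N.+3 + Q) + B * `|w| * `|e| by [].
have bound : `|(1 - tau * w * kap) * (expR (P - r) - E) - tau ^+ N.+1 * (kap * w * e)| <=
    tau ^+ N.+1 * pointwise_majorant (s, kap) w * expR (2 * m).
  apply: le_trans (ler_normB _ _) _.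
  rewrite pmE (mulrDr (tau ^+ N.+1)) mulrDl; apply: lerD.
    rewrite normrM; apply: le_trans (ler_pM _ _ k1 step) _ => //.
    rewrite le_eqVlt; apply/orP; left; apply/eqP; ring.
  rewrite normrM (ger0_norm tN0) -[X in X <= _]mulr1; apply: ler_pM => //.
    by rewrite mulr_ge0.
  rewrite ler_wpM2l // !normrM ler_wpM2r // ler_wpM2r //.
apply: le_trans (ler_wpM2l (expR_ge0 _) bound) _.
rewrite mulrCA -expRD; apply: ler_wpM2l.
  have w3 : 0 <= `|w| ^+ N.+3 := exprn_ge0 _ (normr_ge0 w).
  have Bw := mulr_ge0 B0 (normr_ge0 w); have Bw3 := mulr_ge0 B0 w3.
  apply: mulr_ge0 => //; rewrite pmE; apply: addr_ge0; last exact: mulr_ge0.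
  by apply: mulr_ge0; apply: addr_ge0.
rewrite ler_expR /m.
have : c0 * w ^+ 2 <= s 2 * w ^+ 2 by rewrite ler_wpM2r.
have : 0 <= c0 * w ^+ 2 by rewrite mulr_ge0 // ltW.
lra.
Qed.

End Bound.
End LaplacePointwise.

(** * Integrable majorants and rescaling on the line *)

Section GaussDecay.
Context {R : realType}.
Local Notation mu := (@lebesgue_measure R).

(** Apply x^n / n! <= exp x to x = c (1 + w^2) with n = M + 1: one power more than the polynomial
    leaves the factor 1 / (1 + w^2), whose integral is pi. *)
Lemma gauss_poly_decay (c : R) (M : nat) : 0 < c ->
  exists2 C, 0 <= C & forall w : R, (1 + `|w|) ^+ M * expR (- (c * w ^+ 2)) <= C * (oneDsqr w)^-1.
Proof.
move=> c0; pose n := M.+1.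
pose C := 2 ^+ M * (n`!%:R * c^-1 ^+ n * expR c).
have C0 : 0 <= C.
  apply: mulr_ge0; first exact: exprn_ge0.
  apply: mulr_ge0 (expR_ge0 _); apply: mulr_ge0; first exact: ler0n.
  by rewrite exprn_ge0 // invr_ge0 ltW.
exists C => // w; have o1 := oneDsqr_ge1 w; have o0 : 0 < oneDsqr w by lra.
rewrite ler_pdivlMr //.
have w1 : 1 + `|w| <= 2 * oneDsqr w.
  rewrite /oneDsqr -(real_normK (num_real w)).
  by have := sqr_ge0 (`|w| - 1); have := sqr_ge0 `|w|; rewrite !expr2; nra.
have w0 : 0 <= 1 + `|w| by rewrite addr_ge0.
have h1 : (1 + `|w|) ^+ M <= 2 ^+ M * oneDsqr w ^+ M.
  by rewrite -exprMn lerXn2r ?nnegrE // (le_trans w0).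
have h2 : oneDsqr w ^+ n <= n`!%:R * c^-1 ^+ n * (expR c * expR (c * w ^+ 2)).
  rewrite -expRD; have -> : c + c * w ^+ 2 = c * oneDsqr w by rewrite /oneDsqr; ring.
  have x0 : 0 <= c * oneDsqr w by rewrite mulr_ge0 // ltW.
  have /le_trans /(_ (expR_ge1Dxn M x0)) : (c * oneDsqr w) ^+ n / n`!%:R <= 1 + (c * oneDsqr w) ^+ n / n`!%:R.
    by rewrite lerDr.
  rewrite ler_pdivrMr ?ltr0n ?fact_gt0 // exprMn => h.
  rewrite exprVn mulrAC ler_pdivlMr ?exprn_gt0 //.
  by rewrite mulrC [X in _ <= X]mulrC.
rewrite expRN.
have e0 : 0 < expR (c * w ^+ 2) by exact: expR_gt0.
rewrite mulrAC ler_pdivrMr //.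
apply: le_trans (ler_wpM2r (ltW o0) h1) _.
rewrite /C -!mulrA; apply: ler_wpM2l; first exact: exprn_ge0.
by rewrite -exprSr; apply: le_trans h2 _; rewrite !mulrA.
Qed.

Lemma measurable_oneDsqrV : measurable_fun [set: R] (fun w : R => (oneDsqr w)^-1).
Proof. by apply: continuous_measurable_fun; exact: continuous_oneDsqrV. Qed.

Lemma integralT_oneDsqrV : (\int[mu]_w ((oneDsqr w)^-1)%:E = pi%:E)%E.
Proof.
rewrite ge0_symfun_integralT /=.
- rewrite (_ : [set x | _] = `[0, +oo[%classic); last first.
    by apply/seteqP; split => x/=; rewrite in_itv/= andbT.
  by rewrite integral0y_oneDsqr -EFinM; congr EFin; field.
- by move=> x; rewrite invr_ge0.
- exact: continuous_oneDsqrV.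
- by move=> x /=; rewrite /oneDsqr sqrrN.
Qed.

Lemma integrable_oneDsqrV : mu.-integrable setT (fun w => ((oneDsqr w)^-1)%:E).
Proof.
apply/integrableP; split; first by apply/measurable_EFinP; exact: measurable_oneDsqrV.
under eq_integral => w _ do rewrite gee0_abs ?lee_fin ?invr_ge0 //.
by rewrite integralT_oneDsqrV ltry.
Qed.

Lemma decay_integrable (f : R -> R) C : measurable_fun setT f ->
  (forall w, `|f w| <= C * (oneDsqr w)^-1) -> mu.-integrable setT (EFin \o f).
Proof.
move=> mf fC.
apply: (le_integrable measurableT _ _ (integrableZl measurableT C integrable_oneDsqrV)).
  exact/measurable_EFinP.
move=> w _; rewrite /= lee_fin; apply: le_trans (fC w) _; exact: ler_norm.
Qed.

Lemma decay_Rintegral_le (f : R -> R) C : measurable_fun setT f ->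
  (forall w, `|f w| <= C * (oneDsqr w)^-1) -> `|\int[mu]_w f w| <= C * pi.
Proof.
move=> mf fC; have fi := decay_integrable mf fC.
apply: le_trans (le_normr_Rintegral measurableT fi) _.
have -> : C * pi = \int[mu]_w (C * (oneDsqr w)^-1).
  rewrite RintegralZl //; last exact: integrable_oneDsqrV.
  by rewrite /Rintegral integralT_oneDsqrV.
apply: le_Rintegral => //.
- exact: (integrable_norm fi).
- exact: (integrableZl measurableT C integrable_oneDsqrV).
Qed.

(** The nonnegative formula is applied to the positive and negative parts, whose integrals are
    finite. Negative factors are included because the parity argument takes a = - 1. *)
Lemma Rintegral_scale (a : R) (f : R -> R) : a != 0 -> mu.-integrable setT (EFin \o f) ->
  \int[mu]_w f w = `|a| * \int[mu]_w f (a * w).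
Proof.
move=> a0 fi.
have mf : measurable_fun setT (EFin \o f) by exact: (measurable_int mu fi).
have key : (\int[mu]_w (EFin \o f) w = `|a|%:E * \int[mu]_w (EFin \o f) (a * w)%R)%E.
  have hp : (\int[mu]_w ((EFin \o f)^\+ w) = `|a|%:E * \int[mu]_w ((fun w => (EFin \o f) (a * w)%R)^\+ w))%E.
    rewrite (ge0_integral_affine 0 a0) //; last exact: measurable_funepos.
    by congr (_ * _)%E; apply: eq_integral => x _; rewrite addr0 !(funeposE, funenegE).
  have hn : (\int[mu]_w ((EFin \o f)^\- w) = `|a|%:E * \int[mu]_w ((fun w => (EFin \o f) (a * w)%R)^\- w))%E.
    rewrite (ge0_integral_affine 0 a0) //; last exact: measurable_funeneg.
    by congr (_ * _)%E; apply: eq_integral => x _; rewrite addr0 !(funeposE, funenegE).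
  have a1 : (0 < `|a|)%R by rewrite normr_gt0.
  have finn := integrable_neg_fin_num measurableT fi.
  have fn : (\int[mu]_w ((fun w => (EFin \o f) (a * w)%R)^\- w) \is a fin_num)%E.
    set X := (X in X \is a fin_num); have -> : X = (`|a|^-1%:E * (\int[mu]_w (EFin \o f)^\- w))%E.
      by rewrite hn muleA -EFinM mulVf ?mul1e // normr_eq0.
    exact: fin_numM.
  transitivity (`|a|%:E * (\int[mu]_w ((fun w => (EFin \o f) (a * w)%R)^\+ w) -
      \int[mu]_w ((fun w => (EFin \o f) (a * w)%R)^\- w)))%E; last by rewrite -integralE.
  rewrite [LHS]integralE hp hn; symmetry; apply: muleBr => //.
  by apply: fin_num_adde_defl; rewrite fin_numN.
rewrite /Rintegral key fineM //; set X := (X in X \is a fin_num).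
have -> : X = (`|a|^-1%:E * (\int[mu]_w (EFin \o f) w))%E.
  by rewrite key muleA -EFinM mulVf ?mul1e // normr_eq0.
by apply: fin_numM => //; exact: integrable_fin_num.
Qed.

Lemma integrable_scale (a : R) (f : R -> R) : a != 0 -> mu.-integrable setT (EFin \o f) ->
  mu.-integrable setT (EFin \o (fun w => f (a * w))).
Proof.
move=> a0 /integrableP[/measurable_EFinP mf fi]; apply/integrableP; split.
  by apply/measurable_EFinP; apply: (measurableT_comp mf); exact: measurable_funM.
move: fi; rewrite (ge0_integral_affine 0 a0) //; last first.
  by apply: measurableT_comp => //; exact/measurable_EFinP.
under eq_integral => x _ do rewrite addr0.
set X := (X in (_ * X)%E); have a1 : (0 < `|a|)%R by rewrite normr_gt0.
by rewrite ltey => XE; rewrite ltey; apply: contraNneq XE => Xy; rewrite /X Xy gt0_muley ?lte_fin.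
Qed.

Lemma integrable_patch (A : set (measurableTypeR R)) (f : R -> R) : measurable A ->
  mu.-integrable A (EFin \o f) -> mu.-integrable setT (EFin \o (f \_ A)).
Proof.
move=> mA fi; have -> : EFin \o (f \_ A) = ((EFin \o f) \_ A)%E.
  by apply/funext => z; rewrite /= !patchE; case: ifP.
exact: (iffLR (@integrable_mkcond _ _ _ mu A (EFin \o f) mA) fi).
Qed.

Lemma Rintegral_sum d (T : measurableType d) (nu : {measure set T -> \bar R}) (D : set T) n
    (f : nat -> T -> R) : measurable D ->
  (forall i, (i < n)%N -> nu.-integrable D (EFin \o f i)) ->
  nu.-integrable D (EFin \o (fun x => \sum_(i < n) f i x)) /\
  \int[nu]_(x in D) (\sum_(i < n) f i x) = \sum_(i < n) \int[nu]_(x in D) f i x.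
Proof.
move=> mD; elim: n => [|n IH] fi.
  have -> : (fun x => \sum_(i < 0) f i x) = cst 0 by apply/funext => x; rewrite big_ord0.
  by rewrite big_ord0; split; [exact: integrable0|rewrite Rintegral_cst // mul0r].
have [IH1 IH2] := IH (fun i ni => fi i (ltnW ni)).
have -> : (fun x => \sum_(i < n.+1) f i x) = (fun x => \sum_(i < n) f i x + f n x).
  by apply/funext => x; rewrite big_ord_recr.
split; first exact: (integrableD mD IH1 (fi n (ltnSn n))).
by rewrite RintegralD // ?IH2 ?big_ord_recr //; exact: fi.
Qed.

End GaussDecay.

(** * Laplace expansion of the integral over a normal segment *)

Section LaplaceIntegral.
Context {R : realType}.
Local Notation mu := (@lebesgue_measure R).
Implicit Types (s : nat -> R) (w tau : R).

Definition laplace_moment s (kap : R) (j : nat) : R :=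
  \int[mu]_w (expR (- (s 2 * w ^+ 2 / 4)) * laplace_term s kap w j).

Lemma continuous_laplace_term s kap j : continuous (fun w => laplace_term s kap w j).
Proof.
have cp i : continuous (fun w : R => taylor_exponent s w i).
  move=> w; apply: cvgN; apply: cvgMr; exact: exprn_continuous.
have ce n : continuous (fun w : R => exp_coef id (taylor_exponent s w) n).
  elim/ltn_ind: n => -[_|n IH] w.
    exact: cvg_cst.
  have -> : (fun w => exp_coef id (taylor_exponent s w) n.+1) =
      (fun w => n.+1%:R^-1 * \sum_(i < n.+1) i.+1%:R * taylor_exponent s w i.+1 *
        exp_coef id (taylor_exponent s w) (n - i)) by apply/funext => x; rewrite exp_coefS.
  apply: cvgMr.
  apply: cvg_big => [|i _]; first exact: add_continuous.
  apply: cvgM; first by apply: cvgMr; exact: cp.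
  by apply: IH; rewrite ltnS leq_subr.
rewrite /laplace_term /laplace_coef => w; apply: cvgB; first exact: ce.
case: j => [|j]; first exact: cvg_cst.
by apply: cvgM; [apply: cvgMr; exact: cvg_id|exact: ce].
Qed.

Lemma measurable_gauss_term s kap j :
  measurable_fun setT (fun w => expR (- (s 2 * w ^+ 2 / 4)) * laplace_term s kap w j).
Proof.
apply: continuous_measurable_fun => w; apply: cvgM; last exact: continuous_laplace_term.
apply: continuous_comp; last exact: continuous_expR.
apply: cvgN; apply: cvgMl; apply: cvgMr; exact: exprn_continuous.
Qed.

Lemma gauss_term_decay N B c0 j : 0 < c0 -> (j <= N)%N ->
  exists C, forall s kap, jet_bound N B (s, kap) -> c0 <= s 2 ->
  forall w, `|expR (- (s 2 * w ^+ 2 / 4)) * laplace_term s kap w j| <= C * (oneDsqr w)^-1.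
Proof.
move=> c00 jN; have [C [M [C0 CM]]] := @laplace_term_growth R N B j jN.
have c1 : 0 < c0 / 4 by rewrite divr_gt0.
  have [D D0 DM] := gauss_poly_decay M c1.
exists (C * D) => s kap jb s2 w; rewrite normrM ger0_norm ?expR_ge0 // mulrC.
apply: le_trans (ler_wpM2r (expR_ge0 _) (CM _ w jb)) _.
rewrite -(mulrA C) -(mulrA C D); apply: ler_wpM2l => //; apply: le_trans (DM w).
apply: ler_wpM2l; first by rewrite exprn_ge0 // addr_ge0.
rewrite ler_expR lerN2 (_ : c0 / 4 * w ^+ 2 = c0 * w ^+ 2 / 4); last by ring.
  rewrite ler_pM2r ?invr_gt0 //.
by apply: ler_wpM2r => //; exact: sqr_ge0.
Qed.

Lemma integrable_gauss_term s kap j : 0 < s 2 ->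
  mu.-integrable setT (EFin \o (fun w => expR (- (s 2 * w ^+ 2 / 4)) * laplace_term s kap w j)).
Proof.
move=> s2; pose B := `|kap| + \sum_(k < j.+3) `|s k|.
have [C CP] := @gauss_term_decay j B (s 2) j s2 (leqnn j).
apply: decay_integrable (CP s kap _ (lexx _)); first exact: measurable_gauss_term.
split => /=; first by rewrite lerDl sumr_ge0.
move=> k /andP[_ kj]; rewrite /B (bigD1 (Ordinal (kj : k < j.+3)%N)) //=.
by rewrite addrCA lerDl addr_ge0 // sumr_ge0.
Qed.

(** The constant is uniform in [s], [kap], [phi] and [tau], so that the estimate can be integrated
    along the curve. After z = tau w, the pointwise estimate covers |tau w| <= eps; beyond, only the
    tails of the Gaussian terms are left. *)
Lemma laplace_integral (N : nat) (B eps c0 : R) :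
  0 <= B -> 0 < eps -> eps <= 1 -> 0 < c0 -> 16 * N.+1%:R * B * eps <= c0 ->
  exists C, forall s kap (phi : R -> R) tau,
    jet_bound N B (s, kap) -> c0 <= s 2 -> continuous phi ->
    (forall z, `|z| <= eps -> `|phi z - taylor_poly s N z| <= B * `|z| ^+ N.+3) ->
    0 < tau <= 1 ->
    `|\int[mu]_(z in `[(- eps)%R, eps]) (expR (- (phi z / (2 * tau ^+ 2))) * (1 - z * kap)) -
      \sum_(j < N.+1) tau ^+ j.+1 * laplace_moment s kap j| <= C * tau ^+ N.+2.
Proof.
move=> B0 eps0 eps1 c00 small.
have [C1 [M1 [C10 CM1]]] := @pointwise_majorant_growth R N B.
have c1 : 0 < c0 / 8 by rewrite divr_gt0.
  have [D1 D10 DM1] := gauss_poly_decay M1 c1.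
have : forall j : 'I_N.+1, exists C, 0 <= C /\ forall s kap, jet_bound N B (s, kap) -> c0 <= s 2 ->
    forall w, `|w| ^+ N.+1 * `|expR (- (s 2 * w ^+ 2 / 4)) * laplace_term s kap w j| <= C * (oneDsqr w)^-1.
  move=> j; have jN : (j <= N)%N by rewrite -ltnS.
  have [C [M [C0 CM]]] := @laplace_term_growth R N B j jN.
  have c4 : 0 < c0 / 4 by rewrite divr_gt0.
  have [D D0 DM] := gauss_poly_decay (N.+1 + M) c4.
  exists (C * D); split; first exact: mulr_ge0.
  move=> s kap jb s2 w; rewrite normrM ger0_norm ?expR_ge0 //.
  have w1 : `|w| ^+ N.+1 <= (1 + `|w|) ^+ N.+1 by rewrite lerXn2r ?nnegrE ?addr_ge0 // lerDr.
  have CMw := CM _ w jb.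
  have e1 : expR (- (s 2 * w ^+ 2 / 4)) <= expR (- (c0 / 4 * w ^+ 2)).
    rewrite ler_expR lerN2 (_ : c0 / 4 * w ^+ 2 = c0 * w ^+ 2 / 4); last by ring.
  rewrite ler_pM2r ?invr_gt0 //.
    by apply: ler_wpM2r => //; exact: sqr_ge0.
  have -> : C * D / oneDsqr w = C * (D / oneDsqr w) by rewrite mulrA.
  apply: le_trans (ler_wpM2l C0 (DM w)); rewrite exprD.
  have p0 : 0 <= (1 + `|w|) ^+ N.+1 by rewrite exprn_ge0 // addr_ge0.
  have q0 : 0 <= `|w| ^+ N.+1 by rewrite exprn_ge0.
  have -> : C * ((1 + `|w|) ^+ N.+1 * (1 + `|w|) ^+ M * expR (- (c0 / 4 * w ^+ 2))) =
      (1 + `|w|) ^+ N.+1 * (expR (- (c0 / 4 * w ^+ 2)) * (C * (1 + `|w|) ^+ M)) by ring.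
  by apply: ler_pM => //; apply: ler_pM.
move=> /choice[CC CCP].
pose C2 := \sum_j CC j / eps ^+ N.+1.
exists ((C1 * D1 + C2) * pi) => s kap phi tau jb s2 cphi phiT /andP[tau0 tau1].
have tn0 : tau != 0 by rewrite gt_eqF.
have eN0 : 0 < eps ^+ N.+1 by exact: exprn_gt0.
have C20 : 0 <= C2.
  by apply: sumr_ge0 => j _; rewrite divr_ge0 ?(ltW eN0) //; have [] := CCP j.
have s20 : 0 < s 2 by exact: lt_le_trans s2.
pose g z := expR (- (phi z / (2 * tau ^+ 2))) * (1 - z * kap).
pose gt := fun j w => expR (- (s 2 * w ^+ 2 / 4)) * laplace_term s kap w j.
pose I := `[(- eps)%R, eps]%classic.
have cg : continuous g.
  move=> z; apply: cvgM; last first.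
    by apply: cvgB; [exact: cvg_cst|apply: cvgMl; exact: cvg_id].
  apply: continuous_comp; last exact: continuous_expR.
  by apply: cvgN; apply: cvgMl; exact: cphi.
have mI : measurable I by exact: measurable_itv.
have gi : mu.-integrable I (EFin \o g).
  apply: continuous_compact_integrable; first exact: segment_compact.
  exact: continuous_subspaceT.
have gIi : mu.-integrable setT (EFin \o (g \_ I)).
  exact: integrable_patch.
have mgI : measurable_fun setT (g \_ I) by apply/measurable_EFinP; exact: (measurable_int mu gIi).
have mscale : measurable_fun setT (fun w => (g \_ I) (tau * w)).
  by apply: measurableT_comp => //; exact: measurable_funM.
have gtauI := integrable_scale tn0 gIi.
have [fsum sumE] : mu.-integrable setT (EFin \o (fun w => \sum_(j < N.+1) tau ^+ j * gt j w)) /\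
    \int[mu]_w (\sum_(j < N.+1) tau ^+ j * gt j w) = \sum_(j < N.+1) tau ^+ j * laplace_moment s kap j.
  have gti j : mu.-integrable setT (EFin \o gt j) by exact: integrable_gauss_term.
  have [h ->] := @Rintegral_sum _ _ _ mu setT N.+1 (fun j w => tau ^+ j * gt j w) measurableT
    (fun j _ => integrableZl measurableT (tau ^+ j) (gti j)).
  by split => //; apply: eq_bigr => j _; rewrite RintegralZl.
have -> : \sum_(j < N.+1) tau ^+ j.+1 * laplace_moment s kap j =
    tau * \int[mu]_w (\sum_(j < N.+1) tau ^+ j * gt j w).
  by rewrite sumE mulr_sumr; apply: eq_bigr => j _; rewrite exprS mulrA.
have gE : \int[mu]_(z in I) g z = tau * \int[mu]_w (g \_ I) (tau * w).
  by rewrite Rintegral_mkcond (Rintegral_scale tn0 gIi) gtr0_norm.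
rewrite -/(g _) gE -mulrBr -RintegralB //.
rewrite normrM gtr0_norm // exprS mulrCA; apply: ler_wpM2l; first exact: ltW.
rewrite mulrAC; apply: decay_Rintegral_le.
  apply: measurable_funB => //; apply/measurable_EFinP; exact: (measurable_int mu fsum).
move=> w.
have -> : (C1 * D1 + C2) * tau ^+ N.+1 / oneDsqr w =
    C1 * D1 * (tau ^+ N.+1 / oneDsqr w) + C2 * (tau ^+ N.+1 / oneDsqr w) by ring.
have o0 : 0 <= (oneDsqr w)^-1 by rewrite invr_ge0.
have tN0 : 0 <= tau ^+ N.+1 by rewrite exprn_ge0 // ltW.
have gsum : \sum_(j < N.+1) tau ^+ j * gt j w = expR (- (s 2 * w ^+ 2 / 4)) * \sum_(j < N.+1) tau ^+ j * laplace_term s kap w j.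
  by rewrite mulr_sumr; apply: eq_bigr => j _; rewrite /gt mulrCA.
have [tw|tw] := leP `|tau * w| eps.
  have Iw : I (tau * w) by rewrite /I /= in_itv /= -ler_norml.
  rewrite patchE mem_set // gsum /g.
  apply: le_trans (laplace_pointwise B0 eps0 eps1 c00 small jb s2 phiT _ tw) _; first by rewrite tau0.
  apply: le_trans (_ : C1 * D1 * (tau ^+ N.+1 / oneDsqr w) <= _); last first.
    by rewrite lerDl; apply: mulr_ge0 => //; exact: mulr_ge0.
  have -> : C1 * D1 * (tau ^+ N.+1 / oneDsqr w) = tau ^+ N.+1 * (C1 * (D1 / oneDsqr w)) by ring.
  rewrite -mulrA; apply: ler_wpM2l => //; apply: le_trans (ler_wpM2l C10 (DM1 w)).
  have -> : - (c0 * w ^+ 2 / 8) = - (c0 / 8 * w ^+ 2) by ring.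
  rewrite (mulrA C1).
  apply: ler_wpM2r; first exact: expR_ge0.
  by apply: le_trans (CM1 _ w jb); exact: ler_norm.
have Iw : ~ I (tau * w) by rewrite /I /= in_itv /= -ler_norml; apply/negP; rewrite -ltNge.
rewrite patchE memNset // sub0r normrN.
apply: le_trans (_ : C2 * (tau ^+ N.+1 / oneDsqr w) <= _); last first.
  by rewrite lerDr; apply: mulr_ge0 => //; exact: mulr_ge0.
apply: le_trans (ler_norm_sum _ _ _) _; rewrite /C2 mulr_suml; apply: ler_sum => j _.
have [CC0 CCw] := CCP j; have {}CCw := CCw s kap jb s2 w.
rewrite normrM ger0_norm ?exprn_ge0 ?(ltW tau0) //.
have t1 : tau ^+ j <= 1 by rewrite exprn_ile1 // ltW.
(* Beyond |tau w| = eps, multiplying by this factor, which is at least 1, trades the decay of the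
   tails in w for the power tau^(N + 1). *)
have big : 1 <= (tau * `|w|) ^+ N.+1 / eps ^+ N.+1.
  rewrite ler_pdivlMr // mul1r lerXn2r ?nnegrE ?(ltW eps0) ?mulr_ge0 ?(ltW tau0) //.
  by move: tw; rewrite normrM gtr0_norm // => /ltW.
apply: le_trans (_ : `|gt j w| * ((tau * `|w|) ^+ N.+1 / eps ^+ N.+1) <= _).
  rewrite mulrC; apply: ler_wpM2l => //; exact: le_trans big.
have -> : `|gt j w| * ((tau * `|w|) ^+ N.+1 / eps ^+ N.+1) =
   (`|w| ^+ N.+1 * `|gt j w|) * (tau ^+ N.+1 / eps ^+ N.+1) by rewrite exprMn; ring.
have -> : CC j / eps ^+ N.+1 * (tau ^+ N.+1 / oneDsqr w) =
  (CC j / oneDsqr w) * (tau ^+ N.+1 / eps ^+ N.+1) by ring.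
by apply: ler_wpM2r => //; rewrite divr_ge0 // ltW.
Qed.

End LaplaceIntegral.

(** * Parity, Gaussian moments and universal coefficients *)

Section LaplaceMoments.
Context {R : realType}.
Local Notation mu := (@lebesgue_measure R).
Implicit Types (s : nat -> R) (w : R).

Lemma laplace_term_opp s kap w j :
  laplace_term s kap (- w) j = (-1) ^+ j * laplace_term s kap w j.
Proof.
have tE : taylor_exponent s (- w) = fun i => (-1) ^+ i * taylor_exponent s w i.
  apply/funext => i; rewrite /taylor_exponent (exprNn w).
  have -> : (-1 : R) ^+ i.+2 = (-1) ^+ i by rewrite !exprS mulrA mulrNN !mul1r.
  by rewrite mulrCA -mulrN.
rewrite /laplace_term /laplace_coef tE exp_coef_sign; case: j => [|j].
  by rewrite !subr0.
by rewrite exp_coef_sign exprS; ring.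
Qed.

Lemma laplace_moment_odd s kap j : 0 < s 2 -> laplace_moment s kap j.*2.+1 = 0.
Proof.
move=> s2; have gi := integrable_gauss_term kap j.*2.+1 s2.
have n1 : (-1 : R) != 0 by rewrite oppr_eq0 oner_eq0.
have tN w : laplace_term s kap (- w) j.*2.+1 = - laplace_term s kap w j.*2.+1.
  by rewrite laplace_term_opp -signr_odd oddS odd_double mulN1r.
have := Rintegral_scale n1 gi; rewrite normrN1 mul1r -/(laplace_moment _ _ _).
have -> : \int[mu]_w (expR (- (s 2 * (-1 * w) ^+ 2 / 4)) * laplace_term s kap (-1 * w) j.*2.+1) =
    (-1) * laplace_moment s kap j.*2.+1.
  by rewrite -RintegralZl //; apply: eq_Rintegral => w _; rewrite !mulN1r sqrrN tN mulrN.
by lra.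
Qed.

Lemma eq_laplace_coef (A : comNzRingType) (c : R -> A) (p q : nat -> A) k n :
  (forall i, (0 < i <= n)%N -> p i = q i) -> laplace_coef c p k n = laplace_coef c q k n.
Proof.
move=> pq; rewrite /laplace_coef (eq_exp_coef _ pq); case: n pq => [//|n] pq.
by rewrite (@eq_exp_coef _ _ _ _ q n) // => i /andP[i0 /leqW ik]; rewrite pq // i0.
Qed.

(** This is [laplace_term] with w kept as an indeterminate, over a ring A of scalars: evaluation in
    w gives back the integrand, and a morphism out of A specialises the universal coefficients. *)
Definition laplace_poly (A : comNzRingType) (c : R -> A) (s : nat -> A) (kap : A) (j : nat) : {poly A} :=
  laplace_coef (fun r => (c r)%:P)
    (fun i => (- (c (2 * (i.+2)`!%:R)^-1 * s i.+2))%:P * 'X^(i.+2)) (kap%:P * 'X) j.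

Lemma map_laplace_poly (A B : comNzRingType) (c : R -> A) (c' : R -> B) (f : {rmorphism A -> B})
    (sig : nat -> A) (k : A) j : (forall r, f (c r) = c' r) ->
  map_poly f (laplace_poly c sig k j) = laplace_poly c' (f \o sig) (f k) j.
Proof.
move=> fc; rewrite /laplace_poly.
have fc' r : map_poly f (c r)%:P = (c' r)%:P by rewrite map_polyC /= fc.
rewrite (rmorph_laplace_coef _ _ _ fc') rmorphM /= map_polyC map_polyX; congr laplace_coef.
by apply/funext => i; rewrite rmorphM /= map_polyC /= map_polyXn rmorphN rmorphM /= fc.
Qed.

Lemma horner_laplace_poly s kap w j : (laplace_poly id s kap j).[w] = laplace_term s kap w j.
Proof.
have hc r : horner_eval w (id r)%:P = id r by rewrite /horner_eval hornerC.
rewrite -/(horner_eval w _) /laplace_poly (rmorph_laplace_coef _ _ _ hc) /laplace_term.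
rewrite /= /horner_eval !hornerE; congr laplace_coef.
by apply/funext => i; rewrite /taylor_exponent hornerM hornerC hornerXn mulNr.
Qed.

Definition gauss_moment (d : nat) : R := \int[mu]_w (expR (- (w ^+ 2 / 4)) * w ^+ d).

Lemma integrable_gauss_moment d : mu.-integrable setT (EFin \o (fun w => expR (- (w ^+ 2 / 4)) * w ^+ d)).
Proof.
have c0 : 0 < 1 / 4 :> R by rewrite divr_gt0.
have [C C0 CP] := gauss_poly_decay d c0.
apply: (@decay_integrable _ _ C).
  apply: continuous_measurable_fun => w; apply: cvgM; last exact: exprn_continuous.
  apply: continuous_comp; last exact: continuous_expR.
  apply: cvgN; apply: cvgMl; exact: exprn_continuous.
move=> w; apply: le_trans (CP w); rewrite normrM ger0_norm ?expR_ge0 // mulrC normrX.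
have -> : 1 / 4 * w ^+ 2 = w ^+ 2 / 4 by ring.
apply: ler_wpM2r; first exact: expR_ge0.
by rewrite lerXn2r ?nnegrE ?addr_ge0 // lerDr.
Qed.

(** The substitution of s_2^(-1/2) w for w; it is here that s_2^(-1/2) enters the coefficients, with
    one power from the measure and d from the monomial. *)
Lemma gauss_moment_scale (s2 : R) d : 0 < s2 ->
  mu.-integrable setT (EFin \o (fun w => expR (- (s2 * w ^+ 2 / 4)) * w ^+ d)) /\
  \int[mu]_w (expR (- (s2 * w ^+ 2 / 4)) * w ^+ d) = s2 `^ (- (1 / 2)) ^+ d.+1 * gauss_moment d.
Proof.
move=> s20; set r := s2 `^ _.
have r0 : 0 < r by exact: powR_gt0.
have r2 : r ^+ 2 * s2 = 1.
  rewrite /r -powR_mulrn ?powR_ge0 // -powRrM -{2}(powRr1 (ltW s20)) -powRD.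
    by rewrite (_ : - (1 / 2) * 2 + 1 = 0) ?powRr0 //; field.
  by rewrite (gt_eqF s20) implybT.
pose g w := expR (- (w ^+ 2 / 4)) * w ^+ d.
have rn0 : r^-1 != 0 by rewrite invr_eq0 gt_eqF.
have gE w : expR (- (s2 * w ^+ 2 / 4)) * w ^+ d = r ^+ d * g (r^-1 * w).
  rewrite /g !exprMn exprVn (_ : s2 * w ^+ 2 = (r ^+ 2)^-1 * w ^+ 2).
    by rewrite [in RHS]mulrCA mulrA exprVn; field; rewrite expf_neq0 // gt_eqF.
  by congr (_ * _); apply: (mulfI (x := r ^+ 2)); rewrite ?expf_neq0 ?gt_eqF // r2 divff // expf_neq0 // gt_eqF.
have gi := integrable_gauss_moment d.
have gsi := integrable_scale rn0 gi.
have -> : (fun w => expR (- (s2 * w ^+ 2 / 4)) * w ^+ d) = fun w => r ^+ d * g (r^-1 * w).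
  by apply/funext => w; exact: gE.
split; first exact: (integrableZl measurableT (r ^+ d) gsi).
rewrite RintegralZl // /gauss_moment (Rintegral_scale rn0 gi) gtr0_norm ?invr_gt0 //.
by rewrite exprSr mulrA -(mulrA _ r) divff ?mulr1 // gt_eqF.
Qed.

(** The bound [n] is left free because specialisation can lower the degree: the sum is used with the
    size of the universal polynomial. *)
Lemma laplace_momentE s kap j n : 0 < s 2 -> (size (laplace_poly id s kap j) <= n)%N ->
  laplace_moment s kap j =
  \sum_(d < n) (laplace_poly id s kap j)`_d * (s 2 `^ (- (1 / 2)) ^+ d.+1 * gauss_moment d).
Proof.
move=> s20; set p := laplace_poly id s kap j => pn.
pose h d w := p`_d * (expR (- (s 2 * w ^+ 2 / 4)) * w ^+ d).
have hi d : mu.-integrable setT (EFin \o h d).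
  exact: (integrableZl measurableT p`_d (gauss_moment_scale d s20).1).
have -> : laplace_moment s kap j = \int[mu]_w (\sum_(d < n) h d w).
  apply: eq_Rintegral => w _; rewrite -horner_laplace_poly (horner_coef_wide w pn).
  by rewrite mulr_sumr; apply: eq_bigr => d _; rewrite mulrCA.
rewrite (Rintegral_sum measurableT (fun d _ => hi d)).2; apply: eq_bigr => d _.
by rewrite RintegralZl // ?(gauss_moment_scale d s20).2 //; exact: (gauss_moment_scale d s20).1.
Qed.

Section Universal.
Variable k : nat.
Local Notation A := (mpoly.mpoly k.*2.+2 R).

Definition coeff_var (i : nat) : A := mpoly.mpolyX R (mpoly.mnm1 (inord i : 'I_k.*2.+2)).

(* Only s_3, ..., s_(2 k + 2) enter the k-th coefficient. *)
Definition coeff_jet (j : nat) : A := if (2 < j <= k.*2.+2)%N then coeff_var j.-1 else 0.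

Definition coeff_laplace : {poly A} :=
  laplace_poly (fun r => mpoly.mpolyC _ r) coeff_jet (coeff_var 0) k.*2.

(** Gaussian integration monomial by monomial, [coeff_var 1] standing for s_2^(-1/2). The factor 1 /
    (4 pi) is that of the heat kernel. *)
Definition coeff_poly : A :=
  \sum_(d < size coeff_laplace)
    mpoly.mpolyC _ ((4 * pi)^-1 * gauss_moment d) * (coeff_laplace`_d * coeff_var 1 ^+ d.+1).

Lemma coeff_polyE s kap : 0 < s 2 ->
  mpoly.meval (fun i : 'I_k.*2.+2 => local_data kap s i) coeff_poly =
  (4 * pi)^-1 * laplace_moment s kap k.*2.
Proof.
move=> s20; set v := fun i : 'I_k.*2.+2 => local_data kap s i.
have vX i : (i < k.*2.+2)%N -> mpoly.meval v (coeff_var i) = local_data kap s i.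
  by move=> ik; rewrite /coeff_var mpoly.mevalXU /v inordK.
have vC r : mpoly.meval v (mpoly.mpolyC _ r) = id r by exact: mpoly.mevalC.
have mapE : map_poly (mpoly.meval v) coeff_laplace =
    laplace_poly id s kap k.*2.
  rewrite (map_laplace_poly _ _ _ vC) [X in laplace_poly _ _ X](vX 0%N) //.
  apply: eq_laplace_coef => i /andP[i0 ik] /=.
  rewrite /coeff_jet !ltnS i0 ik /= vX ?ltnS //.
  by case: i i0 {ik}.
rewrite (@laplace_momentE s kap k.*2 (size coeff_laplace) s20); last first.
  by rewrite -mapE size_poly.
rewrite mulr_sumr /coeff_poly rmorph_sum /=; apply: eq_bigr => d _.
rewrite !rmorphM rmorphXn /= vX // !vC -mapE coef_map /=.
by ring.
Qed.

End Universal.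
End LaplaceMoments.

(** * Geometry of the tube around the curve *)

Section IteratedDirectional.
Context {R : realType}.
Implicit Types (S : R * R -> R) (v x : R * R).

(** In a normal derivative the direction is frozen at [h x], so it is an iterated derivative in a
    constant direction [v], to which the smoothness of S applies. *)
Definition iter_derive v (k : nat) S : R * R -> R := iter k (fun g x => 'D_v g x) S.

Lemma iter_deriveS v k S : iter_derive v k.+1 S = iter_derive v k (fun x => 'D_v S x).
Proof. by rewrite /iter_derive iterSr. Qed.

Lemma smooth_differentiable S x : smooth S -> differentiable S x.
Proof. by move=> sS; have [] := sS 1%N; move=> + _; exact. Qed.

Lemma smooth_derive v S : smooth S -> smooth (fun x => 'D_v S x).
Proof. by move=> sS n; have [_] := sS n.+1; exact. Qed.

Lemma is_derive_line x v (z : R) : is_derive z 1 (fun z : R => x + z *: v) v.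
Proof.
have dl (a b : R) : is_derive z 1 (fun z : R => a + z * b) b.
  by apply: is_derive_eq; rewrite /GRing.scale /=; ring.
have -> : (fun z : R => x + z *: v) = fun z => (x.1 + z * v.1, x.2 + z * v.2) by [].
have d1 := is_derive_differentiable (dl x.1 v.1).
have d2 := is_derive_differentiable (dl x.2 v.2).
have e := derive_pair (1 : R) d1 d2.
have e1 : 'D_1 (fun z : R => x.1 + z * v.1) z = v.1 by have d := dl x.1 v.1; exact: derive_val.
have e2 : 'D_1 (fun z : R => x.2 + z * v.2) z = v.2 by have d := dl x.2 v.2; exact: derive_val.
rewrite e1 e2 -surjective_pairing in e; rewrite -[X in is_derive _ _ _ X]e.
exact: (differentiable_is_derive (differentiable_pair d1 d2)).
Qed.

Lemma is_derive_comp_line S x v (z : R) : smooth S ->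
  is_derive z 1 (fun z : R => S (x + z *: v)) ('D_v S (x + z *: v)).
Proof.
move=> sS; have dl := is_derive_line x v z.
have d1 := is_derive_differentiable dl.
have d2 := smooth_differentiable (x + z *: v) sS.
have e := derive_compE (1 : R) d1 d2.
have el : 'D_1 (fun z : R => x + z *: v) z = v by exact: derive_val.
rewrite el in e; rewrite -e; apply: differentiable_is_derive.
exact: (differentiable_comp d1 d2).
Qed.

Lemma derive1n_line S x v k : smooth S ->
  derive1n k (fun z : R => S (x + z *: v)) = fun z => iter_derive v k S (x + z *: v).
Proof.
elim: k S => [|k IH] S sS; first by [].
rewrite derive1Sn iter_deriveS -(IH _ (smooth_derive v sS)); congr derive1n.
apply/funext => z; rewrite derive1E.
by have d := is_derive_comp_line x v z sS; exact: derive_val.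
Qed.

Lemma iter_derive_lin v k (a b : R) S T x : smooth S -> smooth T ->
  iter_derive v k (fun x => a * S x + b * T x) x =
  a * iter_derive v k S x + b * iter_derive v k T x.
Proof.
elim: k S T => [//|k IH] S T sS sT; rewrite !iter_deriveS.
rewrite -(IH _ _ (smooth_derive v sS) (smooth_derive v sT)).
congr iter_derive; apply/funext => y.
have dS := diff_derivable (v := v) (smooth_differentiable y sS).
have dT := diff_derivable (v := v) (smooth_differentiable y sT).
have dZS := @derivableZ _ _ _ S a y v dS; have dZT := @derivableZ _ _ _ T b y v dT.
by rewrite (deriveD dZS dZT) !deriveZ.
Qed.

Lemma iter_derive_planeE v k S x : smooth S ->
  iter_derive v k.+1 S x =
  v.1 * iter_derive v k (fun x => 'D_(1, 0) S x) x + v.2 * iter_derive v k (fun x => 'D_(0, 1) S x) x.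
Proof.
move=> sS; rewrite iter_deriveS -iter_derive_lin; [|exact: smooth_derive..].
congr iter_derive; apply/funext => y; rewrite derive_planeE //.
exact: smooth_differentiable.
Qed.

(** An iterated derivative is a polynomial in the components of the direction, with derivatives
    along the axes as coefficients. Expanding one direction at a time makes the continuity in
    direction and point visible. *)
Lemma continuous_iter_derive (T : topologicalType) (x v : T -> R * R) k S (t : T) : smooth S ->
  {for t, continuous x} -> {for t, continuous v} ->
  {for t, continuous (fun t => iter_derive (v t) k S (x t))}.
Proof.
move=> sS cx cv; elim: k S sS => [|k IH] S sS.
  have cS : {for x t, continuous S} := Cn_on_continuous (sS 0%N) I; exact: (continuous_comp cx cS).
rewrite (_ : (fun t => _) = fun t => (v t).1 * iter_derive (v t) k (fun x => 'D_(1, 0) S x) (x t) +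
    (v t).2 * iter_derive (v t) k (fun x => 'D_(0, 1) S x) (x t)); last first.
  by apply/funext => u; rewrite iter_derive_planeE.
have c1 : {for t, continuous (fun t => (v t).1)} := continuous_comp cv (@continuous_fst _ _ (v t)).
have c2 : {for t, continuous (fun t => (v t).2)} := continuous_comp cv (@continuous_snd _ _ (v t)).
have d1 := IH _ (smooth_derive (1, 0) sS); have d2 := IH _ (smooth_derive (0, 1) sS).
exact: (continuousD (continuousM c1 d1) (continuousM c2 d2)).
Qed.

(** Induction on the order: the derivative of the remainder is the remainder of ['D_v S], bounded by
    B |u|^n, and the mean value theorem restores one power of |z|. The factor 1 / n! is given up. *)
Lemma taylor_line S x v n (e B : R) : smooth S ->
  (forall z, `|z| <= e -> `|iter_derive v n S (x + z *: v)| <= B) ->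
  forall z, `|z| <= e ->
  `|S (x + z *: v) - \sum_(i < n) iter_derive v i S x / i`!%:R * z ^+ i| <= B * `|z| ^+ n.
Proof.
elim: n S => [|n IH] S sS bB z ze.
  by rewrite big_ord0 subr0 expr0 mulr1; exact: bB.
have sD := smooth_derive v sS.
pose p (z : R) := \sum_(i < n.+1) iter_derive v i S x / i`!%:R * z ^+ i.
pose q (z : R) := \sum_(i < n) iter_derive v i (fun x => 'D_v S x) x / i`!%:R * z ^+ i.
pose r (z : R) := S (x + z *: v) - p z.
have dp (u : R) : is_derive u 1 p (q u).
  pose P : {poly R} := \poly_(i < n.+1) (iter_derive v i S x / i`!%:R).
  have pE : p = horner P by apply/funext => y; rewrite horner_poly.
  have -> : q u = P^`().[u].
    rewrite /q (_ : P^`() = \poly_(i < n) (iter_derive v i (fun x => 'D_v S x) x / i`!%:R)).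
      by rewrite horner_poly.
    apply/polyP => i; rewrite coef_deriv !coef_poly ltnS -iter_deriveS.
    case: ifP => _; last by rewrite mul0rn.
    rewrite -[LHS]mulr_natr factS natrM.
    have n0 : i.+1%:R != 0 :> R by rewrite pnatr_eq0.
    have f0 : i`!%:R != 0 :> R by rewrite pnatr_eq0 -lt0n fact_gt0.
    by move: (i.+1%:R : R) (i`!%:R : R) n0 f0 => a b n0 f0; field; rewrite n0 f0.
  by rewrite pE; exact: is_derive_poly.
have dr (u : R) : is_derive u 1 r ('D_v S (x + u *: v) - q u).
  by have := is_deriveB (is_derive_comp_line x v u sS) (dp u).
have r0 : r 0 = 0.
  rewrite /r /p scale0r addr0 big_ord_recl expr0 fact0 mulr1 divr1 big1 ?addr0 ?subrr //.
  by move=> i _; rewrite lift0 expr0n mulr0.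
have cr : continuous r.
  by move=> u; have d := dr u; exact: (differentiable_continuous (is_derive_differentiable d)).
have bnd (u : R) : `|u| <= `|z| -> `|'D_v S (x + u *: v) - q u| <= B * `|u| ^+ n.
  move=> uz; apply: (IH _ sD) => [w we|]; last exact: le_trans uz ze.
  by rewrite -iter_deriveS; exact: bB.
have B0 : 0 <= B.
  by apply: le_trans (bB 0 _); rewrite ?normr0 // (le_trans _ ze).
have mvt (a b : R) : a < b -> exists2 u : R, a < u < b & r b - r a = ('D_v S (x + u *: v) - q u) * (b - a).
  move=> ab; have [u uab e0] := MVT ab (fun u _ => dr u) (continuous_subspaceT cr).
  by exists u; [move: uab; rewrite in_itv|].
have fin (u : R) : `|u| <= `|z| -> `|('D_v S (x + u *: v) - q u) * z| <= B * `|z| ^+ n.+1.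
  move=> uz; rewrite normrM exprSr mulrA; apply: ler_wpM2r => //.
  apply: le_trans (bnd u uz) _; apply: ler_wpM2l => //.
  by rewrite lerXn2r ?nnegrE.
change (`|r z| <= B * `|z| ^+ n.+1); have [z0|z0|<-] := ltgtP 0 z.
- have [u u0z e0] := mvt _ _ z0; move: e0; rewrite r0 !subr0 => ->.
  by apply: fin; rewrite !gtr0_norm; lra.
- have [u u0z e0] := mvt _ _ z0; move: e0; rewrite r0 !sub0r mulrN => /oppr_inj ->.
  by apply: fin; rewrite !ltr0_norm; lra.
- by rewrite r0 normr0 expr0n mulr0.
Qed.

End IteratedDirectional.

Section Displacement.
Context {R : realType}.
Variable Phi : R * R -> R * R.
Hypothesis smooth_Phi : smooth Phi.

Local Notation S := (half_sqr_displacement Phi).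

Lemma displacementE x : S x = dot (Phi x - x) (Phi x - x) / 2.
Proof. by rewrite /half_sqr_displacement /world_fun enorm_sqr. Qed.

Lemma displacement_ge0 x : 0 <= S x.
Proof. by rewrite displacementE divr_ge0 // dot_ge0. Qed.

Lemma displacement_gt0 x : ~ fixed_points Phi x -> 0 < S x.
Proof.
move=> nx; rewrite lt_neqAle displacement_ge0 andbT eq_sym; apply/negP => /eqP.
rewrite displacementE => /eqP; rewrite mulf_eq0 invr_eq0 pnatr_eq0 orbF dot_eq0 subr_eq0 => /eqP.
exact: nx.
Qed.

Lemma displacement_fixed x : fixed_points Phi x -> S x = 0.
Proof. by move=> fx; rewrite displacementE fx subrr /dot /= mulr0 addr0 mul0r. Qed.

Lemma smooth_displacement : smooth S.
Proof.
move=> n; have oT : open [set: R * R] by exact: openT.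
have c1 : Cn_on n setT (fun x => Phi x - x) by apply: Cn_sub => //; exact: Cn_id.
apply: (eq_Cn_on oT _ (Cn_scale 2^-1 oT (Cn_dot oT c1 c1))) => x _.
by rewrite displacementE mulrC.
Qed.

(** S is nonnegative and vanishes at x, so x is a minimum along every line. *)
Lemma displacement_derive_fixed v x : fixed_points Phi x -> 'D_v S x = 0.
Proof.
move=> fx; have dl := is_derive_comp_line x v 0 smooth_displacement.
have := @derive1_at_min R (fun z => S (x + z *: v)) (-1) 1 0 _ _ _ _.
rewrite scale0r addr0 in dl; have n1 : -1 <= 1 :> R by lra.
move=> /(_ n1) H; have {}H : is_derive (0 : R) 1 (fun z : R => S (x + z *: v)) 0.
  apply: H; [move=> t _|by rewrite in_itv /=; lra|move=> t _].
    by have d := is_derive_comp_line x v t smooth_displacement; exact: ex_derive.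
  by rewrite scale0r addr0 (displacement_fixed fx) displacement_ge0.
have e1 : 'D_1 (fun z : R => S (x + z *: v)) 0 = 0 by exact: derive_val.
by have := @derive_val _ _ _ _ _ _ _ dl; rewrite e1.
Qed.

End Displacement.

(** * The moving frame of the curve *)

Section NormalCoordinates.
Context {R : realType}.
Variables (M : set (R * R)) (h : R * R -> R * R) (L : R) (f : R -> R * R).
Hypothesis normal_h : unit_normal_field M h.
Hypothesis param_f : closed_param M L f.

Definition normal_along (y : R) : R * R := h (f y).
(** The coordinate of f' along the clockwise rotation of n. Its sign tells the orientation of the
    parametrization relative to [h], and its absolute value is the arc-length density. *)
Definition speed (y : R) : R :=
  (derive1 f y).1 * (normal_along y).2 - (derive1 f y).2 * (normal_along y).1.

Local Notation n := normal_along.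

Let L0 : 0 < L. Proof. by have [[? _ _] _] := param_f. Qed.
Let smooth_f : smooth f. Proof. by have [[_ ? _] _] := param_f. Qed.

Lemma param_periodic (m : int) y : f (y + m%:~R * L) = f y.
Proof.
have [_ [fL _ _]] := param_f.
have natE (k : nat) u : f (u + k%:R * L) = f u.
  elim: k => [|k IH]; first by rewrite mul0r addr0.
  by rewrite -natr1 mulrDl mul1r addrA fL.
case: m => k; first exact: natE.
have e := natE k.+1 (y - k.+1%:R * L); rewrite subrK in e.
by rewrite NegzE mulrNz mulNr; exact: esym e.
Qed.

Lemma param_reduce y : exists2 m : int, 0 <= y + m%:~R * L < L & f (y + m%:~R * L) = f y.
Proof.
exists (- Num.floor (y / L)); last exact: param_periodic.
have yE : y = y / L * L by rewrite mulfVK // gt_eqF.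
have := floor_itv (y / L) => /andP[h1 h2].
have -> : y + (- Num.floor (y / L))%:~R * L = (y / L - (Num.floor (y / L))%:~R) * L.
  by rewrite mulrNz mulNr mulrBl -yE.
apply/andP; split.
  by rewrite mulr_ge0 ?subr_ge0 // ltW.
by rewrite -ltr_pdivlMr // divff ?gt_eqF // ltrBlDr addrC -intrD1.
Qed.

Lemma param_in y : M (f y).
Proof.
have [m /andP[y0 yL] <-] := param_reduce y; have [_ [_ _ <-]] := param_f.
by exists (y + m%:~R * L) => //=; rewrite in_itv /= y0 ltW.
Qed.

Lemma param_surj x : M x -> exists2 y : R, 0 <= y < L & f y = x.
Proof.
have [_ [fL _ <-]] := param_f => -[y /=]; rewrite in_itv /= => /andP[y0 yL] <-.
have [yL'|yL'] := ltP y L; first by exists y; rewrite ?y0.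
have -> : y = 0 + L by rewrite add0r; apply/eqP; rewrite eq_le yL yL'.
by exists 0; rewrite ?lexx.
Qed.

Lemma param_inj (y y' : R) : 0 <= y < L -> 0 <= y' < L -> f y = f y' -> y = y'.
Proof.
have [_ [_ fi _]] := param_f => yL yL'; by apply: fi; rewrite in_itv.
Qed.

Lemma param_periodL y : f (y + L) = f y. Proof. by have [_ []] := param_f. Qed.

Lemma smooth_normal_along : smooth n.
Proof.
move=> k; apply: Cn_on_local => y _.
have [U [g [oU Uy sg gh]]] := normal_h.1 _ (param_in y).
pose A := f @^-1` U.
have cf : continuous f by move=> u; exact: (Cn_on_continuous (smooth_f 0%N)).
have oA : open A by apply: open_comp => // u _; exact: cf.
exists A; split => //.
have cA : Cn_on k A f by apply: Cn_onS (smooth_f k).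
apply: (eq_Cn_on oA (f := fun u => g (f u))).
  by move=> u Au; rewrite /n gh //; exact: param_in.
exact: (Cn_comp_plane2 oA oU _ cA (sg k)).
Qed.

Lemma tangent_param y : tangent M (f y) (derive1 f y).
Proof.
exists (fun t => f (y + t)); split.
- move=> k; have oT : open [set: R] by exact: openT.
  apply: (@Cn_comp_line2 _ _ k setT setT (fun t => y + t) f oT oT) => //.
  by apply: Cn_add => //; [exact: Cn_cst|exact: Cn_id].
- by rewrite addr0.
- by near=> t; exact: param_in.
- rewrite !derive1E.
  have ds (t : R) : is_derive t 1 (fun t : R => y + t) 1.
    by have := is_deriveD (is_derive_cst y t 1) (is_derive_id t 1); rewrite add0r.
  have df : differentiable f (y + 0) by have [H _] := smooth_f 1%N; exact: H.
  have d1 := ds 0; have dd := is_derive_differentiable d1.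
  rewrite (derive_compE (1 : R) dd df) (derive_lineE _ df).
  have -> : 'D_1 (fun t : R => y + t) 0 = 1 by exact: derive_val.
  by rewrite scale1r addr0.
Unshelve. all: by end_near. Qed.

Lemma normal_along_unit y : dot (n y) (n y) = 1.
Proof. by apply/enorm1P; have [] := normal_h.2 _ (param_in y). Qed.

Lemma normal_along_tangent y : dot (n y) (derive1 f y) = 0.
Proof. by have [_] := normal_h.2 _ (param_in y); apply; exact: tangent_param. Qed.

Lemma param_derivative y : derive1 f y = (speed y * (n y).2, - (speed y * (n y).1)).
Proof.
rewrite /speed; have := normal_along_unit y; have := normal_along_tangent y.
case: (derive1 f y) => a b; case: (n y) => c d; rewrite /dot /= => e1 e2.
have ca : c * a = - (d * b) by lra.
congr (_, _).
  by rewrite (_ : _ * d = a * (d * d) - c * (d * b)); [rewrite -(opprK (d * b)) -ca -[LHS]mulr1 -e2; ring|ring].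
by rewrite (_ : - _ = b * (c * c) - d * (c * a)); [rewrite ca -[LHS]mulr1 -e2; ring|ring].
Qed.

Let df (y : R) : differentiable f y.
Proof. by have [+ _] := smooth_f 1%N; exact. Qed.

Let dn (y : R) : differentiable n y.
Proof. by have [+ _] := smooth_normal_along 1; exact. Qed.

Let smooth_Df : smooth (fun y : R => 'D_1 f y).
Proof. by move=> k; have [_] := smooth_f k.+1; exact. Qed.

Let dDf (y : R) : differentiable (fun y : R => 'D_1 f y) y.
Proof. by have [+ _] := smooth_Df 1%N; exact. Qed.

Lemma is_derive_fst_snd (u : R -> R * R) (y : R) : differentiable u y ->
  is_derive y 1 (fun y => (u y).1) ('D_1 u y).1 /\ is_derive y 1 (fun y => (u y).2) ('D_1 u y).2.
Proof.
move=> du; rewrite -(derive_fst _ du) -(derive_snd _ du); split; apply: differentiable_is_derive.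
  exact: (differentiable_comp du (differentiable_fst (u y))).
exact: (differentiable_comp du (differentiable_snd (u y))).
Qed.

Lemma is_derive_dot (u v : R -> R * R) (y : R) : differentiable u y -> differentiable v y ->
  is_derive y 1 (fun y => dot (u y) (v y)) (dot ('D_1 u y) (v y) + dot (u y) ('D_1 v y)).
Proof.
move=> du dv; have [u1 u2] := is_derive_fst_snd du; have [v1 v2] := is_derive_fst_snd dv.
have d := is_deriveD (is_deriveM u1 v1) (is_deriveM u2 v2).
have -> : dot ('D_1 u y) (v y) + dot (u y) ('D_1 v y) =
    (u y).1 *: ('D_1 v y).1 + (v y).1 *: ('D_1 u y).1 +
    ((u y).2 *: ('D_1 v y).2 + (v y).2 *: ('D_1 u y).2).
  rewrite /dot /GRing.scale /=.
  move: (u y) (v y) ('D_1 u y) ('D_1 v y) => [a b] [a' b'] [c e] [c' e'] /=.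
  ring.
exact: d.
Qed.

Lemma speed_sqr y : speed y ^+ 2 = dot (derive1 f y) (derive1 f y).
Proof.
rewrite param_derivative /dot /=; have := normal_along_unit y; rewrite /dot => e.
by rewrite -[LHS]mulr1 -e; ring.
Qed.

Lemma speed_neq0 y : speed y != 0.
Proof.
apply/negP => /eqP s0; have [[_ _ H] _] := param_f; apply: (H y).
by rewrite param_derivative s0 !mul0r oppr0.
Qed.

Lemma normr_speed y : `|speed y| = enorm (derive1 f y).
Proof. by rewrite /enorm -speed_sqr sqrtr_sqr. Qed.

Lemma curvatureE y : curvature h f y = dot ('D_1 (fun y : R => 'D_1 f y) y) (n y) / speed y ^+ 2.
Proof.
rewrite /curvature enorm_sqr -(speed_sqr y) -[h (f y)]/(n y).
have E1 : derive1 f = (fun y : R => 'D_1 f y) by apply/funext => u; exact: derive1E.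
have -> : derive1n 2 f y = 'D_1 (fun y : R => 'D_1 f y) y; last by [].
by rewrite -E1 -derive1E.
Qed.

Lemma derive_param y : 'D_1 f y = (- speed y) *: rot90 (n y).
Proof.
rewrite -derive1E param_derivative; move: (speed y) (n y) => a [b c].
by rewrite /rot90 /=; congr (_, _); rewrite /GRing.scale /=; ring.
Qed.

(** Differentiating n . n = 1 shows that n' is tangent to the curve; differentiating n . f' = 0
    expresses its size through f''. *)
Lemma normal_along_derivative y : 'D_1 n y = (curvature h f y * speed y) *: rot90 (n y).
Proof.
have nn : dot (n y) ('D_1 n y) = 0.
  have := is_derive_dot (dn y) (dn y).
  rewrite (_ : (fun y => dot (n y) (n y)) = cst 1); last by apply/funext => u; rewrite normal_along_unit.
  move=> d; have /esym/eqP := @derive_val _ _ _ _ _ _ _ d.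
  by rewrite derive_cst dotC -mulr2n mulrn_eq0 => /eqP.
rewrite (normal_decomposition (normal_along_unit y) nn); congr (_ *: _).
have nf : dot ('D_1 n y) ('D_1 f y) = - dot (n y) ('D_1 (fun y : R => 'D_1 f y) y).
  have := is_derive_dot (dn y) (dDf y).
  rewrite (_ : (fun y : R => dot (n y) ('D_1 f y)) = cst 0); last first.
    by apply/funext => u; rewrite -derive1E normal_along_tangent.
  move=> d; have /esym/eqP := @derive_val _ _ _ _ _ _ _ d.
  by rewrite derive_cst addr_eq0 => /eqP.
move: nf; rewrite derive_param dotZr curvatureE [in RHS]dotC.
have s0 := speed_neq0 y; rewrite mulNr => /oppr_inj <-.
by rewrite expr2; field.
Qed.

Lemma param_derivatives (y : R) :
  [/\ is_derive y 1 (fun y => (f y).1) (speed y * (n y).2),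
      is_derive y 1 (fun y => (f y).2) (- (speed y * (n y).1)),
      is_derive y 1 (fun y => (n y).1) (- (curvature h f y * (speed y * (n y).2))) &
      is_derive y 1 (fun y => (n y).2) (curvature h f y * (speed y * (n y).1))].
Proof.
have [f1 f2] := is_derive_fst_snd (df y); have [n1 n2] := is_derive_fst_snd (dn y).
rewrite -derive1E param_derivative /= in f1 f2.
rewrite normal_along_derivative /rot90 /= /GRing.scale /= in n1 n2.
split => //; first by rewrite mulrA -mulrN.
by rewrite mulrA.
Qed.

(* The right-hand side does not involve the parametrization, whence a
   curvature function on the curve itself. *)
Lemma curvature_intrinsic y (U : set (R * R)) (g : R * R -> R * R) :
  open U -> U (f y) -> smooth_on U g -> (forall u, U u -> M u -> g u = h u) ->
  curvature h f y = - dot ('D_(rot90 (h (f y))) g (f y)) (rot90 (h (f y))).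
Proof.
move=> oU Uy sg gh.
have dg : differentiable g (f y) by have [+ _] := sg 1%N; exact.
have nE : 'D_1 n y = 'D_1 (fun u : R => g (f u)) y.
  apply: near_eq_derive.
  have cf : {for y, continuous f} := Cn_on_continuous (smooth_f 0%N) I.
  have /cf : nbhs (f y) U by exact: open_nbhs_nbhs.
  rewrite nbhs_simpl /= => H; near=> u; have Uu : U (f u) by near: u.
  by rewrite gh //; exact: param_in.
rewrite (derive_compE (1 : R) (df y) dg) in nE.
have DE : 'D_((- speed y) *: rot90 (n y)) g (f y) = (- speed y) *: 'D_(rot90 (n y)) g (f y).
  by rewrite !deriveE // linearZ.
rewrite derive_param DE normal_along_derivative in nE.
have rr : dot (rot90 (n y)) (rot90 (n y)) = 1.
  by have := normal_along_unit y; rewrite /rot90 /dot /= => <-; ring.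
have := congr1 (fun u => dot u (rot90 (n y))) nE; rewrite !dotZl rr mulr1 mulNr -mulrN mulrC.
by move/(mulfI (speed_neq0 y)).
Unshelve. all: by end_near. Qed.

Lemma continuous_param : continuous f.
Proof. by move=> y; exact: differentiable_continuous. Qed.

Lemma continuous_normal_along : continuous n.
Proof. by move=> y; exact: differentiable_continuous. Qed.

Lemma continuous_speed : continuous speed.
Proof.
move=> y; have cD : {for y, continuous (fun y : R => 'D_1 f y)} by exact: differentiable_continuous.
have E : speed = fun y => ('D_1 f y).1 * (n y).2 - ('D_1 f y).2 * (n y).1.
  by apply/funext => u; rewrite /speed derive1E.
have cn := @continuous_normal_along y.
have a1 : {for y, continuous (fun y : R => ('D_1 f y).1)} := continuous_comp cD (@continuous_fst _ _ _).
have a2 : {for y, continuous (fun y : R => ('D_1 f y).2)} := continuous_comp cD (@continuous_snd _ _ _).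
have b1 : {for y, continuous (fun y : R => (n y).1)} := continuous_comp cn (@continuous_fst _ _ _).
have b2 : {for y, continuous (fun y : R => (n y).2)} := continuous_comp cn (@continuous_snd _ _ _).
rewrite E; exact: (continuousB (continuousM a1 b2) (continuousM a2 b1)).
Qed.

Lemma continuous_curvature : continuous (curvature h f).
Proof.
move=> y.
have cD : {for y, continuous (fun y : R => 'D_1 (fun y : R => 'D_1 f y) y)}.
  have [_ /(_ (1 : R)) sD] := smooth_Df 1%N; exact: (sD y I).
have -> : curvature h f = fun y => dot ('D_1 (fun y : R => 'D_1 f y) y) (n y) / speed y ^+ 2.
  by apply/funext => u; exact: curvatureE.
have cn := @continuous_normal_along y; have cs := @continuous_speed y.
have a1 := continuous_comp cD (@continuous_fst _ _ _).
have a2 := continuous_comp cD (@continuous_snd _ _ _).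
have b1 := continuous_comp cn (@continuous_fst _ _ _).
have b2 := continuous_comp cn (@continuous_snd _ _ _).
have cd := continuousD (continuousM a1 b1) (continuousM a2 b2).
apply: (continuousM cd); apply: continuousV; first by rewrite sqrf_eq0 speed_neq0.
exact: (continuousM cs cs).
Qed.

End NormalCoordinates.

(** * Injectivity of the normal coordinates and covering by the tube *)

Section TubeGeometry.
Context {R : realType}.
Variables (M : set (R * R)) (h : R * R -> R * R) (L : R) (f : R -> R * R).
Hypothesis normal_h : unit_normal_field M h.
Hypothesis param_f : closed_param M L f.

Local Notation n := (normal_along h f).
Local Notation speed := (speed h f).
Local Notation kap := (curvature h f).

Let L0 : 0 < L. Proof. by have [[? _ _] _] := param_f. Qed.

Lemma curvature_eq (L' : R) f' y y' : closed_param M L' f' -> f y = f' y' ->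
  curvature h f y = curvature h f' y'.
Proof.
move=> pf' fy; have [U [g [oU Uy sg gh]]] := normal_h.1 _ (param_in param_f y).
have Uy' : U (f' y') by rewrite -fy.
by rewrite (curvature_intrinsic normal_h param_f oU Uy sg gh) fy (curvature_intrinsic normal_h pf' oU Uy' sg gh).
Qed.

Lemma param_max (u : R -> R) : continuous u -> (forall y y', f y = f y' -> u y = u y') ->
  exists y0, forall y, u y <= u y0.
Proof.
move=> cu fu; have [y0 _ y0P] := EVT_max (ltW L0) (continuous_subspaceT cu).
exists y0 => y; have [m /andP[m0 mL] fm] := param_reduce param_f y.
by rewrite -(fu _ _ fm); apply: y0P; rewrite in_itv /= m0 ltW.
Qed.

Lemma tube_frame_exists : exists2 e0, 0 < e0 & forall e, 0 < e <= e0 ->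
  tube_frame (fun y => (f y).1) (fun y => (f y).2) (fun y => (n y).1) (fun y => (n y).2) speed kap e.
Proof.
have ck := continuous_curvature normal_h param_f.
have [y0 y0P] : exists y0, forall y, `|kap y| <= `|kap y0|.
  apply: (@param_max (fun y => `|kap y|)) => [y|y y' fy]; first by apply: cvg_norm; exact: ck.
  by rewrite (curvature_eq param_f fy).
pose B := 1 + `|kap y0|; have B0 : 0 < B by rewrite /B ltr_wpDr.
exists (1 / 2 / B); first by rewrite !divr_gt0.
move=> e /andP[e0 eB]; split.
  have pd y := param_derivatives normal_h param_f y.
  by split => y; have [] := pd y.
split => //.
- by move=> y; have := normal_along_unit normal_h param_f y; rewrite /dot !expr2.
- exact: (continuous_speed normal_h param_f).
- by move=> y; exact: (speed_neq0 normal_h param_f).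
- split => // y; rewrite ler_pdivlMr // in eB; apply: le_trans eB.
  by rewrite ler_pM2l // (le_trans (y0P y)) // lerDr.
Qed.

Lemma tube_mapE y z : tube_map (fun y => (f y).1) (fun y => (f y).2) (fun y => (n y).1) (fun y => (n y).2) y z =
  f y + z *: n y.
Proof. by []. Qed.

(** With z fixed, take the component [psi u] of f u + z n u along the tangent at y'. Its derivative
    contains the factors speed, 1 - z kap and n u . n y', none of which vanishes near a. Equality of
    the two points gives psi y = psi y', because n y' is orthogonal to this tangent. *)
Lemma tube_local_inj (e : R) (a : R) : (forall y, e * `|kap y| <= 1 / 2) ->
  exists2 d, 0 < d & forall y y' z z' : R, `|y - a| < d -> `|y' - a| < d -> `|z| <= e ->
    f y + z *: n y = f y' + z' *: n y' -> y = y'.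
Proof.
move=> ek; have cn := continuous_normal_along normal_h param_f.
have nn : \forall d \near (0 : R)^'+, 0 < d /\ forall u v : R, `|u - a| < d -> `|v - a| < d -> 0 < dot (n u) (n v).
  have cd : {for (a, a), continuous (fun p : R * R => dot (n p.1) (n p.2))}.
    have c1 : {for (a, a), continuous (fun p : R * R => n p.1)}.
      by apply: continuous_comp; [exact: continuous_fst|exact: cn].
    have c2 : {for (a, a), continuous (fun p : R * R => n p.2)}.
      by apply: continuous_comp; [exact: continuous_snd|exact: cn].
    have a1 := continuous_comp c1 (@continuous_fst _ _ _).
    have a2 := continuous_comp c1 (@continuous_snd _ _ _).
    have b1 := continuous_comp c2 (@continuous_fst _ _ _).
    have b2 := continuous_comp c2 (@continuous_snd _ _ _).
    exact: (continuousD (continuousM a1 b1) (continuousM a2 b2)).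
  have /cd : nbhs (dot (n a) (n a)) [set y : R | 0 < y].
    apply: open_nbhs_nbhs; split; first exact: open_gt.
    by rewrite /= (normal_along_unit normal_h param_f).
  rewrite nbhs_simpl /= => -[] [A B] /= [/nbhs_ballP [dA /= dA0 hA] /nbhs_ballP [dB /= dB0 hB]] AB.
  near=> d; split; first by near: d; exact: nbhs_right_gt.
  have d1 : d < dA by near: d; exact: nbhs_right_lt.
  have d2 : d < dB by near: d; exact: nbhs_right_lt.
  move=> u v ua va; apply: (AB (u, v)); split => /=.
    by apply: hA; rewrite /ball /= distrC; exact: lt_trans ua _.
  by apply: hB; rewrite /ball /= distrC; exact: lt_trans va _.
have [d [d0 dP]] := filter_ex nn; exists d => // y y' z z' ya y'a ze eq.
apply/eqP/negP => /negP nyy.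
pose T := rot90 (n y').
pose psi (u : R) := dot (f u) T + z * dot (n u) T.
have dpsi (u : R) : is_derive u 1 psi (- (speed u * (1 - z * kap u) * dot (n u) (n y'))).
  have [f1 f2 n1 n2] := param_derivatives normal_h param_f u.
  rewrite /psi /dot; apply: is_derive_eq.
  by rewrite /T /rot90 /GRing.scale /=; ring.
have psiE : psi y = psi y'.
  have := congr1 (fun x => dot x T) eq; rewrite !dotDl !dotZl.
  have -> : dot (n y') T = 0 by rewrite /T /rot90 /dot /=; ring.
  rewrite /psi; have -> : dot (n y') T = 0 by rewrite /T /rot90 /dot /=; ring.
  by rewrite !mulr0.
have cpsi : continuous psi.
  by move=> u; have du := dpsi u; exact: differentiable_continuous (is_derive_differentiable du).
have mid (u : R) : `|u - a| < d -> speed u * (1 - z * kap u) * dot (n u) (n y') != 0.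
  move=> ua; rewrite !mulf_neq0 ?(speed_neq0 normal_h param_f) //; last by rewrite gt_eqF // dP.
  have : `|z * kap u| <= 1 / 2.
    by rewrite normrM; apply: le_trans (ek u); exact: ler_wpM2r.
  rewrite ler_norml => /andP[_ zk]; rewrite gt_eqF //; lra.
have key (u v : R) : `|u - a| < d -> `|v - a| < d -> u < v -> psi u = psi v -> False.
  move=> ua va uv e1; have [w wuv e2] := MVT uv (fun w _ => dpsi w) (continuous_subspaceT cpsi).
  have wa : `|w - a| < d.
    by move: ua va wuv; rewrite !ltr_distl in_itv /=; lra.
  move: e2; rewrite e1 subrr mulNr => /esym/eqP; rewrite oppr_eq0 mulf_eq0 (negbTE (mid w wa)) /=.
  by rewrite subr_eq0 gt_eqF.
by move: nyy; rewrite neq_lt => /orP[yy|yy]; [exact: (key y y')|exact: (key y' y)].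
Unshelve. all: by end_near. Qed.

Let near_pair (a b d : R) : 0 < d -> \forall p \near (a, b), `|p.1 - a| < d /\ `|p.2 - b| < d.
Proof.
move=> d0; exists (ball a d, ball b d); first by split; exact: nbhsx_ballx.
by move=> p [] /=; rewrite /ball /= !(distrC _ p.1) !(distrC _ p.2).
Qed.

Let near_dist (V : normedModType R) (u : R -> V) (a e : R) : {for a, continuous u} -> 0 < e ->
  exists2 d, 0 < d & forall y, `|y - a| < d -> `|u y - u a| < e.
Proof.
move=> /cvgrPdist_lt cu e0; have /nbhs_ballP [d /= d0 dP] := cu _ e0.
by exists d => // y ya; rewrite distrC; apply: dP; rewrite /ball /= distrC.
Qed.

Let scale_normal (y z : R) : `|z *: n y| <= `|z|.
Proof.
rewrite normrZ ler_piMr // prod_normE ge_max.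
have := normal_along_unit normal_h param_f y; rewrite /dot -!expr2 => e.
have sq (a b : R) : a ^+ 2 + b ^+ 2 = 1 -> `|a| <= 1.
  move=> ab; rewrite -(@ler_pXn2r _ 2) ?nnegrE // expr1n -normrX ger0_norm ?sqr_ge0 //.
  by have := sqr_ge0 b; lra.
by apply/andP; split; [exact: sq e|rewrite addrC in e; exact: sq e].
Qed.

(** Compactness of the square of parameters. Near a pair with f a <> f b, short normals cannot
    bridge the distance; near a pair over the same point, local injectivity applies. *)
Lemma tube_injective (e : R) : 0 < e -> (forall y, e * `|kap y| <= 1 / 2) ->
  exists2 e', 0 < e' <= e & forall y y' z z' : R, 0 <= y < L -> 0 <= y' < L -> `|z| < e' -> `|z'| < e' ->
    f y + z *: n y = f y' + z' *: n y' -> y = y'.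
Proof.
move=> e0 ek; have cf := continuous_param param_f.
pose P (d : R) (p : R * R) := 0 <= p.1 < L -> 0 <= p.2 < L -> forall z z' : R, `|z| < d -> `|z'| < d ->
    f p.1 + z *: n p.1 = f p.2 + z' *: n p.2 -> p.1 = p.2.
have /compact_near_coveringP cK := compact_setX (@segment_compact R 0 L) (@segment_compact R 0 L).
have nP : \forall d \near (0 : R)^'+, (`[0, L] `*` `[0, L])%classic `<=` P d.
  apply: cK => -[a b] /= [aL bL]; rewrite /= !in_itv /= in aL bL.
  have [fab|fab] := eqVneq (f a) (f b); last first.
    pose e1 := `|f a - f b|; have e10 : 0 < e1 by rewrite normr_gt0 subr_eq0.
    have e14 : 0 < e1 / 4 by rewrite divr_gt0.
    have [da da0 daP] := near_dist (cf a) e14; have [db db0 dbP] := near_dist (cf b) e14.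
    near=> p d => /= p1L p2L z z' zd z'd eq; exfalso.
    have [p1 _] : `|p.1 - a| < da /\ `|p.2 - b| < da by near: p; exact: near_pair.
    have [_ p2] : `|p.1 - a| < db /\ `|p.2 - b| < db by near: p; exact: near_pair.
    have d8 : d < e1 / 8 by near: d; apply: nbhs_right_lt; rewrite divr_gt0.
    have E : f a - f b = (f a - f p.1) + (z' *: n p.2 - z *: n p.1) + (f p.2 - f b).
      rewrite -(addrK (z *: n p.1) (f p.1)) eq !opprD !opprK.
      by rewrite !addrA; ring.
    have : e1 < e1 / 4 + (d + d) + e1 / 4.
      rewrite {1}/e1 E; apply: le_lt_trans (ler_normD _ _) _; apply: ltrD; last exact: dbP.
      apply: le_lt_trans (ler_normD _ _) _; apply: ltrD; first by rewrite distrC; exact: daP.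
      apply: le_lt_trans (ler_normB _ _) _.
      by apply: ltrD; apply: le_lt_trans (scale_normal _ _) _.
    lra.
  have ekL (u : R) : f (u - L) = f u by rewrite -(param_periodL param_f) subrK.
  have nkL (u : R) : n (u - L) = n u by rewrite /normal_along ekL.
  have [dl dl0 dlP] := tube_local_inj a ek; have [d2 d20 d2P] := tube_local_inj b ek.
  (* Parameters over the same point agree up to one period. Across the seam, shifting one of them by
     L brings both near a single point, and their resulting equality contradicts that both lie in
     [[0, L[]. *)
  have [ab|[ab|ab]] : a = b \/ (b = a + L \/ a = b + L).
    have f0L : f L = f 0 by rewrite -(param_periodL param_f 0) add0r.
    have [aL'|aL'] := ltP a L; have [bL'|bL'] := ltP b L.
    - by left; apply: (param_inj param_f) => //; lra.
    - have bE : b = L by lra.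
      right; left; rewrite (_ : a = 0) ?add0r //; apply: (param_inj param_f); rewrite ?lexx ?L0 //; first lra.
      by rewrite fab bE.
    - have aE : a = L by lra.
      right; right; rewrite (_ : b = 0) ?add0r //; apply: (param_inj param_f); rewrite ?lexx ?L0 //; first lra.
      by rewrite -fab aE.
    - by left; lra.
  - near=> p d => /= p1L p2L z z' zd z'd eq.
    have [p1 p2] : `|p.1 - a| < dl /\ `|p.2 - b| < dl by near: p; exact: near_pair.
    rewrite -ab in p2; apply: (dlP _ _ z z' p1 p2) => //.
    by apply: le_trans (ltW zd) _; near: d; exact: nbhs_right_le.
  - near=> p d => /= p1L p2L z z' zd z'd eq.
    have [p1 p2] : `|p.1 - a| < dl /\ `|p.2 - b| < dl by near: p; exact: near_pair.
    have p2' : `|p.2 - L - a| < dl by rewrite -addrA -opprD (addrC L) -ab.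
    have zd' : `|z| <= e by apply: le_trans (ltW zd) _; near: d; exact: nbhs_right_le.
    have := dlP _ _ z z' p1 p2' zd'; rewrite ekL nkL => /(_ eq); lra.
  - near=> p d => /= p1L p2L z z' zd z'd eq.
    have [p1 p2] : `|p.1 - a| < d2 /\ `|p.2 - b| < d2 by near: p; exact: near_pair.
    have p1' : `|p.1 - L - b| < d2 by rewrite -addrA -opprD (addrC L) -ab.
    have zd' : `|z| <= e by apply: le_trans (ltW zd) _; near: d; exact: nbhs_right_le.
    have := d2P _ _ z z' p1' p2 zd'; rewrite ekL nkL => /(_ eq); lra.
have [d [[d0 de] dP]] : exists d : R, (0 < d /\ d <= e) /\ (`[0, L] `*` `[0, L])%classic `<=` P d.
  have : \forall d \near (0 : R)^'+, (0 < d /\ d <= e) /\ (`[0, L] `*` `[0, L])%classic `<=` P d.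
    apply: filterI => //; apply: filterI; first exact: nbhs_right_gt.
    exact: nbhs_right_le.
  by move/filter_ex.
exists d; first by rewrite d0.
move=> y y' z z' yL y'L zd z'd eq.
apply: (dP (y, y') _ yL y'L z z' zd z'd eq).
by split => /=; rewrite in_itv /=; lra.
Unshelve. all: by end_near. Qed.

(** At a point of the curve closest to x, the difference is orthogonal to the tangent, hence a
    multiple of n, and the multiple is the distance up to sign. *)
Lemma nearest_point (d : R) x : 0 < d -> (exists2 m, M m & dot (x - m) (x - m) < d ^+ 2) ->
  exists y z : R, [/\ 0 <= y < L, `|z| < d & x = f y + z *: n y].
Proof.
move=> d0 [m Mm md].
pose u (y : R) := dot (x - f y) (x - f y).
have cf := continuous_param param_f.
have df (y : R) : differentiable f y.
  by have [[_ sf _] _] := param_f; have [+ _] := sf 1%N; exact.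
have du (y : R) : is_derive y 1 u (- (2 * dot (x - f y) (derive1 f y))).
  have [f1 f2] := is_derive_fst_snd (df y); rewrite -derive1E in f1 f2.
  rewrite /u /dot /=; apply: is_derive_eq.
  rewrite /GRing.scale /=; move: (derive1 f y) (f y) => [a b] [a' b'] /=; ring.
have cu : continuous u.
  by move=> y; have d1 := du y; exact: differentiable_continuous (is_derive_differentiable d1).
have [y0 y0P] : exists y0, forall y, - u y <= - u y0.
  apply: (@param_max (fun y => - u y)) => [y|y y' fy]; first by apply: cvgN; exact: cu.
  by rewrite /u fy.
have [k k0L fk] := param_reduce param_f y0.
set y1 := y0 + _ in k0L fk.
have y1P y : u y1 <= u y by rewrite /u fk -/(u y0) -lerN2 y0P.
have crit : dot (x - f y1) (derive1 f y1) = 0.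
  have : is_derive y1 1 u 0.
    apply: (@derive1_at_min R u (y1 - 1) (y1 + 1)); first lra.
    - by move=> t _; have d1 := du t; exact: ex_derive.
    - by rewrite in_itv /=; lra.
    - by move=> t _; exact: y1P.
  move=> H; have e1 := @derive_val _ _ _ _ _ _ _ H; have d1 := du y1.
  by have := @derive_val _ _ _ _ _ _ _ d1; rewrite e1; lra.
have nu := normal_along_unit normal_h param_f y1.
rewrite (param_derivative normal_h param_f) in crit.
have sn := speed_neq0 normal_h param_f y1.
have vE : x - f y1 = dot (x - f y1) (n y1) *: n y1.
  have c0 : (x - f y1).1 * (n y1).2 - (x - f y1).2 * (n y1).1 = 0.
    apply: (mulfI sn); rewrite mulr0 -crit /dot /=; ring.
  move: (x - f y1) (n y1) c0 nu => [a b] [c d'] /=; rewrite /dot /= => c0 nu.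
  congr (_, _); rewrite /GRing.scale /=.
    rewrite -[LHS]mulr1 -nu; have bc : b * c = a * d' by lra.
    by transitivity (a * (c * c) + d' * (b * c)); [rewrite bc; ring|ring].
  rewrite -[LHS]mulr1 -nu; have ad : a * d' = b * c by lra.
  by transitivity (b * (d' * d') + c * (a * d')); [rewrite ad; ring|ring].
exists y1, (dot (x - f y1) (n y1)); split => //; last by rewrite -vE addrC subrK.
have [y2 _ fy2] := param_surj param_f Mm.
have : u y1 < d ^+ 2 by apply: le_lt_trans (y1P y2) _; rewrite /u fy2.
move: vE; set t := dot (x - f y1) (n y1) => vE.
rewrite /u vE dotZl dotZr nu mulr1 -expr2 -(real_normK (num_real t)).
by rewrite ltr_pXn2r ?nnegrE // ltW.
Qed.

End TubeGeometry.

(** * Points of small displacement *)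

Section Support.
Context {R : realType}.
Variable Phi : R * R -> R * R.
Hypothesis smooth_Phi : smooth Phi.

(** On the square of half-side r, which contains the disc left out by the growth condition, argue by
    compactness: points close to a fixed point satisfy the conclusion, and near any other point x
    the displacement exceeds S x / 2. Outside the disc, the growth condition bounds S below by
    [c1]. *)
Lemma displacement_small (p r C d : R) : 0 < p -> 0 < r -> 0 < C -> 0 < d ->
  (forall x, r ^+ 2 / 2 < world_fun x 0 -> C * world_fun x 0 `^ p <= half_sqr_displacement Phi x) ->
  exists2 c, 0 < c & forall x, half_sqr_displacement Phi x < c ->
    exists2 m, fixed_points Phi m & dot (x - m) (x - m) < d ^+ 2.
Proof.
move=> p0 r0 C0 d0 growth.
pose S := half_sqr_displacement Phi.
have cS : continuous S by move=> x; exact: (Cn_on_continuous (smooth_displacement smooth_Phi 0%N) I).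
pose P (c : R) (x : R * R) := S x < c -> exists2 m, fixed_points Phi m & dot (x - m) (x - m) < d ^+ 2.
have /compact_near_coveringP cK := compact_setX (@segment_compact R (- r) r) (@segment_compact R (- r) r).
have nP : \forall c \near (0 : R)^'+, (`[(- r)%R, r] `*` `[(- r)%R, r])%classic `<=` P c.
  suff near_P (x : R * R) : \forall x' \near x & c \near (0 : R)^'+, P c x' by apply: cK => x _; exact: near_P.
  have [fx|nfx] := pselect (fixed_points Phi x).
    have cd : {for x, continuous (fun x' : R * R => dot (x' - x) (x' - x))}.
      have cid : {for x, continuous (fun x' : R * R => x' - x)}.
        by apply: cvgB; [exact: cvg_id|exact: cvg_cst].
      have a1 := continuous_comp cid (@continuous_fst _ _ _).
      have a2 := continuous_comp cid (@continuous_snd _ _ _).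
      exact: (continuousD (continuousM a1 a1) (continuousM a2 a2)).
    have near_x : \forall x' \near x, dot (x' - x) (x' - x) < d ^+ 2.
      apply: (cd [set y : R | y < d ^+ 2]); apply: open_nbhs_nbhs; split; first exact: open_lt.
      by rewrite /= subrr /dot /= mulr0 addr0 exprn_gt0.
    near=> x' c => /= _; exists x => //; near: x'; exact: near_x.
  have Sx := displacement_gt0 nfx.
  have near_x : \forall x' \near x, S x / 2 < S x'.
    apply: (cS x [set y : R | S x / 2 < y]); apply: open_nbhs_nbhs; split; first exact: open_gt.
    by rewrite /= /S; lra.
  near=> x' c => /= Sc; exfalso.
  have h1 : S x / 2 < S x' by near: x'; exact: near_x.
  have h2 : c < S x / 2 by near: c; apply: nbhs_right_lt; rewrite /S; lra.
  lra.
pose c1 := C * (r ^+ 2 / 2) `^ p.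
have c10 : 0 < c1 by rewrite mulr_gt0 // powR_gt0 // divr_gt0 // exprn_gt0.
have [c [[c0 cc1] cP]] : exists c : R, (0 < c /\ c <= c1) /\ (`[(- r)%R, r] `*` `[(- r)%R, r])%classic `<=` P c.
  have : \forall c \near (0 : R)^'+, (0 < c /\ c <= c1) /\ (`[(- r)%R, r] `*` `[(- r)%R, r])%classic `<=` P c.
    by apply: filterI => //; apply: filterI; [exact: nbhs_right_gt|exact: nbhs_right_le].
  by move/filter_ex.
exists c => // x Sx; have [wx|wx] := ltP (r ^+ 2 / 2) (world_fun x 0).
  have r2 : 0 <= r ^+ 2 / 2 by rewrite divr_ge0 // exprn_ge0 // ltW.
  have := growth x wx; have : (r ^+ 2 / 2) `^ p <= world_fun x 0 `^ p.
    by apply: ge0_ler_powR; rewrite ?nnegrE ?(ltW p0) ?(ltW wx) // (le_trans r2 (ltW wx)).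
  rewrite -(ler_pM2l C0); rewrite -/c1; lra.
apply: (cP x) => //.
move: wx; rewrite /world_fun enorm_sqr subr0 ler_pM2r ?invr_gt0 // /dot -!expr2 => wx.
have x1 := sqr_ge0 x.1; have x2 := sqr_ge0 x.2.
have sq (a : R) : a ^+ 2 <= r ^+ 2 -> - r <= a <= r.
  by move=> ar; rewrite -ler_norml -(@ler_pXn2r _ 2) ?nnegrE ?(ltW r0) // -normrX ger0_norm // sqr_ge0.
by split => /=; rewrite in_itv /=; apply: sq; lra.
Unshelve. all: by end_near. Qed.

End Support.

(** * Expansion of the heat trace *)

Section PlaneIntegrability.
Context {R : realType}.
Local Notation mu := (@lebesgue_measure R).
Variable Phi : R * R -> R * R.
Hypothesis smooth_Phi : smooth Phi.
Variables (p r C : R).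
Hypotheses (p0 : 0 < p) (r0 : 0 < r) (C0 : 0 < C).
Hypothesis growth : forall x, r ^+ 2 / 2 < world_fun x 0 ->
  C * world_fun x 0 `^ p <= half_sqr_displacement Phi x.

Local Notation S := (half_sqr_displacement Phi).

(** The majorant is a product of functions of one variable, hence integrable by Tonelli's
    theorem. *)
Lemma exp_displacement_decay (a : R) : 0 < a ->
  exists2 D, 0 <= D & forall x : R * R, expR (- (a * S x)) <= D * ((oneDsqr x.1)^-1 * (oneDsqr x.2)^-1).
Proof.
move=> a0; pose W := 1 + r ^+ 2 / 2.
have W1 : 1 <= W by rewrite /W lerDl divr_ge0 // exprn_ge0 // ltW.
(* With p m >= 2, the term of order m in the exponential series of a C w^p dominates w^2 for w > 1,
   hence the product of the two factors 1 + x_i^2. *)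
pose m := (Num.trunc (2 / p)).+1.
have mp : 2 <= p * m%:R by rewrite mulrC -ler_pdivrMr //; apply: ltW; exact: truncnS_gt.
pose E := m`!%:R / (a * C) ^+ m.
have aC0 : 0 < a * C by exact: mulr_gt0.
have E0 : 0 < E by rewrite divr_gt0 ?ltr0n ?fact_gt0 // exprn_gt0.
exists ((1 + 2 * W) ^+ 2 + 9 * E).
  by apply: addr_ge0; [exact: sqr_ge0|rewrite mulr_ge0 // ltW].
move=> x; have o1 := oneDsqr_ge1 x.1; have o2 := oneDsqr_ge1 x.2.
have o10 : 0 < oneDsqr x.1 by lra.
have o20 : 0 < oneDsqr x.2 by lra.
rewrite -invfM ler_pdivlMr ?mulr_gt0 //.
set w := world_fun x 0.
have wE : 2 * w = x.1 ^+ 2 + x.2 ^+ 2.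
  by rewrite /w /world_fun enorm_sqr subr0 /dot !expr2; field.
have w0 : 0 <= w by have := sqr_ge0 x.1; have := sqr_ge0 x.2; lra.
have q : oneDsqr x.1 * oneDsqr x.2 <= (1 + 2 * w) ^+ 2.
  rewrite wE expr2 /oneDsqr; have x1 := sqr_ge0 x.1; have x2 := sqr_ge0 x.2.
  by apply: ler_pM; lra.
have oo : 0 <= oneDsqr x.1 * oneDsqr x.2 by rewrite mulr_ge0 // ltW.
have S0 := displacement_ge0 Phi x.
have e0 : 0 <= expR (- (a * S x)) := expR_ge0 _.
have eS1 : expR (- (a * S x)) <= 1 by rewrite -expR0 ler_expR oppr_le0 mulr_ge0 // ltW.
have [wW|wW] := leP w W.
  apply: le_trans (_ : 1 * (1 + 2 * W) ^+ 2 <= _); last by rewrite mul1r lerDl mulr_ge0 // ltW.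
  apply: (ler_pM e0 oo eS1).
  by apply: le_trans q _; rewrite lerXn2r ?nnegrE; lra.
have wr : r ^+ 2 / 2 < w by apply: lt_trans wW; rewrite /W ltrDr.
have w1 : 1 < w by exact: le_lt_trans wW.
have Sw := growth wr.
have q9 : oneDsqr x.1 * oneDsqr x.2 <= 9 * w ^+ 2.
  apply: le_trans q _; rewrite (_ : 9 * w ^+ 2 = (3 * w) ^+ 2); last by ring.
  by rewrite lerXn2r ?nnegrE; lra.
have wp : w ^+ 2 <= (w `^ p) ^+ m.
  rewrite -(powR_mulrn m (powR_ge0 w p)) -powRrM -(powR_mulrn 2 w0).
  by apply: ler_powR => //; exact: ltW.
have big : w ^+ 2 / E <= expR (a * S x).
  apply: le_trans (_ : expR (a * C * w `^ p) <= _); last first.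
    by rewrite ler_expR -mulrA ler_pM2l.
  have z0 : 0 <= a * C * w `^ p by rewrite mulr_ge0 ?powR_ge0 // ltW.
  have h := expR_ge1Dxn (Num.trunc (2 / p)) z0; rewrite -/m in h.
  apply: le_trans (_ : (a * C * w `^ p) ^+ m / m`!%:R <= _); last first.
    by apply: le_trans h; rewrite lerDr.
  have -> : (a * C * w `^ p) ^+ m = (a * C) ^+ m * (w `^ p) ^+ m by exact: exprMn.
  rewrite /E invf_div mulrA ler_pM2r ?invr_gt0 ?ltr0n ?fact_gt0 //.
  by rewrite mulrC ler_pM2l ?exprn_gt0.
apply: le_trans (_ : 9 * E <= _); last by rewrite lerDr sqr_ge0.
rewrite expRN mulrC ler_pdivrMr ?expR_gt0 //.
apply: le_trans q9 _; rewrite -mulrA ler_pM2l // mulrC -ler_pdivrMr //.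
Qed.

Lemma continuous_exp_displacement (a : R) : continuous (fun x => expR (- (a * S x))).
Proof.
move=> x; apply: continuous_comp; last exact: continuous_expR.
apply: cvgN; apply: cvgMr.
exact: (Cn_on_continuous (smooth_displacement smooth_Phi 0%N) I).
Qed.

Lemma integrable_exp_displacement (a : R) : 0 < a ->
  (@plane_measure R).-integrable setT (fun x => (expR (- (a * S x)))%:E).
Proof.
move=> a0; have [D D0 DP] := exp_displacement_decay a0.
pose G (x : R * R) : \bar R := ((oneDsqr x.1)^-1 * (oneDsqr x.2)^-1)%:E.
have mG : measurable_fun setT G.
  apply/measurable_EFinP; apply: continuous_measurable_plane => x.
  have c1 := continuous_comp_fst (@continuous_oneDsqrV R) (x := x).
  have c2 := continuous_comp_snd (@continuous_oneDsqrV R) (x := x).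
  exact: (continuousM c1 c2).
have G0 x : (0 <= G x)%E by rewrite lee_fin mulr_ge0 // invr_ge0.
have Gi : (@plane_measure R).-integrable setT G.
  apply/integrableP; split => //.
  under eq_integral => x _ do rewrite gee0_abs //.
  have -> : (\int[@plane_measure R]_x G x = \int[mu]_x \int[mu]_y G (x, y))%E.
    by apply: (fubini_tonelli1 (m1 := mu) (m2 := mu) _ mG) => x; exact: G0.
  rewrite (_ : (fun x => _) = (fun x => pi%:E * ((oneDsqr x)^-1)%:E)%E); last first.
    apply/funext => x; rewrite /G /=.
    under eq_integral => y _ do rewrite EFinM.
    rewrite integralZl //; last exact: integrable_oneDsqrV.
    by rewrite integralT_oneDsqrV muleC.
  rewrite integralZl //; last exact: integrable_oneDsqrV.
  by rewrite integralT_oneDsqrV -EFinM ltry.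
apply: (le_integrable measurableT _ _ (integrableZl measurableT D Gi)).
  by apply/measurable_EFinP; apply: continuous_measurable_plane; exact: continuous_exp_displacement.
move=> x _; rewrite /= lee_fin ger0_norm ?expR_ge0 //.
by apply: le_trans (DP x) _; exact: ler_norm.
Qed.

End PlaneIntegrability.

Lemma continuous_powR (R : realType) (u : R -> R) (a : R) : continuous u -> (forall y, 0 < u y) ->
  continuous (fun y => u y `^ a).
Proof.
move=> cu u0; rewrite (_ : (fun y => u y `^ a) = fun y => expR (a * ln (u y))); last first.
  by apply/funext => y; rewrite /powR gt_eqF.
move=> y; apply: continuous_comp; last exact: continuous_expR.
by apply: cvgMr; apply: continuous_comp; [exact: cu|exact: continuous_ln].
Qed.

Lemma continuous_meval (R : realType) (T : topologicalType) (n : nat) (P : mpoly.mpoly n R) (v : T -> 'I_n -> R) :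
  (forall i, continuous (fun y => v y i)) -> continuous (fun y => mpoly.meval (v y) P).
Proof.
move=> cv y.
rewrite (_ : (fun y => mpoly.meval (v y) P) = fun y => \sum_(m <- mpoly.msupp P) mpoly.mcoeff m P * \prod_(i < n) v y i ^+ mpoly.fun_of_multinom m i).
  apply: cvg_big => [|m _]; first exact: add_continuous.
  apply: cvgMr; apply: cvg_big => [|i _]; first exact: mul_continuous.
  apply: (@cvg_comp _ _ _ (fun u => v u i) (fun a => a ^+ mpoly.fun_of_multinom m i)); first exact: cv.
  exact: exprn_continuous.
by apply/funext => u; rewrite mpoly.mevalE.
Qed.

(** * Uniform bounds on the normal derivatives *)

Section LocalData.
Context {R : realType}.
Variables (Phi h : R * R -> R * R) (L : R) (f : R -> R * R).
Hypothesis smooth_Phi : smooth Phi.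
Local Notation M := (fixed_points Phi).
Hypothesis normal_h : unit_normal_field M h.
Hypothesis param_f : closed_param M L f.
Local Notation S := (half_sqr_displacement Phi).
Local Notation n := (normal_along h f).
Local Notation kap := (curvature h f).
Hypothesis s2_gt0 : forall x, M x -> 0 < normal_derivative h S 2 x.

Definition jet (y : R) (j : nat) : R := normal_derivative h S j (f y).

Let sS := smooth_displacement smooth_Phi.

Lemma jetE y j : jet y j = iter_derive (n y) j S (f y).
Proof. by rewrite /jet /normal_derivative derive1n_line // scale0r addr0. Qed.

Lemma jet0 y : jet y 0 = 0.
Proof. by rewrite jetE /= displacement_fixed //; exact: (param_in param_f). Qed.

Lemma jet1 y : jet y 1 = 0.
Proof. by rewrite jetE /= displacement_derive_fixed //; exact: (param_in param_f). Qed.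

Lemma jet2_gt0 y : 0 < jet y 2.
Proof. exact: (s2_gt0 (param_in param_f y)). Qed.

Lemma continuous_jet j : continuous (fun y => jet y j).
Proof.
move=> y; rewrite (_ : (fun y => jet y j) = fun y => iter_derive (n y) j S (f y)); last first.
  by apply/funext => u; rewrite jetE.
apply: continuous_iter_derive => //; first exact: (continuous_param param_f).
exact: (continuous_normal_along normal_h param_f).
Qed.

Lemma jets_bounded j : exists2 B, 0 <= B & forall y z : R, `|z| <= 1 ->
  `|iter_derive (n y) j S (f y + z *: n y)| <= B.
Proof.
have [[L0 _ _] _] := param_f.
pose u (p : R * R) := `|iter_derive (n p.1) j S (f p.1 + p.2 *: n p.1)|.
have cu : continuous u.
  move=> p; have cn : {for p, continuous (fun p : R * R => n p.1)}.
    apply: continuous_comp; first exact: continuous_fst.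
    exact: (continuous_normal_along normal_h param_f).
  have cf : {for p, continuous (fun p : R * R => f p.1)}.
    apply: continuous_comp; first exact: continuous_fst.
    exact: (continuous_param param_f).
  have cs : {for p, continuous (fun p : R * R => p.2)} by exact: continuous_snd.
  have cx : {for p, continuous (fun p : R * R => f p.1 + p.2 *: n p.1)}.
    exact: (continuousD cf (continuousZ cs cn)).
  apply: cvg_norm; exact: (continuous_iter_derive sS cx cn).
have K0 : (`[0, L] `*` `[(-1 : R), 1])%classic !=set0.
  by exists (0 : R, 0 : R); split; rewrite /= in_itv /=; lra.
have cK := compact_setX (@segment_compact R 0 L) (@segment_compact R (-1) 1).
have [p0 _ p0P] := compact_EVT_max K0 cK (continuous_subspaceT cu).
exists (u p0); first exact: normr_ge0.
move=> y z z1; have [m /andP[m0 mL] fm] := param_reduce param_f y.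
have nm : n (y + m%:~R * L) = n y by rewrite /normal_along fm.
rewrite -fm -nm; apply: (p0P (y + m%:~R * L, z)); rewrite inE; split => /=; rewrite in_itv /=.
  by rewrite m0 ltW.
by rewrite -ler_norml.
Qed.

Lemma uniform_jets (N : nat) : exists B c0, [/\ 0 < B, 0 < c0 & forall y,
  [/\ jet_bound N B (jet y, kap y), c0 <= jet y 2 &
    forall z, `|z| <= 1 -> `|S (f y + z *: n y) - taylor_poly (jet y) N z| <= B * `|z| ^+ N.+3]].
Proof.
have /choice[Bj BjP] : forall j : nat, exists B, 0 <= B /\ forall y z : R, `|z| <= 1 ->
    `|iter_derive (n y) j S (f y + z *: n y)| <= B.
  by move=> j; have [B ? ?] := jets_bounded j; exists B.
have [yk ykP] : exists y0, forall y, `|kap y| <= `|kap y0|.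
  apply: (param_max param_f (u := fun y => `|kap y|)) => [y|y y' fy].
    by apply: cvg_norm; exact: (continuous_curvature normal_h param_f).
  by rewrite (curvature_eq normal_h param_f param_f fy).
have [ys ysP] : exists y0, forall y, - jet y 2 <= - jet y0 2.
  apply: (param_max param_f (u := fun y => - jet y 2)) => [y|y y' fy].
    by apply: cvgN; exact: continuous_jet.
  by rewrite /jet fy.
(* A single bound for the curvature, the jets and the derivative of order N + 3 in the Taylor
   remainder, whence N + 4 summands. *)
pose B := 1 + `|kap yk| + \sum_(j < N.+4) Bj j.
have Bj0 j : 0 <= Bj j by have [] := BjP j.
have BjB j : (j < N.+4)%N -> Bj j <= B.
  move=> jN; rewrite /B (bigD1 (Ordinal jN)) //= addrCA lerDl.
  by rewrite addr_ge0 ?addr_ge0 // sumr_ge0.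
exists B, (jet ys 2); split.
- by rewrite /B ltr_wpDr ?ltr_wpDr // sumr_ge0.
- exact: jet2_gt0.
- move=> y; split.
  + split => /=.
      apply: le_trans (ykP y) _; rewrite /B -addrA addrCA lerDl.
      by rewrite addr_ge0 // sumr_ge0.
    move=> k /andP[_ kN]; have [_ h0] := BjP k; have := h0 y 0.
    rewrite normr0 scale0r addr0 -jetE => /(_ ler01) /le_trans; apply; apply: BjB.
    exact: leqW.
  + by rewrite -lerN2; exact: ysP.
  + move=> z z1; have [_ h0] := BjP N.+3.
    have := taylor_line sS (h0 y) z1.
    have -> : \sum_(i < N.+3) iter_derive (n y) i S (f y) / i`!%:R * z ^+ i = taylor_poly (jet y) N z.
      rewrite 2!big_ord_recl -!jetE jet0 jet1 !mul0r !add0r /taylor_poly.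
      by apply: eq_bigr => i _; rewrite -jetE !lift0.
    move/le_trans; apply; apply: ler_wpM2r; first exact: exprn_ge0.
    exact: BjB.
Qed.

Lemma continuous_local_data i : continuous (fun y => local_data (kap y) (jet y) i).
Proof.
case: i => [|[|j]] y /=.
- exact: (continuous_curvature normal_h param_f).
- exact: (continuous_powR (@continuous_jet 2) jet2_gt0).
- exact: continuous_jet.
Qed.

(** Continuity is read off the polynomial expression of the moment in the local data, each of which
    is continuous along the curve. *)
Lemma continuous_moment k : continuous (fun y => laplace_moment (jet y) (kap y) k.*2).
Proof.
have pi0 : (4 * pi : R) != 0 by rewrite gt_eqF // mulr_gt0 // pi_gt0.
have -> : (fun y => laplace_moment (jet y) (kap y) k.*2) = fun y => (4 * pi) *
    mpoly.meval (fun i : 'I_k.*2.+2 => local_data (kap y) (jet y) i) (@coeff_poly R k).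
  by apply/funext => y; rewrite coeff_polyE ?jet2_gt0 // mulVKf.
move=> y; apply: cvgMr; apply: continuous_meval => i; exact: continuous_local_data.
Qed.

End LocalData.

Section Cutoff.
Context {R : realType}.

(* The truncation has support in the tube, where the change of variables is
   available, and is continuous. *)
Definition cutoff (c tau s : R) : R :=
  Num.max 0 (expR (- (s / (2 * tau ^+ 2))) - expR (- (c / (2 * tau ^+ 2)))).

Lemma cutoff_ge0 c tau s : 0 <= cutoff c tau s.
Proof. by rewrite /cutoff le_max lexx. Qed.

Lemma cutoff_eq0 c tau s : 0 < tau -> c <= s -> cutoff c tau s = 0.
Proof.
move=> t0 cs; apply/eqP; rewrite /cutoff eq_le le_max lexx andbT ge_max lexx /=.
by rewrite subr_le0 ler_expR lerN2 ler_pM2r // invr_gt0 mulr_gt0 // exprn_gt0.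
Qed.

(* The defect is min (exp (- s / (2 tau^2)), exp (- c / (2 tau^2))), at most
   the geometric mean of the two. *)
Lemma cutoff_defect c tau s : 0 < tau <= 1 -> 0 <= s ->
  0 <= expR (- (s / (2 * tau ^+ 2))) - cutoff c tau s <= expR (- (c / (4 * tau ^+ 2))) * expR (- (s / 4)).
Proof.
move=> /andP[t0 t1] s0; have t20 : 0 < tau ^+ 2 by exact: exprn_gt0.
have t21 : tau ^+ 2 <= 1 by rewrite exprn_ile1 // ltW.
have half (x : R) : x / (2 * tau ^+ 2) = x / (4 * tau ^+ 2) + x / (4 * tau ^+ 2).
  by field; rewrite gt_eqF.
have quarter : s / 4 <= s / (4 * tau ^+ 2).
  by rewrite ler_wpM2l // lef_pV2 ?posrE ?mulr_gt0 //; rewrite -[X in _ <= X]mulr1 ler_pM2l.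
have mono (x y : R) : x <= y -> x / (4 * tau ^+ 2) <= y / (4 * tau ^+ 2).
  by move=> xy; rewrite ler_pM2r // invr_gt0 mulr_gt0.
have [cs|sc] := leP c s.
  rewrite cutoff_eq0 // subr0 expR_ge0 /= -expRD ler_expR half.
  by have := mono _ _ cs; lra.
have sc' := mono _ _ (ltW sc).
have -> : cutoff c tau s = expR (- (s / (2 * tau ^+ 2))) - expR (- (c / (2 * tau ^+ 2))).
  rewrite /cutoff; apply/max_idPr; rewrite subr_ge0 ler_expR lerN2 !half; lra.
by rewrite opprB addrC subrK expR_ge0 /= -expRD ler_expR half; lra.
Qed.

(** The term of order m + 1 in the exponential series at x = c / (4 tau^2) bounds exp x from
    below. *)
Lemma flat_exp (c : R) (m : nat) : 0 < c ->
  exists2 C, 0 <= C & forall tau : R, 0 < tau <= 1 -> expR (- (c / (4 * tau ^+ 2))) <= C * tau ^+ m.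
Proof.
move=> c0; pose C := (m.+1)`!%:R * (4 / c) ^+ m.+1.
have C0 : 0 <= C by rewrite mulr_ge0 // exprn_ge0 // divr_ge0 // ltW.
exists C => // tau /andP[t0 t1]; have t20 : 0 < tau ^+ 2 by exact: exprn_gt0.
have x0 : 0 < c / (4 * tau ^+ 2) by rewrite divr_gt0 // mulr_gt0.
have h := expR_ge1Dxn m (ltW x0).
rewrite expRN; set x := c / _ in x0 h *.
have xm : 0 < x ^+ m.+1 / (m.+1)`!%:R by rewrite divr_gt0 ?exprn_gt0 // ltr0n fact_gt0.
apply: le_trans (_ : (x ^+ m.+1 / (m.+1)`!%:R)^-1 <= _).
  rewrite lef_pV2 ?posrE ?expR_gt0 //; apply: le_trans h; by rewrite lerDr.
rewrite invf_div -exprVn /C -mulrA; apply: ler_wpM2l => //.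
have -> : x^-1 = 4 / c * tau ^+ 2 by rewrite /x invf_div mulrAC.
rewrite exprMn; apply: ler_wpM2l; first by rewrite exprn_ge0 // divr_ge0 // ltW.
rewrite -exprM; apply: ler_wiXn2l => //; first exact: ltW.
by rewrite mul2n -addnn addSn ltnW // ltnS leq_addr.
Qed.

Lemma continuous_cutoff c tau : continuous (cutoff c tau).
Proof.
pose d (s : R) := expR (- (s / (2 * tau ^+ 2))) - expR (- (c / (2 * tau ^+ 2))).
have cd : continuous d.
  move=> s; apply: cvgB; last exact: cvg_cst.
  apply: continuous_comp; last exact: continuous_expR.
  by apply: cvgN; apply: cvgMl; exact: cvg_id.
have -> : cutoff c tau = fun s => 2^-1 * (d s + `|d s|).
  apply/funext => s; rewrite /cutoff -/(d s); have [d0|d0] := leP 0 (d s).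
    by rewrite ger0_norm //; field.
  by rewrite ltr0_norm // subrr mulr0.
by move=> s; apply: cvgMr; apply: cvgD; [exact: cd|apply: cvg_norm; exact: cd].
Qed.

End Cutoff.

Lemma sum_even (V : nmodType) (F : nat -> V) K : (forall k, F k.*2.+1 = 0) ->
  \sum_(j < K.*2) F j = \sum_(k < K) F k.*2.
Proof.
move=> F0; elim: K => [|K IH]; first by rewrite !big_ord0.
by rewrite doubleS !big_ord_recr /= IH F0 addr0.
Qed.

(** * Expansion of the plane integral in tau *)

Section Expansion.
Context {R : realType}.
Local Notation mu := (@lebesgue_measure R).
Variables (Phi h : R * R -> R * R) (L : R) (f : R -> R * R).
Hypothesis smooth_Phi : smooth Phi.
Local Notation M := (fixed_points Phi).
Hypothesis normal_h : unit_normal_field M h.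
Hypothesis param_f : closed_param M L f.
Local Notation S := (half_sqr_displacement Phi).
Local Notation n := (normal_along h f).
Local Notation kap := (curvature h f).
Local Notation spd := (speed h f).
Local Notation jet := (jet Phi h f).
Hypothesis s2_gt0 : forall x, M x -> 0 < normal_derivative h S 2 x.
Variables (p r C : R).
Hypotheses (p0 : 0 < p) (r0 : 0 < r) (C0 : 0 < C).
Hypothesis growth : forall x, r ^+ 2 / 2 < world_fun x 0 -> C * world_fun x 0 `^ p <= S x.

Let L0 : 0 < L. Proof. by have [[? _ _] _] := param_f. Qed.
Let cS : continuous S.
Proof. by move=> x; exact: (Cn_on_continuous (smooth_displacement smooth_Phi 0%N) I). Qed.

(** The level [c] is chosen for the tube of radius eps / 2, whereas injectivity holds up to a radius
    of at least 2 eps. A point with height between eps / 2 and eps and S < c would therefore have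
    two distinct sets of normal coordinates. *)
Lemma tube_radius (N : nat) : exists B c0 eps c,
  [/\ 0 <= B, 0 < c0, 0 < eps <= 1, 0 < c & 16 * N.+1%:R * B * eps <= c0] /\
  [/\ tube_frame (fun y => (f y).1) (fun y => (f y).2) (fun y => (n y).1) (fun y => (n y).2) spd kap eps,
      (forall y y' z z' : R, 0 <= y < L -> 0 <= y' < L -> `|z| < eps -> `|z'| < eps ->
         f y + z *: n y = f y' + z' *: n y' -> y = y'),
      (forall x, S x < c -> exists y z : R, [/\ 0 <= y < L, `|z| < eps & x = f y + z *: n y]),
      (forall y z : R, eps / 2 <= `|z| <= eps -> c <= S (f y + z *: n y)) &
      forall y,
      [/\ jet_bound N B (jet y, kap y), c0 <= jet y 2 &
        forall z, `|z| <= 1 -> `|S (f y + z *: n y) - taylor_poly (jet y) N z| <= B * `|z| ^+ N.+3]].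
Proof.
have [B [c0 [B0 c00 BP]]] := uniform_jets smooth_Phi normal_h param_f s2_gt0 N.
have [e0 e00 frame] := tube_frame_exists normal_h param_f.
have e0k y : e0 * `|kap y| <= 1 / 2.
  have e0e : 0 < e0 <= e0 by rewrite e00 lexx.
  by have [_ [_ _ _ _ [_]]] := frame _ e0e.
have [e1 /andP[e10 e1e0] inj] := tube_injective normal_h param_f e00 e0k.
pose e2 := c0 / (16 * N.+1%:R * B).
have NB0 : 0 < 16 * N.+1%:R * B by rewrite !mulr_gt0 // ltr0n.
have e20 : 0 < e2 by rewrite divr_gt0.
pose eps := Num.min 1 (Num.min (e1 / 2) e2).
have eps0 : 0 < eps by rewrite !lt_min ltr01 divr_gt0.
have eps1 : eps <= 1 by rewrite ge_min lexx.
have epse1 : eps <= e1 / 2 by rewrite !ge_min lexx orbT.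
have epse2 : eps <= e2 by rewrite !ge_min lexx !orbT.
have d0 : 0 < eps / 2 by rewrite divr_gt0.
have [c cc0 cP] := displacement_small smooth_Phi p0 r0 C0 d0 growth.
have cover x : S x < c -> exists y z : R, [/\ 0 <= y < L, `|z| < eps / 2 & x = f y + z *: n y].
  by move=> Sx; apply: (nearest_point normal_h param_f d0); exact: cP.
exists B, c0, eps, c; split; first split => //; first exact: ltW.
- by rewrite eps0.
- by move: epse2; rewrite /e2 ler_pdivlMr // mulrC.
split.
- by apply: frame; rewrite eps0 /=; lra.
- by move=> y y' z z' yL y'L ze z'e; apply: inj => //; lra.
- by move=> x /cover [y [z [yL ze xE]]]; exists y, z; split => //; lra.
- move=> y z /andP[z1 z2]; rewrite leNgt; apply/negP => /cover [y' [z' [y'L z'e xE]]].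
  have [m mL fm] := param_reduce param_f y.
  have nm : n (y + m%:~R * L) = n y by rewrite /normal_along fm.
  have eq : f (y + m%:~R * L) + z *: n (y + m%:~R * L) = f y' + z' *: n y' by rewrite fm nm.
  have yy : y + m%:~R * L = y' by apply: (inj _ _ z z') => //; lra.
  move: eq; rewrite yy => /addrI /(congr1 (dot (n y'))).
  rewrite !dotZr (normal_along_unit normal_h param_f) !mulr1 => zz.
  by move: z'e; rewrite -zz; lra.
- exact: BP.
Qed.

Lemma displacement_integral_expansion K : exists2 D, 0 <= D & forall tau, 0 < tau <= 1 ->
  `|\int[@plane_measure R]_x expR (- (S x / (2 * tau ^+ 2))) -
    \sum_(k < K.+1) tau ^+ k.*2.+1 *
      \int[mu]_(y in `[0, L]) (laplace_moment (jet y) (kap y) k.*2 * `|spd y|)| <=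
  D * tau ^+ K.*2.+3.
Proof.
(* The orders 0 to 2 K + 1 are expanded. The odd ones vanish, which leaves K + 1 terms and an error
   of order tau^(2 K + 3). *)
pose N := K.*2.+1.
have [B [c0 [eps [c [[B0 c00 /andP[eps0 eps1] cc0 small] [frame inj cover away jets]]]]]] := tube_radius N.
have [C1 C1P] := laplace_integral B0 eps0 eps1 c00 small.
have [C2 C20 C2P] := flat_exp N.+2 cc0.
pose I0 := \int[@plane_measure R]_x expR (- (4^-1 * S x)).
(* [C1] comes from the Laplace estimate on a normal segment. The truncation costs 3 / 2 for the
   Jacobian factor, times the length 2 eps, times [C2] for the flat exponential. *)
pose D1 := `|C1| + 3 * eps * C2.
pose Ls := \int[mu]_(y in `[0, L]) `|spd y|.
have cspd : continuous spd by exact: (continuous_speed normal_h param_f).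
have I00 : 0 <= I0 by apply: Rintegral_ge0 => x _; exact: expR_ge0.
have Ls0 : 0 <= Ls by apply: Rintegral_ge0.
have D10 : 0 <= D1 by rewrite /D1 addr_ge0 // !mulr_ge0 // ltW.
have mD : measurable (`[0, L]%classic : set (measurableTypeR R)) by exact: measurable_itv.
have mI : measurable (`[(- eps)%R, eps]%classic : set (measurableTypeR R)) by exact: measurable_itv.
have cont_int (u : R -> R) (a b : R) : continuous u -> mu.-integrable `[a, b] (EFin \o u).
  move=> cu; apply: continuous_compact_integrable; first exact: segment_compact.
  exact: continuous_subspaceT.
have cM k : continuous (fun y => laplace_moment (jet y) (kap y) k.*2 * `|spd y|).
  move=> y; apply: cvgM; last by apply: cvg_norm; exact: cspd.
  exact: (continuous_moment smooth_Phi normal_h param_f s2_gt0).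
exists (C2 * I0 + D1 * Ls); first by rewrite addr_ge0 ?mulr_ge0.
move=> tau t01; have /andP[t0 t1] := t01.
have t20 : 0 < 2 * tau ^+ 2 by rewrite mulr_gt0 // exprn_gt0.
set ec := expR (- (c / (4 * tau ^+ 2))).
have ec0 : 0 <= ec by exact: expR_ge0.
have ecC : ec <= C2 * tau ^+ N.+2 by exact: C2P.
pose E x := expR (- (S x / (2 * tau ^+ 2))).
pose g x := cutoff c tau (S x).
have Ei : (@plane_measure R).-integrable setT (EFin \o E).
  have -> : EFin \o E = fun x => (expR (- ((2 * tau ^+ 2)^-1 * S x)))%:E.
    by apply/funext => x; rewrite /= /E mulrC.
  by apply: (integrable_exp_displacement smooth_Phi p0 r0 C0 growth); rewrite invr_gt0.
have I0i : (@plane_measure R).-integrable setT (fun x => (expR (- (4^-1 * S x)))%:E).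
  by apply: (integrable_exp_displacement smooth_Phi p0 r0 C0 growth); rewrite invr_gt0.
have cg : continuous g.
  by move=> x; apply: (@continuous_comp _ _ _ S (cutoff c tau)); [exact: cS|exact: continuous_cutoff].
have g0 x : 0 <= g x by exact: cutoff_ge0.
have gE x : 0 <= E x - g x <= ec * expR (- (4^-1 * S x)).
  by rewrite (mulrC 4^-1); apply: cutoff_defect => //; exact: displacement_ge0.
have gi : (@plane_measure R).-integrable setT (EFin \o g).
  apply: (le_integrable measurableT _ _ Ei).
    by apply/measurable_EFinP; exact: continuous_measurable_plane.
  move=> x _; rewrite /= lee_fin !ger0_norm ?expR_ge0 //.
  by have /andP[] := gE x; rewrite subr_ge0.
(* The truncation removes at most the flat factor [ec] times an integrable function that does not
   depend on tau. *)
have outer : `|\int[@plane_measure R]_x E x - \int[@plane_measure R]_x g x| <= ec * I0.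
  have Egi : (@plane_measure R).-integrable setT (EFin \o (fun x => E x - g x)).
    exact: (integrableB measurableT Ei gi).
  rewrite -RintegralB //; apply: le_trans (le_normr_Rintegral measurableT Egi) _.
  rewrite -RintegralZl //; apply: le_Rintegral => //.
  - exact: (integrable_norm Egi).
  - exact: (integrableZl measurableT ec I0i).
  - by move=> x _; have /andP[h1 h2] := gE x; rewrite ger0_norm.
have cFz y : continuous (fun z : R => f y + z *: n y).
  by move=> z; have d := is_derive_line (f y) (n y) z; exact: differentiable_continuous (is_derive_differentiable d).
have cgz y : continuous (fun z : R => g (f y + z *: n y)).
  by move=> z; apply: (@continuous_comp _ _ _ (fun z : R => f y + z *: n y) g); [exact: cFz|exact: cg].
have cphi y : continuous (fun z : R => S (f y + z *: n y)).
  by move=> z; apply: (@continuous_comp _ _ _ (fun z : R => f y + z *: n y) S); [exact: cFz|exact: cS].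
have cJ y : continuous (fun z : R => 1 - z * kap y).
  by move=> z; apply: cvgB; [exact: cvg_cst|apply: cvgMl; exact: cvg_id].
have cgJ y : continuous (fun z : R => g (f y + z *: n y) * (1 - z * kap y)).
  by move=> z; apply: cvgM; [exact: cgz|exact: cJ].
have cEJ y : continuous (fun z : R => expR (- (S (f y + z *: n y) / (2 * tau ^+ 2))) * (1 - z * kap y)).
  move=> z; apply: cvgM; last exact: cJ.
  apply: continuous_comp; last exact: continuous_expR.
  by apply: cvgN; apply: cvgMl; exact: cphi.
have [_ [_ _ _ _ [_ ek]]] := frame.
have Jz y z : - eps <= z <= eps -> 0 <= 1 - z * kap y <= 3 / 2.
  rewrite -ler_norml => ze; have : `|z * kap y| <= 1 / 2.
    by rewrite normrM; apply: le_trans (ek y); exact: ler_wpM2r.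
  by rewrite ler_norml; lra.
pose Jr y := \int[mu]_(z in `[(- eps)%R, eps]) (g (f y + z *: n y) * (`|spd y| * (1 - z * kap y))).
pose Q y := \sum_(k < K.+1) tau ^+ k.*2.+1 * laplace_moment (jet y) (kap y) k.*2.
(* On a single normal segment, the truncated integrand is compared with the full one ([AG]), and the
   full one with its Laplace sum ([AQ]). *)
have inner y : `|Jr y - Q y * `|spd y| | <= D1 * tau ^+ N.+2 * `|spd y|.
  pose G := \int[mu]_(z in `[(- eps)%R, eps]) (g (f y + z *: n y) * (1 - z * kap y)).
  have -> : Jr y = G * `|spd y|.
    rewrite /G -RintegralZr //; last exact: cont_int.
    by apply: eq_Rintegral => z _; rewrite mulrCA mulrC.
  rewrite -mulrBl normrM normr_id; apply: ler_wpM2r => //.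
  have [jb s2 ty] := jets y.
  pose A := \int[mu]_(z in `[(- eps)%R, eps]) (expR (- (S (f y + z *: n y) / (2 * tau ^+ 2))) * (1 - z * kap y)).
  have AQ : `|A - Q y| <= C1 * tau ^+ N.+2.
    have := C1P _ _ (fun z => S (f y + z *: n y)) tau jb s2 (cphi y) _ t01.
    rewrite -/A (@sum_even _ (fun j => tau ^+ j.+1 * laplace_moment (jet y) (kap y) j) K.+1).
      by apply => z ze; apply: ty; exact: le_trans ze eps1.
    by move=> k; rewrite laplace_moment_odd ?mulr0 // (jet2_gt0 param_f s2_gt0).
  have AG : `|A - G| <= 3 * eps * C2 * tau ^+ N.+2.
    have i1 := cont_int _ (- eps) eps (cEJ y); have i2 := cont_int _ (- eps) eps (cgJ y).
    rewrite -RintegralB //.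
    have i3 : mu.-integrable `[(- eps)%R, eps] (EFin \o (fun z => expR (- (S (f y + z *: n y) / (2 * tau ^+ 2))) * (1 - z * kap y) - g (f y + z *: n y) * (1 - z * kap y))).
      exact: (integrableB mI i1 i2).
    apply: le_trans (le_normr_Rintegral mI i3) _.
    apply: le_trans (_ : \int[mu]_(z in `[(- eps)%R, eps]) (ec * (3 / 2)) <= _).
      apply: le_Rintegral => //.
      - exact: (integrable_norm i3).
      - by apply: (cont_int (cst (ec * (3 / 2)))); exact: cst_continuous.
      - move=> z; rewrite /= in_itv /= => ze; rewrite -mulrBl normrM.
        have /andP[j0 j1] := Jz y z ze; have /andP[h1 h2] := gE (f y + z *: n y).
        rewrite ger0_norm // [X in _ * X]ger0_norm //; apply: ler_pM => //.
        apply: le_trans h2 _; rewrite -[X in _ <= X]mulr1; apply: ler_wpM2l => //.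
        by rewrite -expR0 ler_expR oppr_le0 mulr_ge0 // displacement_ge0.
    have -> : \int[mu]_(z in `[(- eps)%R, eps]) (ec * (3 / 2)) = ec * (3 / 2) * fine (mu `[(- eps)%R, eps]%classic).
      exact: Rintegral_cst.
    have ee : - eps < eps by lra.
    rewrite lebesgue_measure_itv /= lte_fin ee -EFinD /= opprK.
    have -> : ec * (3 / 2) * (eps + eps) = 3 * eps * ec by field.
    rewrite -(mulrA (3 * eps)); apply: ler_wpM2l; last exact: ecC.
    by rewrite mulr_ge0 // ltW.
  have -> : G - Q y = - (A - G) + (A - Q y) by ring.
  apply: le_trans (ler_normD _ _) _; rewrite normrN /D1 mulrDl addrC; apply: lerD => //.
  apply: le_trans AQ _; apply: ler_wpM2r; first by rewrite exprn_ge0 // ltW.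
  exact: ler_norm.
have fiber y : (\int[mu]_(z in `[(- eps)%R, eps])
    (g (tube_map (fun y => (f y).1) (fun y => (f y).2) (fun y => (n y).1) (fun y => (n y).2) y z) *
      (`|spd y| * (1 - z * kap y)))%:E)%E = (Jr y)%:E.
  rewrite /Jr /Rintegral fineK //; apply: integrable_fin_num => //.
  apply: (cont_int (fun z => g (f y + z *: n y) * (`|spd y| * (1 - z * kap y)))) => z.
  by apply: cvgM; [exact: cgz|apply: cvgMr; exact: cJ].
have test : tube_test (fun y => (f y).1) (fun y => (f y).2) (fun y => (n y).1) (fun y => (n y).2) eps g.
  split => // y z ze; rewrite tube_mapE; apply: cutoff_eq0 => //; exact: away.
have mJ : measurable_fun setT Jr.
  apply/measurable_EFinP; have := measurable_tube_fiber frame test.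
  by rewrite (_ : (fun y => _) = EFin \o Jr) //; apply/funext => y; rewrite fiber.
have cQ : continuous (fun y => Q y * `|spd y|).
  have -> : (fun y => Q y * `|spd y|) = fun y => \sum_(k < K.+1) tau ^+ k.*2.+1 * (laplace_moment (jet y) (kap y) k.*2 * `|spd y|).
    by apply/funext => y; rewrite /Q mulr_suml; apply: eq_bigr => k _; rewrite mulrA.
  move=> y; apply: cvg_big => [|k _]; first exact: add_continuous.
  by apply: cvgMr; exact: cM.
have cns : continuous (fun y => `|spd y|) by move=> y; apply: cvg_norm; exact: cspd.
have cH : continuous (fun y => `|Q y * `|spd y| | + D1 * tau ^+ N.+2 * `|spd y|).
  by move=> y; apply: cvgD; [apply: cvg_norm; exact: cQ|apply: cvgMr; exact: cns].
(* [Jr] is dominated by the continuous function that [inner] provides; its measurability was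
   obtained from Tonelli's theorem. *)
have Jri : mu.-integrable `[0, L] (EFin \o Jr).
  apply: (le_integrable mD _ _ (cont_int _ 0 L cH)).
    by apply/measurable_EFinP; exact: measurable_funTS.
  move=> y _; rewrite /= lee_fin; apply: le_trans _ (ler_norm _).
  rewrite -[X in `|X|](subrK (Q y * `|spd y|)); apply: le_trans (ler_normD _ _) _.
  by rewrite addrC lerD2l; exact: inner.
have gJ : \int[@plane_measure R]_x g x = \int[mu]_(y in `[0, L]) Jr y.
  rewrite /Rintegral (tube_integral frame test _ L0); first last.
  - move=> x gx; have [y [z [yL ze ->]]] : exists y z : R, [/\ 0 <= y < L, `|z| < eps & x = f y + z *: n y].
      by apply: cover; rewrite ltNge; apply/negP => cSx; move: gx; rewrite /g cutoff_eq0 // eqxx.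
    by exists y, z.
  - by move=> y y' z z' yL y'L ze z'e; rewrite !tube_mapE; exact: inj.
  by congr fine; apply: eq_integral => y _; rewrite fiber.
have sumE : \sum_(k < K.+1) tau ^+ k.*2.+1 *
      \int[mu]_(y in `[0, L]) (laplace_moment (jet y) (kap y) k.*2 * `|spd y|) =
    \int[mu]_(y in `[0, L]) (Q y * `|spd y|).
  have ci k : mu.-integrable `[0, L] (EFin \o (fun y => laplace_moment (jet y) (kap y) k.*2 * `|spd y|)).
    exact: cont_int.
  have [_ e] := @Rintegral_sum _ _ _ mu `[0, L] K.+1
    (fun k y => tau ^+ k.*2.+1 * (laplace_moment (jet y) (kap y) k.*2 * `|spd y|)) mD
    (fun k _ => integrableZl mD (tau ^+ k.*2.+1) (ci k)).
  transitivity (\sum_(k < K.+1) \int[mu]_(y in `[0, L]) (tau ^+ k.*2.+1 * (laplace_moment (jet y) (kap y) k.*2 * `|spd y|))).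
    by apply: eq_bigr => k _; rewrite RintegralZl.
  rewrite -e; apply: eq_Rintegral => y _; rewrite /Q mulr_suml.
  by apply: eq_bigr => k _; rewrite mulrA.
rewrite sumE.
have Qi := cont_int _ 0 L cQ.
have mid : `|\int[mu]_(y in `[0, L]) Jr y - \int[mu]_(y in `[0, L]) (Q y * `|spd y|)| <= D1 * tau ^+ N.+2 * Ls.
  have i3 : mu.-integrable `[0, L] (EFin \o (fun y => Jr y - Q y * `|spd y|)) by exact: (integrableB mD Jri Qi).
  rewrite -RintegralB //; apply: le_trans (le_normr_Rintegral mD i3) _.
  rewrite -RintegralZl //; last exact: cont_int.
  apply: le_Rintegral => //; first exact: (integrable_norm i3).
  by apply: (cont_int (fun y => D1 * tau ^+ N.+2 * `|spd y|)) => y; apply: cvgMr; exact: cns.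
rewrite -(subrKA (\int[@plane_measure R]_x g x)) {2}gJ.
apply: le_trans (ler_normD _ _) _; rewrite (mulrDl (C2 * I0)); apply: lerD.
  apply: le_trans outer _; rewrite mulrAC; exact: ler_wpM2r.
by apply: le_trans mid _; rewrite mulrAC.
Qed.

End Expansion.

(** * Uniqueness of the coefficients *)

Section Uniqueness.
Context {R : realType}.

(** At the first index where the coefficients differ, by d in absolute value, the two estimates give
    d <= (D + D') tau^2, which fails for small tau. *)
Lemma odd_expansion_unique (G : R -> R) (A A' : nat -> R) :
  (forall K, exists2 D, 0 <= D & forall tau, 0 < tau <= 1 ->
    `|G tau - \sum_(k < K.+1) tau ^+ k.*2.+1 * A k| <= D * tau ^+ K.*2.+3) ->
  (forall K, exists2 D, 0 <= D & forall tau, 0 < tau <= 1 ->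
    `|G tau - \sum_(k < K.+1) tau ^+ k.*2.+1 * A' k| <= D * tau ^+ K.*2.+3) ->
  forall k, A k = A' k.
Proof.
move=> hA hA' K; elim/ltn_ind: K => K IH.
have [D D0 DP] := hA K; have [D' D'0 D'P] := hA' K.
apply/eqP; rewrite -subr_eq0 -normr_eq0; apply/negP => /negP dn0.
set d := `|A K - A' K| in dn0; have d0 : 0 < d by rewrite lt_neqAle eq_sym dn0 /d normr_ge0.
pose E := D + D' + 1; have E0 : 0 < E by rewrite /E ltr_wpDl ?addr_ge0.
(* This choice gives (D + D') tau^2 <= E tau <= d / 2. *)
pose tau := Num.min 1 (d / (2 * E)).
have t0 : 0 < tau by rewrite lt_min ltr01 divr_gt0 // mulr_gt0.
have t1 : tau <= 1 by rewrite ge_min lexx.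
have td : tau * (2 * E) <= d by rewrite -ler_pdivlMr ?mulr_gt0 // ge_min lexx orbT.
have t01 : 0 < tau <= 1 by rewrite t0.
have key : tau ^+ K.*2.+1 * d <= (D + D') * tau ^+ K.*2.+3.
  have -> : tau ^+ K.*2.+1 * d = `|(G tau - \sum_(k < K.+1) tau ^+ k.*2.+1 * A' k) -
      (G tau - \sum_(k < K.+1) tau ^+ k.*2.+1 * A k)|.
    have sE : \sum_(k < K) tau ^+ k.*2.+1 * A k = \sum_(k < K) tau ^+ k.*2.+1 * A' k.
      by apply: eq_bigr => k _; rewrite IH.
    rewrite !big_ord_recr /= sE; set s := \sum_(_ < _) _; rewrite /d -[X in X * _]ger0_norm ?exprn_ge0 ?(ltW t0) // -normrM.
    by congr `|_|; ring.
  apply: le_trans (ler_normB _ _) _; rewrite mulrDl addrC.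
  by apply: lerD; [exact: DP|exact: D'P].
have p0 : 0 < tau ^+ K.*2.+1 by exact: exprn_gt0.
have {}key : d <= (D + D') * (tau * tau).
  by rewrite -(ler_pM2l p0); apply: le_trans key _; rewrite !exprS le_eqVlt; apply/orP; left; apply/eqP; ring.
have h1 : (D + D') * (tau * tau) <= E * tau.
  apply: ler_pM; rewrite ?addr_ge0 ?mulr_ge0 ?(ltW t0) //; first by rewrite /E lerDl.
  by rewrite -[X in _ <= X]mulr1 ler_pM2l.
have : tau * E <= d / 2 by lra.
by rewrite mulrC => h2; have : d <= d / 2 by [exact: le_trans key (le_trans h1 h2)]; lra.
Qed.

End Uniqueness.

(** The prefactor 1 / t of the heat kernel turns the odd powers of tau = sqrt t into the
    half-integer powers of the expansion. *)
Lemma sqrt_powR_div (R : realType) (t : R) k : 0 < t ->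
  t `^ (((2 * k)%N%:R - 1) / 2) = Num.sqrt t ^+ k.*2.+1 / t.
Proof.
move=> t0; rewrite -(powR12_sqrt (ltW t0)) -powR_mulrn ?powR_ge0 // -powRrM.
have -> : t^-1 = t `^ (- 1) by rewrite powRN powRr1 // ltW.
rewrite -powRD; last by rewrite (gt_eqF t0) implybT.
by congr (_ `^ _); rewrite -natr1 -muln2 mulnC; field.
Qed.

Section Main.
Context {R : realType}.
Local Notation mu := (@lebesgue_measure R).
Variables (Phi h : R * R -> R * R).
Hypothesis smooth_Phi : smooth Phi.
Local Notation M := (fixed_points Phi).
Local Notation S := (half_sqr_displacement Phi).
Hypothesis normal_h : unit_normal_field M h.
Hypothesis s2_gt0 : forall x, M x -> 0 < normal_derivative h S 2 x.
Variables (p r C : R).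
Hypotheses (p0 : 0 < p) (r0 : 0 < r) (C0 : 0 < C).
Hypothesis growth : forall x, r ^+ 2 / 2 < world_fun x 0 -> C * world_fun x 0 `^ p <= S x.

Lemma heat_kernel_integrable t : 0 < t -> theta_cvg Phi t.
Proof.
move=> t0; have a0 : 0 < (2 * t)^-1 by rewrite invr_gt0 mulr_gt0.
have Ei := integrable_exp_displacement smooth_Phi p0 r0 C0 growth a0.
have := integrableZl measurableT ((4 * pi * t)^-1) Ei.
by apply: eq_integrable => // x _; rewrite -EFinM /heat_kernel (mulrC (2 * t)^-1).
Qed.

Lemma thetaE t : 0 < t ->
  theta Phi t = (4 * pi * t)^-1 * \int[@plane_measure R]_x expR (- (S x / (2 * t))).
Proof.
move=> t0; have a0 : 0 < (2 * t)^-1 by rewrite invr_gt0 mulr_gt0.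
have Ei := integrable_exp_displacement smooth_Phi p0 r0 C0 growth a0.
rewrite -RintegralZl //.
by apply: eq_integrable Ei => // x _; rewrite /= mulrC.
Qed.

Definition arc_moment (L : R) (f : R -> R * R) (k : nat) : R :=
  \int[mu]_(y in `[0, L]) (laplace_moment (jet Phi h f y) (curvature h f y) k.*2 * `|speed h f y|).

Lemma arc_moment_eq L f L' f' k : closed_param M L f -> closed_param M L' f' ->
  arc_moment L f k = arc_moment L' f' k.
Proof.
move=> pf pf'; pose G tau := \int[@plane_measure R]_x expR (- (S x / (2 * tau ^+ 2))).
apply: (@odd_expansion_unique _ G) => K.
  exact: (displacement_integral_expansion smooth_Phi normal_h pf s2_gt0 p0 r0 C0 growth).
exact: (displacement_integral_expansion smooth_Phi normal_h pf' s2_gt0 p0 r0 C0 growth).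
Qed.

Lemma theta_expansion L f : closed_param M L f ->
  asymptotic_expansion (theta Phi) (fun k => (4 * pi)^-1 * arc_moment L f k).
Proof.
move=> pf K; have [D D0 DP] :=
  displacement_integral_expansion smooth_Phi normal_h pf s2_gt0 p0 r0 C0 growth K.
have pi40 : 0 < 4 * pi :> R by rewrite mulr_gt0 // pi_gt0.
apply/eqoP => e e0; near=> t.
have t0 : 0 < t by near: t; exact: nbhs_right_gt.
have t1 : t <= 1 by near: t; exact: nbhs_right_le.
(* The error relative to the last power is D t / (4 pi); D + 1 replaces D to have a positive
   denominator. *)
have te : t <= e * (4 * pi) / (D + 1).
  by near: t; apply: nbhs_right_le; rewrite divr_gt0 ?mulr_gt0 ?pi_gt0 // ltr_wpDl.
pose tau := Num.sqrt t.
have tau2 : tau ^+ 2 = t by rewrite sqr_sqrtr // ltW.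
have tau01 : 0 < tau <= 1 by rewrite sqrtr_gt0 t0 -sqrtr1 ler_wsqrtr.
have := DP tau tau01; rewrite tau2 => h1.
rewrite big_mkord thetaE //; under eq_bigr => k _ do rewrite sqrt_powR_div //.
rewrite sqrt_powR_div // -/tau.
set I0 := \int[_]_x _ in h1 *; set s := \sum_(_ < _) _ in h1.
have -> : \sum_(k < K.+1) tau ^+ k.*2.+1 / t * ((4 * pi)^-1 * arc_moment L f k) = (4 * pi * t)^-1 * s.
  rewrite /s mulr_sumr; apply: eq_bigr => k _; set X := arc_moment L f k.
  change (tau ^+ k.*2.+1 / t * ((4 * pi)^-1 * X) = (4 * pi * t)^-1 * (tau ^+ k.*2.+1 * X)).
  by rewrite (invfM (4 * pi) t); move: (4 * pi)^-1 => q; ring.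
rewrite -mulrBr normrM.
have pit : 0 < 4 * pi * t by rewrite mulr_gt0.
have /andP[tau0 _] := tau01.
have q0 : 0 <= tau ^+ K.*2.+1 / t by rewrite divr_ge0 ?exprn_ge0 // ltW.
rewrite gtr0_norm ?invr_gt0 // [X in _ <= _ * X]ger0_norm //.
apply: le_trans (ler_wpM2l _ h1) _; first by rewrite invr_ge0 ltW.
have -> : (4 * pi * t)^-1 * (D * tau ^+ K.*2.+3) = (D * t / (4 * pi)) * (tau ^+ K.*2.+1 / t).
  have -> : tau ^+ K.*2.+3 = t * tau ^+ K.*2.+1 by rewrite -[in RHS]tau2 -exprD add2n.
  by rewrite (invfM (4 * pi) t); move: (4 * pi)^-1 => q; ring.
apply: ler_wpM2r => //; rewrite ler_pdivrMr //.
have D1 : 0 < D + 1 by rewrite ltr_wpDl.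
rewrite ler_pdivlMr // in te; apply: le_trans te.
by rewrite mulrC ler_pM2l // lerDl.
Unshelve. all: by end_near. Qed.

Lemma curve_data_exists : curve_submanifold M -> M !=set0 -> compact M -> connected M ->
  exists (A : nat -> R) (a : nat -> R * R -> R),
    [/\ asymptotic_expansion (theta Phi) A,
        forall k, is_arc_integral M (a k) (A k) &
        forall k (L : R) (f : R -> R * R) (y : R), closed_param M L f ->
          a k (f y) = mpoly.meval
            (fun i : 'I_k.*2.+2 => local_data (curvature h f y) (jet Phi h f y) i) (@coeff_poly R k)].
Proof.
move=> subM M0 cM coM.
have [L0 [f0 pf0]] := closed_param_exists subM normal_h M0 cM coM.
(* The coefficients must be functions of the point, so the curvature is read at some parameter over
   x. By [curvature_eq] its value on the curve depends neither on this parameter nor on the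
   parametrization. *)
pose kappa x := curvature h f0 (xget 0 [set y | f0 y = x]).
pose a (k : nat) (x : R * R) := (4 * pi)^-1 * laplace_moment (fun j => normal_derivative h S j x) (kappa x) k.*2.
have aE k L f y : closed_param M L f ->
    a k (f y) = (4 * pi)^-1 * laplace_moment (jet Phi h f y) (curvature h f y) k.*2.
  move=> pf; have kE : kappa (f y) = curvature h f y; last by rewrite /a kE.
  apply: (curvature_eq normal_h pf0 pf).
  have [u _ fu] := param_surj pf0 (param_in pf y).
  exact: (@xgetI _ 0 [set v | f0 v = f y] u fu).
exists (fun k => (4 * pi)^-1 * arc_moment L0 f0 k), a; split.
- exact: theta_expansion.
- move=> k; split; first by exists L0, f0.
  move=> L f pf; rewrite (arc_moment_eq k pf0 pf) /arc_moment -RintegralZl.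
  + apply: eq_Rintegral => y _.
    by rewrite (aE _ _ _ _ pf) (normr_speed normal_h pf) mulrA.
  + exact: measurable_itv.
  + apply: continuous_compact_integrable; first exact: segment_compact.
    apply: continuous_subspaceT => y; apply: cvgM.
      exact: (continuous_moment smooth_Phi normal_h pf s2_gt0).
    by apply: cvg_norm; exact: (continuous_speed normal_h pf).
- move=> k L f y pf; rewrite (aE _ _ _ _ pf) coeff_polyE //.
  exact: (jet2_gt0 pf s2_gt0).
Qed.

End Main.

Theorem theorem3p1 (R : realType) :
  exists (n : nat -> nat) (P : forall k : nat, mpoly.mpoly (n k) R),
  forall (Phi h : R * R -> R * R),
    smooth Phi ->
    curve_submanifold (fixed_points Phi) ->
    fixed_points Phi !=set0 ->
    compact (fixed_points Phi) ->
    connected (fixed_points Phi) ->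
    (exists p r C : R, [/\ 0 < p, 0 < r & 0 < C] /\
       forall x : R * R, r ^+ 2 / 2 < world_fun x 0 ->
         C * world_fun x 0 `^ p <= half_sqr_displacement Phi x) ->
    unit_normal_field (fixed_points Phi) h ->
    (forall x, fixed_points Phi x -> 0 < normal_derivative h (half_sqr_displacement Phi) 2 x) ->
    (forall t : R, 0 < t -> theta_cvg Phi t) /\
    exists (A : nat -> R) (a : nat -> R * R -> R),
      [/\ asymptotic_expansion (theta Phi) A,
          (forall k, is_arc_integral (fixed_points Phi) (a k) (A k)) &
          (forall k (L : R) (f : R -> R * R) (y : R),
             closed_param (fixed_points Phi) L f ->
             a k (f y) =
             mpoly.meval
               (fun i : 'I_(n k) =>
                  local_data (curvature h f y)
                    (fun j => normal_derivative h (half_sqr_displacement Phi) j (f y)) i)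
               (P k))].
Proof.
(* The variables for index k are kappa, s_2^(-1/2) and s_3, ..., s_(2 k + 2), which makes 2 k + 2 of
   them. *)
exists (fun k => k.*2.+2), (@coeff_poly R) => Phi h sPhi subM M0 cM coM [p [r [C [[p0 r0 C0] growth]]]] nh s2.
split; first by move=> t; exact: (heat_kernel_integrable sPhi p0 r0 C0 growth).
exact: (curve_data_exists sPhi nh s2 p0 r0 C0 growth subM M0 cM coM).
Qed.
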